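(* For every $1\le p<\infty$, the vertical sliced Wasserstein distance $\mathrm{VSW}_p$ is a metric on the set $\mathcal P(\mathbb S^2)\cap\mathcal M_{\mathrm{sym}}(\mathbb S^2)$ of even probability measures on $\mathbb S^2$, and the semicircular sliced Wasserstein distance $\mathrm{SSW}_p$ is a metric on the set $\mathcal P(\mathbb S^2)$ of probability measures on $\mathbb S^2$.
   Context: $\mathcal M(X)$ and $\mathcal P(X)$ denote the finite signed Borel measures and the Borel probability measures on a compact metric space $(X,d)$. The $p$-Wasserstein distance of $\mu,\nu\in\mathcal P(X)$ is $\mathrm W_p(\mu,\nu)=\big(\min_\pi\int_{X\times X}d(x,y)^p\,d\pi(x,y)\big)^{1/p}$, the minimum being over all couplings $\pi$ of $\mu$ and $\nu$. Let $\mathbb I=[-1,1]$ with $d(x,y)=|x-y|$ and $\mathbb T=\mathbb R/(2\pi\mathbb Z)$ with $d(x,y)=\min_{k\in\mathbb Z}|x-y+2\pi k|$; $d\psi$ is Lebesgue measure on $\mathbb T$ (total mass $2\pi$). $\mathbb S^2\subset\mathbb R^3$ is the unit sphere with surface measure $\sigma_{\mathbb S^2}$. Even measures: $\mathcal M_{\mathrm{sym}}(\mathbb S^2)=\{\mu\in\mathcal M(\mathbb S^2):\langle\mu,f\rangle=\langle\mu,\check f\rangle\ \forall f\in C(\mathbb S^2)\}$, where $\check f(\xi)=f(\xi_1,\xi_2,-\xi_3)$. Vertical slices: $\mathcal S_\psi\colon\mathbb S^2\to\mathbb I$, $\mathcal S_\psi(\xi)=\xi_1\cos\psi+\xi_2\sin\psi$,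 and $\mathcal V_\psi\mu=(\mathcal S_\psi)_\#\mu=\mu\circ\mathcal S_\psi^{-1}$ for $\psi\in\mathbb T$. Then $$\mathrm{VSW}_p^p(\mu,\nu)=\int_{\mathbb T}\mathrm W_p^p(\mathcal V_\psi\mu,\mathcal V_\psi\nu)\,d\psi .$$ Semicircles: $\Phi(\varphi,\vartheta)=(\cos\varphi\sin\vartheta,\sin\varphi\sin\vartheta,\cos\vartheta)$; the azimuth $\mathrm{azi}(\xi)\in\mathbb T$ is given by $\mathrm{azi}(\Phi(\varphi,\vartheta))=\varphi$ for $\vartheta\in(0,\pi)$ and $\mathrm{azi}=0$ at the two poles. $\Psi(\alpha,\beta,\gamma)=R_3(\alpha)R_2(\beta)R_3(\gamma)\in\mathrm{SO}(3)$ with $$R_3(\alpha)=\begin{pmatrix}\cos\alpha&-\sin\alpha&0\\ \sin\alpha&\cos\alpha&0\\0&0&1\end{pmatrix},\quad R_2(\beta)=\begin{pmatrix}\cos\beta&0&\sin\beta\\0&1&0\\-\sin\beta&0&\cos\beta\end{pmatrix}.$$ $\mathcal A_{\alpha,\beta}(\xi)=\mathrm{azi}(\Psi(\alpha,\beta,0)^\top\xi)$, $\mathcal W_{\alpha,\beta}\mu=(\mathcal A_{\alpha,\beta})_\#\mu\in\mathcal M(\mathbb T)$, and $$\mathrm{SSW}_p^p(\mu,\nu)=\int_{\mathbb S^2}\mathrm W_p^p(\mathcal W_{\alpha,\beta}\mu,\mathcal W_{\alpha,\beta}\nu)\,d\sigma_{\mathbb S^2}(\Phi(\alpha,\beta)).$$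 *)

(* Defs.v *)
From HB Require Import structures.
From mathcomp Require Import all_boot all_order all_algebra.
From mathcomp Require Import all_classical all_reals all_analysis.
From mathcomp Require Import measurable_realfun giry.
From mathcomp Require Import ring.

Set Implicit Arguments.
Unset Strict Implicit.
Unset Printing Implicit Defensive.

Import Order.TTheory GRing.Theory Num.Theory.
Import numFieldNormedType.Exports.

Local Open Scope classical_set_scope.
Local Open Scope ring_scope.

Section Wasserstein.
Context d (X : measurableType d) (R : realType).

(* For compact metric spaces the product sigma-algebra on [X * X] is the Borel
   one. *)
Definition coupling (mu nu : set X -> \bar R) : set (probability (X * X)%type R) :=
  [set gamma | forall A : set X, measurable A ->
     gamma (A `*` setT) = mu A /\ gamma (setT `*` A) = nu A].

(* The minimum over couplings is attained, so it is written as an infimum. *)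
Definition wasserstein (dist : X -> X -> R) (p : R) (mu nu : set X -> \bar R)
    : \bar R :=
  ((ereal_inf [set \int[gamma]_z (dist z.1 z.2 `^ p)%:E
              | gamma in coupling mu nu]) `^ p^-1)%E.

(* Measures are compared on measurable sets only ([measure_eq]): they are total
   functions whose values on other sets carry no meaning. *)
Definition is_metric_on (P : set (probability X R))
    (D : probability X R -> probability X R -> \bar R) : Prop :=
  [/\ forall mu nu, P mu -> P nu -> (0 <= D mu nu < +oo)%E,
      forall mu nu, P mu -> P nu -> (D mu nu = 0%E <-> measure_eq mu nu),
      forall mu nu, P mu -> P nu -> D mu nu = D nu mu &
      forall mu nu la, P mu -> P nu -> P la ->
        (D mu la <= D mu nu + D nu la)%E].

End Wasserstein.

Section Interval.
Variable R : realType.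

Definition intervalI : Type := (`[-1, 1]%classic : set R).

HB.instance Definition _ := Topological.copy intervalI (`[-1, 1]%classic : set R).

Fact interval0_subproof : (0 : R) \in (`[-1, 1]%classic : set R).
Proof. by rewrite inE/= in_itv/= lerN10 ler01. Qed.

HB.instance Definition _ :=
  isPointed.Build intervalI (exist _ 0 interval0_subproof).
HB.instance Definition _ :=
  Measurable.copy intervalI (g_sigma_algebraType (@open intervalI)).

Definition interval_dist (x y : intervalI) : R := `|val x - val y|.

End Interval.

Section Circle.
Variable R : realType.

Definition circle_rel (x y : R) : bool :=
  `[< exists k : int, x - y = 2 * pi * k%:~R >].

Fact circle_rel_refl : reflexive circle_rel.
Proof. by move=> x; apply/asboolP; exists 0; rewrite subrr mulr0. Qed.

Fact circle_rel_sym : symmetric circle_rel.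
Proof.
move=> x y; apply/asboolP/asboolP => -[k xy]; exists (- k);
  by rewrite mulrNz mulrN -xy opprB.
Qed.

Fact circle_rel_trans : transitive circle_rel.
Proof.
move=> y x z /asboolP[k xy] /asboolP[l yz]; apply/asboolP; exists (k + l).
by rewrite intrD mulrDr -xy -yz addrA subrK.
Qed.

Canonical circle_equiv :=
  EquivRel circle_rel circle_rel_refl circle_rel_sym circle_rel_trans.

Definition circle : Type := {eq_quot circle_equiv}%qT.

HB.instance Definition _ := Topological.copy circle (quotient_topology circle).
HB.instance Definition _ := Quotient.on circle.
HB.instance Definition _ := isPointed.Build circle (\pi_circle 0)%qT.
HB.instance Definition _ :=
  Measurable.copy circle (g_sigma_algebraType (@open circle)).

Definition to_circle (x : R) : circle := (\pi_circle x)%qT.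

Lemma measurable_to_circle : measurable_fun [set: R] to_circle.
Proof.
apply: (@measurability _ _ R circle setT to_circle (@open circle)) => //.
by move=> _ [U oU <-]; rewrite setTI; apply: open_measurable.
Qed.

Definition circle_dist (x y : circle) : R :=
  inf [set `|repr x - repr y + 2 * pi * k%:~R| | k in [set: int]].

Definition circle_measure : set circle -> \bar R :=
  pushforward (mrestr lebesgue_measure (measurable_itv `[0, 2 * pi[)) to_circle.

Fact circle_measure0 : circle_measure set0 = 0%E.
Proof. by rewrite /circle_measure /pushforward preimage_set0 measure0. Qed.

Fact circle_measure_ge0 (A : set circle) : (0 <= circle_measure A)%E.
Proof. by rewrite /circle_measure /pushforward /mrestr measure_ge0. Qed.

Fact circle_measure_sigma_additive : semi_sigma_additive circle_measure.
Proof.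
apply: (@measure_semi_sigma_additive _ _ _ (pushforward
  (mrestr lebesgue_measure (measurable_itv `[0, 2 * pi[)) to_circle)).
exact: measurable_to_circle.
Qed.

HB.instance Definition _ := isMeasure.Build _ _ _ circle_measure
  circle_measure0 circle_measure_ge0 circle_measure_sigma_additive.

End Circle.

Section Sphere.
Variable R : realType.

Definition unit_sphere : set 'cV[R]_3 :=
  [set v | v 0 0 ^+ 2 + v 1 0 ^+ 2 + v 2 0 ^+ 2 = 1].

Definition sphere : Type := unit_sphere.

Definition vec3 (x y z : R) : 'cV[R]_3 := \col_(i < 3) [:: x; y; z]`_i.

Definition Phi (phi theta : R) : 'cV[R]_3 :=
  vec3 (cos phi * sin theta) (sin phi * sin theta) (cos theta).

Fact Phi_subproof phi theta : Phi phi theta \in unit_sphere.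
Proof.
rewrite inE /unit_sphere/= !mxE/=.
have c := cos2Dsin2 phi; have d := cos2Dsin2 theta.
by rewrite !exprMn -mulrDl c mul1r addrC.
Qed.

Definition Phi_sphere (z : R * R) : sphere :=
  exist _ (Phi z.1 z.2) (Phi_subproof z.1 z.2).

HB.instance Definition _ := Topological.copy sphere (unit_sphere : Type).
HB.instance Definition _ := isPointed.Build sphere (Phi_sphere (0, 0)).
HB.instance Definition _ :=
  Measurable.copy sphere (g_sigma_algebraType (@open sphere)).

Fact reflect_subproof (xi : sphere) :
  vec3 (val xi 0 0) (val xi 1 0) (- val xi 2 0) \in unit_sphere.
Proof.
case: xi => v /= vS; rewrite inE /unit_sphere/= !mxE/= sqrrN.
by move: vS; rewrite inE.
Qed.

Definition reflect_sphere (xi : sphere) : sphere :=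
  exist (fun v => v \in unit_sphere) _ (reflect_subproof xi).

Definition even_probability : set (probability sphere R) :=
  [set mu | forall f : sphere -> R, continuous f ->
    (\int[mu]_xi (f xi)%:E = \int[mu]_xi (f (reflect_sphere xi))%:E)%E].

Fact slice_subproof (psi : R) (xi : sphere) :
  val xi 0 0 * cos psi + val xi 1 0 * sin psi \in (`[-1, 1]%classic : set R).
Proof.
case: xi => v vS; rewrite inE/= in_itv/=.
have vS1 : v 0 0 ^+ 2 + v 1 0 ^+ 2 + v 2 0 ^+ 2 = 1 by exact: set_mem vS.
have := cos2Dsin2 psi; move: vS1 => {vS}.
move: (v 0 0) (v 1 0) (v 2 0) (cos psi) (sin psi) => a b z c s H1 H2.
have Ha : (a * c + b * s) ^+ 2 <= 1.
  have -> : (a * c + b * s) ^+ 2 = 1 - z ^+ 2 - (a * s - b * c) ^+ 2.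
    transitivity ((a ^+ 2 + b ^+ 2) * (c ^+ 2 + s ^+ 2) - (a * s - b * c) ^+ 2).
      by ring.
    by rewrite H2 mulr1 -H1 addrK.
  by rewrite -addrA -opprD gerBl addr_ge0// sqr_ge0.
by rewrite -ler_norml -(@expr_le1 _ 2)// real_normK// num_real.
Qed.

Definition slice (psi : circle R) (xi : sphere) : intervalI R :=
  exist (fun x => x \in (`[-1, 1]%classic : set R)) _
    (slice_subproof (repr psi) xi).

Definition VSW (p : R) (mu nu : probability sphere R) : \bar R :=
  ((\int[@circle_measure R]_psi
      (wasserstein (@interval_dist R) p
        (pushforward mu (slice psi)) (pushforward nu (slice psi)) `^ p))
   `^ p^-1)%E.

Definition azi (v : 'cV[R]_3) : circle R :=
  xget (to_circle 0)
    [set x | exists phi theta,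
       [/\ 0 < theta < pi, v = Phi phi theta & x = to_circle phi]].

Definition rot3 (a : R) : 'M[R]_3 := \matrix_(i < 3, j < 3)
  (nth [::] [:: [:: cos a; - sin a; 0];
                [:: sin a;   cos a; 0];
                [:: 0;           0; 1]] i)`_j.

Definition rot2 (b : R) : 'M[R]_3 := \matrix_(i < 3, j < 3)
  (nth [::] [:: [::   cos b; 0; sin b];
                [::       0; 1;     0];
                [:: - sin b; 0; cos b]] i)`_j.

Definition Psi (a b c : R) : 'M[R]_3 := rot3 a *m rot2 b *m rot3 c.

Definition semicircle (a b : R) (xi : sphere) : circle R :=
  azi ((Psi a b 0)^T *m val xi).

Local Notation leb2 := (@lebesgue_measure R \x @lebesgue_measure R)%E.

Definition angles : set (R * R) := `[0, 2 * pi[%classic `*` `[0, pi]%classic.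

(* The surface area element in spherical coordinates is
   [sin theta dphi dtheta]. *)
Definition sphere_measure (A : set sphere) : \bar R :=
  (\int[leb2]_(z in angles `&` Phi_sphere @^-1` A) (sin z.2)%:E)%E.

Definition polar (v : 'cV[R]_3) : R := acos (v 2 0).

Lemma measurable_preimage_open d (T : measurableType d) (f : T -> 'cV[R]_3)
    (V : set 'cV[R]_3) :
  (forall i, measurable_fun setT (fun t => f t i 0)) -> open V ->
  measurable (f @^-1` V).
Proof.
move=> mf oV.
pose box (k : {ffun 'I_3 -> rat} * nat) : set 'cV[R]_3 :=
  [set v | forall i, `|v i 0 - ratr (k.1 i)| < k.2.+1%:R^-1].
have VE : V = \bigcup_(k in [set k | box k `<=` V]) box k.
  apply/seteqP; split => [v Vv|v [k /= kV /kV//]].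
  have /nbhs_ballP[e /= e0 eV] : nbhs v V by exact: open_nbhs_nbhs.
  have [n ne] : exists n : nat, n.+1%:R^-1 < e / 2.
    have e20 : 0 < e / 2 by rewrite divr_gt0.
    have [n _ /(_ n (leqnn _)) h] := near_infty_natSinv_lt (PosNum e20).
    by exists n.
  have n0 : 0 < n.+1%:R^-1 :> R by rewrite invr_gt0.
  have /choice[q qv] : forall i, exists q, `|v i 0 - ratr q| < n.+1%:R^-1.
    move=> i; have /rat_in_itvoo[q] : v i 0 - n.+1%:R^-1 < v i 0 + n.+1%:R^-1.
      by rewrite ltrD2l gtrN.
    rewrite in_itv/= => /andP[q1 q2]; exists q.
    by rewrite distrC ltr_distl q1.
  exists ([ffun i => q i], n) => [w bw|i /=]; last by rewrite ffunE.
  apply: eV; split => // i j; rewrite ord1 /ball/=.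
  have := bw i; rewrite /= ffunE => wq; move: (qv i) => vq.
  rewrite (le_lt_trans (ler_distD (ratr (q i)) _ _))//.
  by rewrite (splitr e) ltrD// (lt_trans _ ne)// distrC.
rewrite VE preimage_bigcup bigcup_mkcond.
apply: countable_bigcupT_measurable => // k; case: ifPn => // _.
have -> : f @^-1` box k = \bigcap_(i in [set: 'I_3])
    ((fun t => `|f t i 0 - ratr (k.1 i)|) @^-1` `]-oo, k.2.+1%:R^-1[).
  by apply/seteqP; split => [t bt i _|t bt i] /=;
    [rewrite in_itv/=|have := bt i I; rewrite /= in_itv/=].
apply: fin_bigcap_measurable => // i _; rewrite -[X in measurable X]setTI.
have : measurable_fun setT (fun t => `|f t i 0 - ratr (k.1 i)|).
  by apply: measurableT_comp => //; exact: measurable_funB.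
by apply.
Qed.

Lemma measurable_Phi_sphere : measurable_fun [set: R * R] Phi_sphere.
Proof.
apply: (@measurability _ _ (R * R)%type sphere setT Phi_sphere (@open sphere)) => //.
move=> _ [U [V oV <-] <-]; rewrite setTI -comp_preimage.
apply: measurable_preimage_open => // i.
have mcos : measurable_fun setT (@cos R).
  by apply: continuous_measurable_fun => x; exact: continuous_cos.
have msin : measurable_fun setT (@sin R).
  by apply: continuous_measurable_fun => x; exact: continuous_sin.
have mc1 : measurable_fun setT (fun z : R * R => cos z.1).
  exact: measurableT_comp.
have ms1 : measurable_fun setT (fun z : R * R => sin z.1).
  exact: measurableT_comp.
have mc2 : measurable_fun setT (fun z : R * R => cos z.2).
  exact: measurableT_comp.
have ms2 : measurable_fun setT (fun z : R * R => sin z.2).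
  exact: measurableT_comp.
case: i => -[|[|[|//]]] ?.
- apply: (eq_measurable_fun (fun z => cos z.1 * sin z.2)).
    by move=> z _; rewrite /= mxE.
  exact: measurable_funM.
- apply: (eq_measurable_fun (fun z => sin z.1 * sin z.2)).
    by move=> z _; rewrite /= mxE.
  exact: measurable_funM.
- apply: (eq_measurable_fun (fun z => cos z.2)) => //.
  by move=> z _; rewrite /= mxE.
Qed.

Lemma measurable_angles : measurable angles.
Proof. exact: measurableX. Qed.

Fact angles_sin_ge0 z : angles z -> (0 <= (sin z.2)%:E)%E.
Proof. by case=> _ /=; rewrite in_itv/= lee_fin => z2; exact: sin_ge0_pi. Qed.

Fact sphere_measure0 : sphere_measure set0 = 0%E.
Proof. by rewrite /sphere_measure preimage_set0 setI0 integral_set0. Qed.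

Fact sphere_measure_ge0 (A : set sphere) : (0 <= sphere_measure A)%E.
Proof. by apply: integral_ge0 => z [/angles_sin_ge0]. Qed.

Fact sphere_measure_sigma_additive : semi_sigma_additive sphere_measure.
Proof.
move=> F mF tF _; rewrite /sphere_measure preimage_bigcup setI_bigcupr.
have mpre i : measurable (angles `&` Phi_sphere @^-1` F i).
  apply: measurableI; first exact: measurable_angles.
  by rewrite -[X in measurable X]setTI; exact: measurable_Phi_sphere.
rewrite ge0_integral_bigcup//.
- apply: is_cvg_ereal_nneg_natsum_cond => n _ _.
  by apply: integral_ge0 => z [/angles_sin_ge0].
- apply: measurable_funTS; apply/measurable_EFinP.
  apply: measurableT_comp => //.
  by apply: continuous_measurable_fun => x; exact: continuous_sin.
- by move=> z [i _ [/angles_sin_ge0]].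
- apply/trivIsetP => i j _ _ ij; rewrite setIACA -preimage_setI.
  by move/trivIsetP : tF => ->//; rewrite preimage_set0 setI0.
Qed.

HB.instance Definition _ := isMeasure.Build _ _ _ sphere_measure
  sphere_measure0 sphere_measure_ge0 sphere_measure_sigma_additive.

(* [Phi alpha beta = zeta] for [alpha := repr (azi zeta)] and
   [beta := polar zeta], except that at the poles (a null set) alpha, which is
   then arbitrary, is a representative of 0. *)
Definition SSW (p : R) (mu nu : probability sphere R) : \bar R :=
  ((\int[sphere_measure]_zeta
      (let A := semicircle (repr (azi (val zeta))) (polar (val zeta)) in
       wasserstein (@circle_dist R) p (pushforward mu A) (pushforward nu A)
         `^ p))
   `^ p^-1)%E.

End Sphere.

(* Main.v *)
From HB Require Import structures.
Require Import Defs.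
From mathcomp Require Import all_boot all_order all_algebra.
From mathcomp Require Import all_classical all_reals all_analysis.
From mathcomp Require Import measurable_realfun giry.
From mathcomp Require Import ring lra.

(** Both distances have the form [(int_z W_p(A_z mu, A_z nu)^p dm(z))^(1/p)] for
a family of maps [A_z] from the sphere to a metric space, the interval or the
circle.

For such a family most of the metric axioms are general: [W_p] is a bounded
metric on probabilities, and Minkowski's inequality for the measure [m] carries
the triangle inequality to the integral ([sliced_wasserstein_metric]).  The
triangle inequality of [W_p] itself needs two couplings to be glued along their
common marginal.  As [W_p] is an infimum, an approximate gluing is enough: the
space is cut into finitely many cells of diameter at most [e], and the couplings
are made conditionally independent given the cell of the middle point
([gluing_by_labels]).  This is an exact coupling of the outer marginals and costs
only an extra [e].

Two things depend on the family: the integrand must be measurable, and its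
vanishing almost everywhere must force [mu = nu].

Vertical slices depend on the angle in a Lipschitz way, so the integrand is
continuous, and if it vanishes almost everywhere it vanishes everywhere.  Then
all the linear functionals of [(xi_1, xi_2)] have the same law under [mu] and
[nu], and so does [(xi_1, xi_2)] by the Cramer-Wold theorem ([cramer_wold]).  An
even measure gives the two open hemispheres above and below the equator mirror
images of each other, and on each of them the third coordinate is a function of
the first two, so that the law of [(xi_1, xi_2)] determines the measure
([even_measure_eq]).

For semicircles the azimuth about an axis [zeta] is discontinuous at
[zeta] and [- zeta], so the integrand is continuous at [zeta] only if these
points are not atoms of [mu] or [nu] ([axis_wasserstein_cvg]).  The excluded axes
are countable, hence null, and the integrand is still measurable and still
vanishes at every other axis ([axis_wasserstein_eq0]).  For such an axis the
law of the azimuth determines the measure of every lune with vertices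
[zeta] and [- zeta].  Now fix an open hemisphere with centre [e] and map it to the
plane by the gnomonic projection from the centre of the sphere.  Great
semicircles become lines, and an axis orthogonal to [e] is a direction of
parallel lines, so the azimuth about that axis gives the law of one linear
functional of the planar measure.  All directions but countably many are
obtained, the others follow by continuity, and Cramer-Wold identifies [mu] and
[nu] on the hemisphere ([agree_on_hemisphere]).  Six hemispheres cover the
sphere. *)

Set Implicit Arguments.
Unset Strict Implicit.
Unset Printing Implicit Defensive.

Import Order.TTheory GRing.Theory Num.Theory.
Import numFieldNormedType.Exports.

Local Open Scope classical_set_scope.
Local Open Scope ring_scope.

(** * Couplings of probability measures *)

Section Packing.
Context d (T : measurableType d) (R : realType).

(** The proof of total mass 1 is an argument so that the probability structure
    can be inferred from the term. *)
Definition probability_of (m : {measure set T -> \bar R})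
  (m1 : m setT = 1%E) : set T -> \bar R := m.

Section instances.
Context (m : {measure set T -> \bar R}) (m1 : m setT = 1%E).

HB.instance Definition _ := Measure.copy (probability_of m1) m.
HB.instance Definition _ :=
  Measure_isProbability.Build _ _ _ (probability_of m1) m1.

End instances.

Lemma measurable_preimage d' (T' : measurableType d') (f : T -> T') A :
  measurable_fun setT f -> measurable A -> measurable (f @^-1` A).
Proof. by move=> mf mA; rewrite -[X in measurable X]setTI; exact: mf. Qed.

Lemma pushforward_probability d' (T' : measurableType d') (P : probability T R)
    (f : T -> T') : measurable_fun setT f ->
  exists Q : probability T' R, Q = pushforward P f :> (set T' -> \bar R).
Proof.
move=> mf; pose F : {mfun T >-> T'} := HB.pack f (isMeasurableFun.Build _ _ _ _ f mf).
by exists (distribution P F).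
Qed.

End Packing.

Section Gluing.
Context d1 d2 (T1 : measurableType d1) (T2 : measurableType d2) (R : realType).

(** Conditionally on the value of the labels the two coordinates are taken
    independent: on the box of label [i] the measure is the product measure
    divided by the common probability [q i] of that label. *)
Lemma gluing_by_labels (g1 : probability T1 R) (g2 : probability T2 R)
    (n : nat) (c1 : T1 -> nat) (c2 : T2 -> nat) :
  (forall i, measurable (c1 @^-1` [set i])) ->
  (forall i, measurable (c2 @^-1` [set i])) ->
  (forall t, (c1 t < n)%N) -> (forall t, (c2 t < n)%N) ->
  (forall i, g1 (c1 @^-1` [set i]) = g2 (c2 @^-1` [set i])) ->
  exists Th : probability (T1 * T2)%type R,
    [/\ forall A, measurable A -> Th (A `*` setT) = g1 A,
        forall B, measurable B -> Th (setT `*` B) = g2 B &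
        Th [set t | c1 t.1 <> c2 t.2] = 0%E].
Proof.
move=> mc1 mc2 c1n c2n c12.
pose q i := fine (g1 (c1 @^-1` [set i])).
have qE i : g1 (c1 @^-1` [set i]) = (q i)%:E.
  by rewrite /q fineK// fin_num_measure.
have q0 i : 0 <= (q i)^-1 by rewrite invr_ge0 fine_ge0.
pose box i := (c1 @^-1` [set i]) `*` (c2 @^-1` [set i]) : set (T1 * T2).
have mbox i : measurable (box i) by exact: measurableX.
pose th := msum (fun i => mscale (NngNum (q0 i)) (mrestr (g1 \x g2)%E (mbox i))) n.
have split_n d (T : measurableType d) (g : probability T R) (c : T -> nat) A :
    (forall i, measurable (c @^-1` [set i])) -> (forall t, (c t < n)%N) ->
    measurable A ->
    g A = (\sum_(i < n) g (A `&` c @^-1` [set nat_of_ord i]))%E.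
  move=> mc cn mA.
  have mAi (i : 'I_n) : measurable (A `&` c @^-1` [set nat_of_ord i]).
    exact: measurableI.
  rewrite -measure_bigsetU_ord//; last first.
    by apply/trivIsetP => i j _ _ /eqP ij; rewrite -subset0 => t /=
      [[_ h] [_ k]]; apply: ij; apply: val_inj; rewrite /= -h -k.
  congr (g _); rewrite -(bigcup_mkord n (fun i => A `&` c @^-1` [set i])).
  by apply/seteqP; split => [t At|t [i _ []//]]; exists (c t) => //=.
have thE A B : measurable A -> measurable B ->
    th (A `*` B) = (\sum_(i < n) ((q i)^-1)%:E *
      (g1 (A `&` c1 @^-1` [set nat_of_ord i]) *
       g2 (B `&` c2 @^-1` [set nat_of_ord i])))%E.
  move=> mA mB; rewrite /th/= /msum; apply: eq_bigr => i _.
  rewrite -product_measure1E; [|exact: measurableI..].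
  by rewrite setXI.
have le_q0 d (T : measurableType d) (g : probability T R) (A C : set T) :
    measurable A -> measurable C -> g C = 0%E -> g (A `&` C) = 0%E.
  move=> mA mC g0; apply/eqP; rewrite eq_le measure_ge0 andbT -g0.
  by apply: le_measure; rewrite ?inE//; exact: measurableI.
have th1 A : measurable A -> th (A `*` setT) = g1 A.
  move=> mA; rewrite thE// (split_n _ _ g1 c1 A)//; apply: eq_bigr => i _.
  rewrite setTI -c12 qE; have [q0i|q0i] := eqVneq (q i) 0.
    (* a label of probability 0 contributes nothing to either side *)
    by rewrite q0i invr0 mul0e le_q0// qE q0i.
  by rewrite muleC -muleA -EFinM divff// mule1.
have th2 B : measurable B -> th (setT `*` B) = g2 B.
  move=> mB; rewrite thE// (split_n _ _ g2 c2 B)//; apply: eq_bigr => i _.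
  rewrite setTI qE; have [q0i|q0i] := eqVneq (q i) 0.
    by rewrite q0i invr0 mul0e le_q0// -c12 qE q0i.
  by rewrite muleA -EFinM mulVf// mul1e.
have thT : th setT = 1%E by rewrite -setXTT th1// probability_setT.
exists (probability_of thT); split => //.
rewrite /= /probability_of /th /= /msum big1// => i _.
have E : [set t : T1 * T2 | c1 t.1 <> c2 t.2] `&` box i = set0.
  by rewrite -subset0 => t [/= h [/= e1 e2]]; apply: h; rewrite e1 e2.
change (((q i)^-1)%:E *
  (g1 \x g2) ([set t : T1 * T2 | c1 t.1 <> c2 t.2] `&` box i) = 0)%E.
by rewrite E measure0 mule0.
Qed.

End Gluing.

(** * The Wasserstein distance *)

Section Lp.
Context d (T : measurableType d) (R : realType) (p : R).
Hypothesis p1 : 1 <= p.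

Let p0 : 0 < p. Proof. exact: lt_le_trans p1. Qed.

Definition Lp (m : {measure set T -> \bar R}) (f : T -> R) : \bar R :=
  ((\int[m]_x (f x `^ p)%:E) `^ p^-1)%E.

Lemma measurable_EFin_powR (f : T -> R) : measurable_fun setT f ->
  measurable_fun setT (fun x => (f x `^ p)%:E).
Proof.
move=> mf; apply/measurable_EFinP.
exact: (@measurableT_comp _ _ _ _ _ _ (@powR R ^~ p)).
Qed.

Lemma Lp_ge0 m f : (0 <= Lp m f)%E.
Proof. exact: poweR_ge0. Qed.

Lemma Lp_le (m : {measure set T -> \bar R}) (f g : T -> R) : measurable_fun setT f -> measurable_fun setT g ->
  (forall x, 0 <= f x <= g x) -> (Lp m f <= Lp m g)%E.
Proof.
move=> mf mg fg; have [f0 g0] : (forall x, 0 <= f x) /\ forall x, 0 <= g x.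
  split=> x; have /andP[f0 fgx] := fg x => //; exact: le_trans fgx.
rewrite /Lp gt0_ler_poweR ?invr_ge0 ?(ltW p0)//.
- by rewrite in_itv/= leey andbT integral_ge0// => x _; rewrite lee_fin powR_ge0.
- by rewrite in_itv/= leey andbT integral_ge0// => x _; rewrite lee_fin powR_ge0.
apply: ge0_le_integral => //; try exact: measurable_EFin_powR.
- by move=> x _; rewrite lee_fin powR_ge0.
- move=> x _; rewrite lee_fin ge0_ler_powR ?(ltW p0) ?nnegrE//.
  by have /andP[] := fg x.
Qed.

Lemma Lp_minkowski (m : {measure set T -> \bar R}) (f g : T -> R) : measurable_fun setT f -> measurable_fun setT g ->
  (forall x, 0 <= f x) -> (forall x, 0 <= g x) ->
  (Lp m (fun x => (f x + g x)%R) <= Lp m f + Lp m g)%E.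
Proof.
move=> mf mg f0 g0.
have E h : (forall x, 0 <= h x) -> Lp m h = Lnorm m p%:E (EFin \o h).
  move=> h0; rewrite unlock /Lp; congr (_ `^ _)%E.
  by apply: eq_integral => x _ /=; rewrite ger0_norm// poweR_EFin.
rewrite !E//; first exact: minkowski_EFin.
by move=> x; rewrite addr_ge0.
Qed.

Lemma Lp_le_cst (m : probability T R) (f : T -> R) (c : R) (N : set T) :
  measurable_fun setT f ->
  (forall x, 0 <= f x) -> 0 <= c -> measurable N -> m N = 0%E ->
  (forall x, ~ N x -> f x <= c) -> (Lp m f <= c%:E)%E.
Proof.
move=> mf f0 c0 mN N0 fc.
have -> : (c%:E = (c `^ p)%:E `^ p^-1)%E.
  by rewrite poweR_EFin -powRrM mulfV ?gt_eqF// powRr1.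
rewrite /Lp gt0_ler_poweR ?invr_ge0 ?(ltW p0)//.
- by rewrite in_itv/= leey andbT integral_ge0// => x _; rewrite lee_fin powR_ge0.
- by rewrite in_itv/= leey andbT lee_fin powR_ge0.
apply: (@le_trans _ _ (\int[m]_x (c `^ p)%:E)%E); last first.
  by rewrite integral_cst//= probability_setT mule1.
apply: ae_ge0_le_integral => //; try exact: measurable_EFin_powR.
- by move=> x _; rewrite lee_fin powR_ge0.
- by move=> x _; rewrite lee_fin powR_ge0.
- exists N; split => // x /= h; apply: contrapT => Nx; apply: h => _.
  by rewrite lee_fin ge0_ler_powR ?(ltW p0) ?nnegrE// fc.
Qed.

End Lp.

Lemma Lp_pushforward d d' (T : measurableType d) (T' : measurableType d')
    (R : realType) (p : R) (m : {measure set T -> \bar R})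
    (m' : {measure set T' -> \bar R}) (phi : T -> T') (f : T' -> R) :
  measurable_fun setT phi ->
  (forall A, measurable A -> m' A = m (phi @^-1` A)) -> measurable_fun setT f ->
  Lp p m' f = Lp p m (f \o phi).
Proof.
move=> mphi mm' mf; rewrite /Lp; congr (_ `^ _)%E.
rewrite (eq_measure_integral (pushforward m phi)); last by move=> A mA _; rewrite mm'.
rewrite ge0_integral_pushforward//; first exact: measurable_EFin_powR.
by move=> x _; rewrite lee_fin powR_ge0.
Qed.

(** What the theory of [W_p] below uses of a compact metric space.  The function
    [coord] is a bounded real coordinate whose increments dominate the distance:
    cutting its range into short intervals gives the finite partitions into
    small cells, and its bound [M] bounds the distance. *)
Record coord_metric d (X : measurableType d) (R : realType)
    (dist : X -> X -> R) (coord : X -> R) (M : R) : Prop := CoordMetric {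
  cm_dist0 : forall x, dist x x = 0;
  cm_ge0 : forall x y, 0 <= dist x y;
  cm_sym : forall x y, dist x y = dist y x;
  cm_triangle : forall x y z, dist x z <= dist x y + dist y z;
  cm_measurable : measurable_fun setT (fun z : X * X => dist z.1 z.2);
  cm_coord_measurable : measurable_fun setT coord;
  cm_coord_itv : forall x, 0 <= coord x <= M;
  cm_dist_le : forall x y, dist x y <= `|coord x - coord y| }.

Section Wasserstein.
Context d (X : measurableType d) (R : realType).
Context (dist : X -> X -> R) (coord : X -> R) (M p : R).
Hypothesis cm : coord_metric dist coord M.
Hypothesis p1 : 1 <= p.

Let p0 : 0 < p. Proof. exact: lt_le_trans p1. Qed.

Let dist2 (z : X * X) := dist z.1 z.2.

Let mdist2 : measurable_fun setT dist2. Proof. exact: cm_measurable cm. Qed.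

Let dist2_ge0 z : 0 <= dist2 z. Proof. exact: cm_ge0 cm _ _. Qed.

Lemma coord_metric_bound_ge0 : 0 <= M.
Proof. by have /andP[] := cm_coord_itv cm point; exact: le_trans. Qed.

Lemma coord_metric_le_bound x y : dist x y <= M.
Proof.
rewrite (le_trans (cm_dist_le cm x y))//.
have /andP[x0 xM] := cm_coord_itv cm x; have /andP[y0 yM] := cm_coord_itv cm y.
by rewrite ler_norml; apply/andP; split; lra.
Qed.

Lemma wasserstein_ge0 mu nu : (0 <= wasserstein dist p mu nu)%E.
Proof. exact: poweR_ge0. Qed.

Lemma wasserstein_ext mu nu mu' nu' :
  (forall A, measurable A -> mu A = mu' A) ->
  (forall A, measurable A -> nu A = nu' A) ->
  wasserstein dist p mu nu = wasserstein dist p mu' nu'.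
Proof.
move=> muE nuE; rewrite /wasserstein; congr ((ereal_inf [set _ | _ in _]) `^ _)%E.
by apply/seteqP; split => g + A mA => /(_ A mA); rewrite muE ?nuE.
Qed.

Let inf_ge0 mu nu : (0 <= ereal_inf [set \int[gamma]_z (dist z.1 z.2 `^ p)%:E
              | gamma in coupling mu nu])%E.
Proof.
apply: le_ereal_inf_tmp => _ [g _ <-].
by apply: integral_ge0 => z _; rewrite lee_fin powR_ge0.
Qed.

Lemma wasserstein_le_coupling mu nu (g : probability (X * X)%type R) :
  coupling mu nu g -> (wasserstein dist p mu nu <= Lp p g dist2)%E.
Proof.
move=> cg; rewrite /wasserstein /Lp gt0_ler_poweR ?invr_ge0 ?(ltW p0)//.
- by rewrite in_itv/= leey andbT inf_ge0.
- by rewrite in_itv/= leey andbT integral_ge0// => x _; rewrite lee_fin powR_ge0.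
- by apply: ereal_inf_lbound; exists g.
Qed.

Lemma coupling_nonempty (P Q : probability X R) : exists g, coupling P Q g.
Proof.
have T1 : (P \x Q)%E setT = 1%E.
  rewrite -setXTT; transitivity (P setT * Q setT)%E.
    exact: product_measure1E.
  by rewrite !probability_setT mule1.
exists (probability_of T1) => A mA.
split.
  change ((P \x Q)%E (A `*` setT) = P A).
  transitivity (P A * Q setT)%E; first exact: product_measure1E.
  by rewrite probability_setT mule1.
change ((P \x Q)%E (setT `*` A) = Q A).
transitivity (P setT * Q A)%E; first exact: product_measure1E.
by rewrite probability_setT mul1e.
Qed.

Lemma wasserstein_le_bound (P Q : probability X R) :
  (wasserstein dist p P Q <= M%:E)%E.
Proof.
have [g cg] := coupling_nonempty P Q.
rewrite (le_trans (wasserstein_le_coupling cg))//.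
apply: (@Lp_le_cst _ _ _ _ _ _ _ _ set0) => //.
- exact: coord_metric_bound_ge0.
- by move=> z _; exact: coord_metric_le_bound.
Qed.

Lemma wasserstein_fin_num (P Q : probability X R) :
  wasserstein dist p P Q \is a fin_num.
Proof.
rewrite ge0_fin_numE ?wasserstein_ge0//.
by rewrite (le_lt_trans (wasserstein_le_bound _ _))// ltry.
Qed.

(** The infimum over couplings is reached up to any [e], already after taking the
    root. *)
Lemma wasserstein_approx (P Q : probability X R) (e : R) : 0 < e ->
  exists2 g, coupling P Q g & (Lp p g dist2 <= wasserstein dist p P Q + e%:E)%E.
Proof.
move=> e0; pose I := ereal_inf [set (\int[g]_z (dist z.1 z.2 `^ p)%:E)%E
  | g in @coupling _ X R P Q].
have WE : wasserstein dist p P Q = (I `^ p^-1)%E by [].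
have pV : p^-1 * p = 1 by rewrite mulVf// gt_eqF.
have Wfin := wasserstein_fin_num P Q.
set w := fine (wasserstein dist p P Q).
have wE : wasserstein dist p P Q = w%:E by rewrite fineK.
have w0 : 0 <= w by rewrite fine_ge0// wasserstein_ge0.
have IE : I = (w `^ p)%:E.
  by rewrite -poweR_EFin -wE WE -poweRrM pV poweRe1// inf_ge0.
have : (I < ((w + e) `^ p)%:E)%E.
  by rewrite IE lte_fin gt0_ltr_powR// ?nnegrE; lra.
move=> /ereal_inf_lt[_ [g cg <-] gI]; exists g => //.
rewrite wE -EFinD /Lp.
have -> : ((w + e)%:E = ((w + e) `^ p)%:E `^ p^-1)%E.
  by rewrite poweR_EFin -powRrM mulfV ?gt_eqF// powRr1//; lra.
rewrite gt0_ler_poweR ?invr_ge0 ?(ltW p0)//; last exact: ltW.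
- by rewrite in_itv/= leey andbT integral_ge0// => x _; rewrite lee_fin powR_ge0.
- by rewrite in_itv/= leey andbT lee_fin powR_ge0.
Qed.

(** Two maps on a common probability space form a coupling of their laws. *)
Lemma wasserstein_maps d' (O : measurableType d') (mu : probability O R)
    (A B : O -> X) : measurable_fun setT A -> measurable_fun setT B ->
  (wasserstein dist p (pushforward mu A) (pushforward mu B)
    <= Lp p mu (fun w => dist (A w) (B w)))%E.
Proof.
move=> mA mB; have mAB : measurable_fun setT (fun w => (A w, B w)).
  exact: measurable_fun_pair.
have [g gE] := pushforward_probability mu mAB.
have -> : Lp p mu (fun w => dist (A w) (B w)) = Lp p g dist2.
  by rewrite (@Lp_pushforward _ _ _ _ _ p mu _ _ _ mAB)//= gE.
apply: wasserstein_le_coupling => E mE; rewrite gE /pushforward; split.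
  by congr (mu _); apply/seteqP; split => w //= -[].
by congr (mu _); apply/seteqP; split => w //= -[].
Qed.

Lemma wasserstein_sym (P Q : probability X R) :
  wasserstein dist p P Q = wasserstein dist p Q P.
Proof.
suff H (P' Q' : probability X R) :
    (wasserstein dist p P' Q' <= wasserstein dist p Q' P')%E.
  by apply/eqP; rewrite eq_le !H.
apply/lee_addgt0Pr => e e0; have [g cg] := wasserstein_approx Q' P' e0.
apply: le_trans.
have mswap : measurable_fun setT (fun z : X * X => (z.2, z.1)).
  exact: measurable_fun_pair.
have [h hE] := pushforward_probability g mswap.
have -> : Lp p g dist2 = Lp p h dist2.
  have hA A : measurable A -> h A = g ((fun z => (z.2, z.1)) @^-1` A) by rewrite hE.
  rewrite (Lp_pushforward p mswap hA (cm_measurable cm)).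
  by congr Lp; apply/funext => z; exact: cm_sym cm _ _.
apply: wasserstein_le_coupling => A mA; have [g1 g2] := cg A mA.
rewrite hE /pushforward; split.
  by rewrite -g2; congr (g _); apply/seteqP; split => -[x y] [].
by rewrite -g1; congr (g _); apply/seteqP; split => -[x y] [].
Qed.

(** The label along which couplings are glued. *)
Let cell (e : R) (x : X) : nat := Num.truncn (coord x / e).

Let measurable_cell (e : R) i : 0 < e -> measurable (cell e @^-1` [set i]).
Proof.
move=> e0; have -> : cell e @^-1` [set i] = coord @^-1` `[i%:R * e, i.+1%:R * e[.
  apply/seteqP; split => x; have /andP[x0 _] := cm_coord_itv cm x;
    rewrite /cell/= in_itv/= -ler_pdivlMr// -ltr_pdivrMr//.
    by move=> <-; rewrite truncn_le ?truncnS_gt// divr_ge0// ltW.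
  by move=> h; apply/eqP; rewrite truncn_eq// divr_ge0// ltW.
by apply: measurable_preimage => //; exact: cm_coord_measurable cm.
Qed.

Let cell_lt (e : R) x : 0 < e -> (cell e x < (Num.truncn (M / e)).+1)%N.
Proof.
move=> e0; rewrite ltnS /cell le_truncn// ler_pM2r ?invr_gt0//.
by have /andP[] := cm_coord_itv cm x.
Qed.

Let cell_dist (e : R) x y : 0 < e -> cell e x = cell e y -> dist x y <= e.
Proof.
move=> e0 xy; apply: le_trans (cm_dist_le cm x y) _.
have /andP[x0 _] := cm_coord_itv cm x; have /andP[y0 _] := cm_coord_itv cm y.
have B t : 0 <= coord t -> (cell e t)%:R * e <= coord t < (cell e t).+1%:R * e.
  move=> t0; rewrite -ler_pdivlMr// -ltr_pdivrMr// /cell.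
  by rewrite truncn_le ?truncnS_gt// divr_ge0// ltW.
have := B _ x0; have := B _ y0; rewrite xy -natr1 mulrDl mul1r.
move=> /andP[a b] /andP[c f]; rewrite ler_norml; apply/andP; split; lra.
Qed.

(** Nearly optimal couplings of [P, Q] and of [Q, S] are glued along the cell of
    their [Q]-coordinate.  Under the result [Th] the two middle points lie in the
    same cell, and the path through both of them costs the two given costs plus
    the diameter of a cell. *)
Lemma wasserstein_triangle (P Q S : probability X R) :
  (wasserstein dist p P S <=
   wasserstein dist p P Q + wasserstein dist p Q S)%E.
Proof.
apply/lee_addgt0Pr => e e0; have e30 : 0 < e / 3 by rewrite divr_gt0.
have [g1 cg1 N1] := wasserstein_approx P Q e30.
have [g2 cg2 N2] := wasserstein_approx Q S e30.
have [//|//|//|//|//|Th [ThL ThR Thc]] := @gluing_by_labels _ _ _ _ _ g1 g2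
  (Num.truncn (M / (e / 3))).+1 (cell (e / 3) \o snd) (cell (e / 3) \o fst).
- by move=> i; rewrite comp_preimage; apply: measurable_preimage => //;
    exact: measurable_cell.
- by move=> i; rewrite comp_preimage; apply: measurable_preimage => //;
    exact: measurable_cell.
- by move=> t; exact: cell_lt.
- by move=> t; exact: cell_lt.
- move=> i; have mi := measurable_cell i e30.
  have [_ q1] := cg1 _ mi; have [q2 _] := cg2 _ mi.
  transitivity (g1 (setT `*` (cell (e / 3) @^-1` [set i]))).
    by congr (g1 _); apply/seteqP; split => -[x y] //= [].
  rewrite q1 -q2; congr (g2 _); apply/seteqP; split => -[x y] //=.
  by case.
have m1 : measurable_fun setT (fun z : (X * X) * (X * X) => dist z.1.1 z.1.2).
  exact: (measurableT_comp (cm_measurable cm) measurable_fst).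
have m2 : measurable_fun setT (fun z : (X * X) * (X * X) => dist z.2.1 z.2.2).
  exact: (measurableT_comp (cm_measurable cm) measurable_snd).
have mmid : measurable_fun setT (fun z : (X * X) * (X * X) => (z.1.2, z.2.1)).
  by apply: measurable_fun_pair; exact: measurableT_comp.
have mend : measurable_fun setT (fun z : (X * X) * (X * X) => (z.1.1, z.2.2)).
  by apply: measurable_fun_pair; exact: measurableT_comp.
have m3 : measurable_fun setT (fun z : (X * X) * (X * X) => dist z.1.2 z.2.1).
  exact: (measurableT_comp (cm_measurable cm) mmid).
have m4 : measurable_fun setT (fun z : (X * X) * (X * X) => dist z.1.1 z.2.2).
  exact: (measurableT_comp (cm_measurable cm) mend).
have [g gE] := pushforward_probability Th mend.
have cg : coupling P S g.
  move=> A mA; have [a1 _] := cg1 A mA; have [_ a2] := cg2 A mA.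
  rewrite gE /pushforward -a1 -a2 -ThL -?ThR; try exact: measurableX.
  split; congr (Th _); apply/seteqP; split => z //=; by case=> // -[].
apply: le_trans (wasserstein_le_coupling cg) _.
rewrite (@Lp_pushforward _ _ _ _ _ p Th _ _ _ mend)//= ?gE//.
have L1 : Lp p Th (fun z => dist z.1.1 z.1.2) = Lp p g1 dist2.
  rewrite (@Lp_pushforward _ _ _ _ _ p Th g1 fst)// => A mA /=.
  by rewrite -ThL//; congr (Th _); apply/seteqP; split => z //= -[].
have L2 : Lp p Th (fun z => dist z.2.1 z.2.2) = Lp p g2 dist2.
  rewrite (@Lp_pushforward _ _ _ _ _ p Th g2 snd)// => A mA /=.
  by rewrite -ThR//; congr (Th _); apply/seteqP; split => z //= -[].
have L3 : (Lp p Th (fun z => dist z.1.2 z.2.1) <= (e / 3)%:E)%E.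
  pose N := [set t : (X * X) * (X * X) |
    (cell (e / 3) \o snd) t.1 <> (cell (e / 3) \o fst) t.2].
  have mN : measurable N.
    rewrite (_ : N = ~` \bigcup_i ((fun z => cell (e / 3) z.1.2) @^-1` [set i] `&`
        (fun z => cell (e / 3) z.2.1) @^-1` [set i])).
      apply: measurableC; apply: bigcupT_measurable => i; apply: measurableI.
        apply: (@measurable_preimage _ _ _ _ (fun z => z.1.2) (cell (e / 3) @^-1` [set i])) => //.
          exact: measurableT_comp.
        exact: measurable_cell.
      apply: (@measurable_preimage _ _ _ _ (fun z => z.2.1) (cell (e / 3) @^-1` [set i])) => //.
        exact: measurableT_comp.
      exact: measurable_cell.
    apply/seteqP; split => z /=; rewrite /N/=.
      by move=> h [i _ [/= a b]]; apply: h; rewrite a b.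
    by move=> h k; apply: h; exists (cell (e / 3) z.1.2).
  apply: (@Lp_le_cst _ _ _ _ _ _ _ _ N) => //.
  - by move=> z; exact: cm_ge0 cm _ _.
  - exact: ltW.
  - by move=> z /= /contrapT h; exact: cell_dist.
apply: (@le_trans _ _ (Lp p Th (fun z => (dist z.1.1 z.1.2 + dist z.1.2 z.2.1) + dist z.2.1 z.2.2))).
  apply: Lp_le => //.
    by apply: measurable_funD => //; exact: measurable_funD.
  move=> z /=; rewrite (cm_ge0 cm) /dist2/= (le_trans (cm_triangle cm _ z.2.1 _))//.
  by rewrite lerD2r (cm_triangle cm).
apply: le_trans (Lp_minkowski p1 _ _ _ _ _) _ => //.
- exact: measurable_funD.
- by move=> z; rewrite addr_ge0// (cm_ge0 cm).
- by move=> z; rewrite (cm_ge0 cm).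
rewrite L2; apply: le_trans (leeD (Lp_minkowski p1 _ _ _ _ _) N2) _ => //.
- by move=> z; rewrite (cm_ge0 cm).
- by move=> z; rewrite (cm_ge0 cm).
rewrite L1; apply: le_trans (leeD (leeD N1 L3) (lexx _)) _.
rewrite -(fineK (wasserstein_fin_num P Q)) -(fineK (wasserstein_fin_num Q S)).
rewrite -!EFinD lee_fin; lra.
Qed.

End Wasserstein.

Lemma bounded_integrable d (T : measurableType d) (R : realType)
    (m : {finite_measure set T -> \bar R}) (f : T -> R) (B : R) :
  measurable_fun setT f -> (forall x, `|f x| <= B) ->
  m.-integrable setT (EFin \o f).
Proof.
move=> mf fB; apply: measurable_bounded_integrable => //.
  by rewrite -ge0_fin_numE// fin_num_measure.
by exists B; split; [exact: num_real|move=> x Bx t _ /=; rewrite (le_trans (fB t))// ltW].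
Qed.

Section ZeroWasserstein.
Context d (X : measurableType d) (R : realType).
Context (dist : X -> X -> R) (coord : X -> R) (M p : R).
Hypothesis cm : coord_metric dist coord M.
Hypothesis p1 : 1 <= p.

Let p0 : 0 < p. Proof. exact: lt_le_trans p1. Qed.

(** Replaces Jensen's inequality in the comparison of [W_1] with [W_p]: below
    [eta] the term [eta] suffices, above it [t^(p-1)] exceeds [eta^(p-1)]. *)
Lemma le_powR_linear (eta t : R) : 0 < eta -> 0 <= t ->
  t <= eta + t `^ p / eta `^ (p - 1).
Proof.
move=> e0 t0; have [te|et] := leP t eta.
  by rewrite (le_trans te)// lerDl divr_ge0 ?powR_ge0.
apply: (@le_trans _ _ (t `^ p / eta `^ (p - 1))); last by rewrite lerDr ltW.
rewrite ler_pdivlMr ?powR_gt0// -[leRHS]mulr_powRB1//.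
rewrite ler_wpM2l// ge0_ler_powR ?nnegrE ?subr_ge0// ltW//.
Qed.

(** Lipschitz functions are continuous for [W_1], and [W_1] vanishes with [W_p]: a
    coupling of [p]-cost at most [eta ^ p] moves the integral by at most
    [2 * eta] times the Lipschitz constant. *)
Lemma wasserstein0_integral_lipschitz (P Q : probability X R) (f : X -> R)
    (L : R) : wasserstein dist p P Q = 0%E -> measurable_fun setT f ->
  (forall x y, `|f x - f y| <= L * dist x y) ->
  \int[P]_x f x = \int[Q]_x f x.
Proof.
move=> W0 mf fL.
pose K : R := `|L|; have K0 : 0 <= K by exact: normr_ge0.
have {}fL x y : `|f x - f y| <= K * dist x y.
  by rewrite (le_trans (fL x y))// ler_wpM2r ?ler_norm// (cm_ge0 cm).
have fB x : `|f x| <= `|f point| + K * M.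
  rewrite -[f x](subrK (f point)) (le_trans (ler_normD _ _))// addrC lerD2l.
  by rewrite (le_trans (fL _ _))// ler_wpM2l// (coord_metric_le_bound cm).
have key (eta : R) : 0 < eta -> `|\int[P]_x f x - \int[Q]_x f x| <= K * (eta + eta).
  move=> eta0; have [g cg gN] := wasserstein_approx cm p1 P Q eta0.
  have mf1 : measurable_fun setT (fun z : X * X => f z.1) by exact: measurableT_comp.
  have mf2 : measurable_fun setT (fun z : X * X => f z.2) by exact: measurableT_comp.
  have i1 : g.-integrable setT (EFin \o (fun z : X * X => f z.1)).
    by apply: bounded_integrable => // z; exact: fB.
  have i2 : g.-integrable setT (EFin \o (fun z : X * X => f z.2)).
    by apply: bounded_integrable => // z; exact: fB.
  have PE : \int[P]_x f x = \int[g]_z f z.1.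
    rewrite /Rintegral (eq_measure_integral (pushforward g fst)); last first.
      move=> A mA _ /=; have [<- _] := cg _ mA.
      by congr (g _); apply/seteqP; split => -[x y] //= [].
    rewrite integral_pushforward//; first exact/measurable_EFinP.
  have QE : \int[Q]_x f x = \int[g]_z f z.2.
    rewrite /Rintegral (eq_measure_integral (pushforward g snd)); last first.
      move=> A mA _ /=; have [_ <-] := cg _ mA.
      by congr (g _); apply/seteqP; split => -[x y] //= [].
    rewrite integral_pushforward//; first exact/measurable_EFinP.
  rewrite PE QE -RintegralB//.
  apply: le_trans (le_normr_Rintegral _ _) _ => //.
    apply: (@bounded_integrable _ _ _ _ _ (K * M)); first exact: measurable_funB.
    move=> z; rewrite (le_trans (fL _ _))// ler_wpM2l//.
    exact: (coord_metric_le_bound cm).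
  have mdist := cm_measurable cm.
  pose h (z : X * X) := K * (eta + dist z.1 z.2 `^ p / eta `^ (p - 1)).
  have mdp : measurable_fun setT (fun z : X * X => dist z.1 z.2 `^ p).
    exact: (@measurableT_comp _ _ _ _ _ _ (@powR R ^~ p)).
  have idp : g.-integrable setT (EFin \o (fun z : X * X => dist z.1 z.2 `^ p)).
    apply: (@bounded_integrable _ _ _ _ _ (M `^ p)) => // z.
    rewrite ger0_norm ?powR_ge0// ge0_ler_powR ?(ltW p0) ?nnegrE//.
    - exact: cm_ge0 cm _ _.
    - exact: coord_metric_bound_ge0 cm.
    - exact: coord_metric_le_bound cm _ _.
  have ieta : g.-integrable setT (EFin \o (fun=> eta)).
    by apply: (@bounded_integrable _ _ _ _ _ `|eta|).
  have idpe : g.-integrable setT (EFin \o (fun z : X * X => dist z.1 z.2 `^ p / eta `^ (p - 1))).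
    rewrite (_ : _ \o _ = (fun z => (EFin \o (fun z : X * X => (dist z.1 z.2 `^ p)%R)) z * ((eta `^ (p - 1))^-1)%:E)%E)//.
    exact: integrableZr.
  have isum : g.-integrable setT (EFin \o (fun z : X * X => eta + dist z.1 z.2 `^ p / eta `^ (p - 1))).
    rewrite (_ : _ \o _ = (fun z => (EFin \o (fun=> eta)) z +
       (EFin \o (fun z : X * X => (dist z.1 z.2 `^ p / eta `^ (p - 1))%R)) z)%E)//.
    exact: integrableD.
  apply: (@le_trans _ _ (\int[g]_z h z)).
    apply: le_Rintegral => //.
    - apply: (@bounded_integrable _ _ _ _ _ (K * M)) => //.
        by apply: measurableT_comp => //; exact: measurable_funB.
      move=> z; rewrite normr_id (le_trans (fL _ _))// ler_wpM2l//.
      exact: (coord_metric_le_bound cm).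
    - rewrite (_ : _ \o _ = (fun z => K%:E * (EFin \o (fun z : X * X => (eta + dist z.1 z.2 `^ p / eta `^ (p - 1))%R)) z)%E)//.
      exact: integrableZl.
    - move=> z _; rewrite (le_trans (fL _ _))// ler_wpM2l// le_powR_linear//.
      exact: cm_ge0 cm _ _.
  rewrite /h RintegralZl// ler_wpM2l// RintegralD// RintegralZr//.
  rewrite Rintegral_cst//= probability_setT/= mulr1 lerD2l.
  rewrite ler_pdivrMr ?powR_gt0// mulr_powRB1 ?(ltW eta0)//.
  have C0 : (0 <= \int[g]_x (dist x.1 x.2 `^ p)%:E)%E.
    by apply: integral_ge0 => z _; rewrite lee_fin powR_ge0.
  have Cfin : (\int[g]_x (dist x.1 x.2 `^ p)%:E)%E \is a fin_num.
    exact: integrable_fin_num.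
  have : ((Lp p g (fun z => dist z.1 z.2)) `^ p <= (eta `^ p)%:E)%E.
    rewrite -poweR_EFin gt0_ler_poweR ?(ltW p0)//.
    - by rewrite in_itv/= leey andbT Lp_ge0.
    - by rewrite in_itv/= leey andbT lee_fin ltW.
    - by move: gN; rewrite W0 add0e.
  rewrite /Lp -poweRrM mulVf ?gt_eqF// poweRe1//.
  by rewrite -lee_fin /Rintegral fineK.
suff : `|\int[P]_x f x - \int[Q]_x f x| <= 0.
  by rewrite normr_le0 subr_eq0 => /eqP.
apply/ler_addgt0Pl => e e0; rewrite addr0.
have K1 : 0 < 2 * (K + 1) by rewrite mulr_gt0// ltr_wpDl.
pose t := e / (2 * (K + 1)); have t0 : 0 < t by rewrite divr_gt0.
have te : t * (2 * (K + 1)) = e by rewrite divfK// gt_eqF.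
rewrite (le_trans (key t t0))// mulrDr; move: te; rewrite mulrDr mulr1 mulrDr.
by rewrite (mulrC t (2 * K)) -mulrA; lra.
Qed.

End ZeroWasserstein.

(** * Sliced distances *)

Section Sliced.
Context d (X : measurableType d) dO (O : measurableType dO)
  dZ (Z : measurableType dZ) (R : realType).
Context (dist : X -> X -> R) (coord : X -> R) (M p : R).
Hypothesis cm : coord_metric dist coord M.
Hypothesis p1 : 1 <= p.
Context (m : {measure set Z -> \bar R}) (A : Z -> O -> X).
Hypothesis mfin : (m setT < +oo)%E.
Hypothesis mA : forall z, measurable_fun setT (A z).

Let p0 : 0 < p. Proof. exact: lt_le_trans p1. Qed.

Definition slice_wasserstein (mu nu : probability O R) (z : Z) : \bar R :=
  wasserstein dist p (pushforward mu (A z)) (pushforward nu (A z)).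

Definition sliced_wasserstein (mu nu : probability O R) : \bar R :=
  ((\int[m]_z (slice_wasserstein mu nu z `^ p)) `^ p^-1)%E.

Lemma slice_wasserstein_fin_num mu nu z : slice_wasserstein mu nu z \is a fin_num.
Proof.
have [P PE] := pushforward_probability mu (mA z).
have [Q QE] := pushforward_probability nu (mA z).
by rewrite /slice_wasserstein -PE -QE (wasserstein_fin_num cm p1).
Qed.

Lemma slice_wasserstein_ge0 mu nu z : (0 <= slice_wasserstein mu nu z)%E.
Proof. exact: wasserstein_ge0. Qed.

Lemma slice_wasserstein_sym mu nu z :
  slice_wasserstein mu nu z = slice_wasserstein nu mu z.
Proof.
have [P PE] := pushforward_probability mu (mA z).
have [Q QE] := pushforward_probability nu (mA z).
by rewrite /slice_wasserstein -PE -QE (wasserstein_sym cm p1).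
Qed.

Lemma slice_wasserstein_triangle mu nu la z :
  (slice_wasserstein mu la z <=
   slice_wasserstein mu nu z + slice_wasserstein nu la z)%E.
Proof.
have [P PE] := pushforward_probability mu (mA z).
have [Q QE] := pushforward_probability nu (mA z).
have [S SE] := pushforward_probability la (mA z).
rewrite /slice_wasserstein -PE -QE -SE; exact: (wasserstein_triangle cm p1).
Qed.

Lemma slice_wasserstein_le_bound mu nu z : (slice_wasserstein mu nu z <= M%:E)%E.
Proof.
have [P PE] := pushforward_probability mu (mA z).
have [Q QE] := pushforward_probability nu (mA z).
rewrite /slice_wasserstein -PE -QE; exact: (wasserstein_le_bound cm p1).
Qed.

Lemma slice_wasserstein_eq0 (mu nu : probability O R) z : measure_eq mu nu ->
  slice_wasserstein mu nu z = 0%E.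
Proof.
move=> munu; have [P PE] := pushforward_probability mu (mA z).
rewrite /slice_wasserstein (@wasserstein_ext _ _ _ _ _ _ _
  (pushforward mu (A z)) (pushforward mu (A z)))//; last first.
  by move=> B mB; rewrite /pushforward munu//; exact: measurable_preimage.
apply/eqP; rewrite eq_le wasserstein_ge0 andbT.
apply: le_trans (wasserstein_maps cm p1 mu (mA z) (mA z)) _.
apply: (@Lp_le_cst _ _ _ _ p1 _ _ _ set0) => //.
- rewrite (_ : (fun _ => _) = cst 0)//.
  by apply/funext => w /=; rewrite (cm_dist0 cm).
- by move=> w; rewrite (cm_ge0 cm).
- by move=> w _; rewrite (cm_dist0 cm).
Qed.

Context (D : set (probability O R)).
Hypothesis mW : forall mu nu, D mu -> D nu ->
  measurable_fun setT (slice_wasserstein mu nu).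
Hypothesis injW : forall (mu nu : probability O R) (N : set Z), D mu -> D nu ->
  measurable N -> m N = 0%E ->
  (forall z, ~ N z -> slice_wasserstein mu nu z = 0%E) -> measure_eq mu nu.

Let w mu nu z := fine (slice_wasserstein mu nu z).

Let wE mu nu z : slice_wasserstein mu nu z = (w mu nu z)%:E.
Proof. by rewrite fineK// slice_wasserstein_fin_num. Qed.

Let mw mu nu : D mu -> D nu -> measurable_fun setT (w mu nu).
Proof. by move=> Dmu Dnu; apply: measurableT_comp => //; exact: mW. Qed.

Let w0 mu nu z : 0 <= w mu nu z.
Proof. by rewrite fine_ge0// slice_wasserstein_ge0. Qed.

Let SWE mu nu : sliced_wasserstein mu nu = Lp p m (w mu nu).
Proof.
rewrite /sliced_wasserstein /Lp; congr (_ `^ _)%E.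
by apply: eq_integral => z _; rewrite wE poweR_EFin.
Qed.

(** The hypotheses [mW] and [injW] are the two parts that depend on the
    geometry; the rest is Minkowski's inequality for the measure [m]. *)
Theorem sliced_wasserstein_metric : is_metric_on D sliced_wasserstein.
Proof.
split.
- move=> mu nu Dmu Dnu; rewrite SWE Lp_ge0/= poweR_lty//.
  apply: (@le_lt_trans _ _ (\int[m]_z (M `^ p)%:E)%E).
    apply: ge0_le_integral => //.
    + by move=> z _; rewrite lee_fin powR_ge0.
    + by apply: measurable_EFin_powR; exact: mw.
    + move=> z _; rewrite lee_fin ge0_ler_powR ?(ltW p0) ?nnegrE//.
        exact: coord_metric_bound_ge0 cm.
      by rewrite -lee_fin -wE slice_wasserstein_le_bound.
  by rewrite integral_cst// lte_mul_pinfty// ?lee_fin ?powR_ge0.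
- move=> mu nu Dmu Dnu; split => [SW0|munu].
    have I0 : (\int[m]_z (w mu nu z `^ p)%:E = 0)%E.
      apply: (@poweR_eq0_eq0 _ _ p^-1); last by rewrite -SW0 SWE.
      by apply: integral_ge0 => z _; rewrite lee_fin powR_ge0.
    have mwp := measurable_EFin_powR p (mw Dmu Dnu).
    have : ae_eq m setT (fun z => (w mu nu z `^ p)%:E) (cst 0%E).
      apply/ae_eq_integral_abs => //; rewrite -[RHS]I0.
      by apply: eq_integral => z _; rewrite gee0_abs// lee_fin powR_ge0.
    move=> [N [mN N0 sN]]; apply: (injW Dmu Dnu mN N0) => z Nz.
    rewrite wE; apply/eqP; rewrite eqe.
    have : (w mu nu z `^ p)%:E = 0%E.
      by apply: contrapT => h; apply: Nz; apply: sN => /= h'; apply: h; exact: h'.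
    by move=> [] /eqP; rewrite powR_eq0 => /andP[].
  rewrite /sliced_wasserstein (eq_integral (cst 0%E)).
    by rewrite integral0 poweR0r// invr_neq0// gt_eqF.
  by move=> z _; rewrite slice_wasserstein_eq0// poweR0r// gt_eqF.
- move=> mu nu Dmu Dnu; rewrite /sliced_wasserstein; congr (_ `^ _)%E.
  by apply: eq_integral => z _; rewrite slice_wasserstein_sym.
- move=> mu nu la Dmu Dnu Dla; rewrite !SWE.
  apply: le_trans (Lp_minkowski p1 _ _ _ _ _); try exact: mw; try exact: w0.
  apply: Lp_le => //; first exact: mw.
    by apply: measurable_funD; exact: mw.
  move=> z; rewrite w0/= -lee_fin EFinD -!wE; exact: slice_wasserstein_triangle.
Qed.

End Sliced.

(** * Laws of pairs of random variables *)

Lemma le_norm_cvg (R : realType) (u : R^nat) (l B : R) :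
  (forall n, `|u n| <= B) -> u @ \oo --> l -> `|l| <= B.
Proof.
by move=> uB ul; apply: (cvgr_to_le (cvg_norm ul)); exact: nearW.
Qed.

Section BoundedMeasurable.
Context d (T : measurableType d) (R : realType).
Implicit Types f g : T -> R.

Definition bounded_measurable f :=
  measurable_fun setT f /\ exists B, forall x, `|f x| <= B.

Lemma bounded_measurable_integrable (m : {finite_measure set T -> \bar R}) f :
  bounded_measurable f -> m.-integrable setT (EFin \o f).
Proof. by move=> [mf [B fB]]; exact: bounded_integrable mf fB. Qed.

Lemma bounded_measurable_cst (c : R) : bounded_measurable (fun=> c).
Proof. by split => //; exists `|c|. Qed.

Lemma bounded_measurableD f g : bounded_measurable f -> bounded_measurable g ->
  bounded_measurable (fun x => f x + g x).
Proof.
move=> [mf [B fB]] [mg [C gC]]; split; first exact: measurable_funD.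
by exists (B + C) => x; rewrite (le_trans (ler_normD _ _))// lerD.
Qed.

Lemma bounded_measurableM f g : bounded_measurable f -> bounded_measurable g ->
  bounded_measurable (fun x => f x * g x).
Proof.
move=> [mf [B fB]] [mg [C gC]]; split; first exact: measurable_funM.
by exists (B * C) => x; rewrite normrM ler_pM.
Qed.

Lemma bounded_measurable_cos f : measurable_fun setT f ->
  bounded_measurable (fun x => cos (f x)).
Proof.
move=> mf; split; last by exists 1 => x; exact: cos_max.
apply: measurableT_comp => //; apply: continuous_measurable_fun.
exact: continuous_cos.
Qed.

Lemma bounded_measurable_sin f : measurable_fun setT f ->
  bounded_measurable (fun x => sin (f x)).
Proof.
move=> mf; split; last by exists 1 => x; exact: sin_max.
apply: measurableT_comp => //; apply: continuous_measurable_fun.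
exact: continuous_sin.
Qed.

Lemma bounded_measurable_indic (A : set T) : measurable A ->
  bounded_measurable (\1_A : T -> R).
Proof.
move=> mA; split; first exact: measurable_indic.
by exists 1 => x; rewrite indicE; case: (_ \in _); rewrite ?normr1 ?normr0.
Qed.

Lemma cvg_Rintegral (m : {finite_measure set T -> \bar R}) (f_ : nat -> T -> R)
    f (B : R) : (forall n, measurable_fun setT (f_ n)) ->
  (forall n x, `|f_ n x| <= B) -> (forall x, f_ ^~ x @ \oo --> f x) ->
  (fun n => \int[m]_x f_ n x) @ \oo --> \int[m]_x f x.
Proof.
move=> mf fB ff.
have mfl : measurable_fun setT f by apply: measurable_fun_cvg => // x _; exact: ff.
have fBl x : `|f x| <= B by apply: le_norm_cvg (ff x) => n.
have [] := @dominated_convergence _ T R m setT measurableT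
    (fun n => EFin \o f_ n) (EFin \o f) (EFin \o fun=> B).
- by move=> n; exact/measurable_EFinP.
- exact/measurable_EFinP.
- by apply: aeW => x _; apply: cvg_EFin; [exact: nearW|exact: ff].
- by apply: bounded_measurable_integrable; exact: bounded_measurable_cst.
- by apply: aeW => x n _ /=; rewrite lee_fin.
move=> _ _ h; apply: fine_cvg; rewrite fineK//.
apply: integrable_fin_num => //.
by apply: bounded_measurable_integrable; split => //; exists B.
Qed.

End BoundedMeasurable.

Lemma cvg_of_le_harmonic (R : realType) (u : R^nat) (l C : R) :
  (forall n, `|u n - l| <= C / n.+1%:R) -> u @ \oo --> l.
Proof.
move=> uC; have h : (fun n => C * n.+1%:R^-1) @ \oo --> 0.
  rewrite -[X in _ --> X](mulr0 C); apply: cvgMr; exact: cvg_harmonic.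
apply/cvgrPdist_le => e e0.
move/cvgrPdist_le : h => /(_ e e0); apply: filterS => n; rewrite sub0r normrN.
by move=> Ce; rewrite distrC (le_trans (uC n))// (le_trans _ Ce)// ler_norm.
Qed.

(** A smooth approximation of the indicator of the positive numbers built from
    exponentials only, so that it stays within any algebra of functions closed
    under bounded limits.  The inner exponential tends to infinity for [s < 0]
    and to 0 for [0 < s] faster than its factor [n + 1]; for [s = 0] that factor
    alone drives the value to 0. *)
Lemma cvg_expR_step (R : realType) (s : R) :
  (fun n => expR (- (n.+1%:R * expR (- (n.+1%:R ^+ 2 * s))))) @ \oo -->
  ((0 < s)%R%:R : R).
Proof.
have [s0|s0] := ltP 0 s; last first.
  apply: (@cvg_of_le_harmonic _ _ _ 1) => n; rewrite subr0 ger0_norm ?expR_ge0//.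
  have h : n.+1%:R <= n.+1%:R * expR (- (n.+1%:R ^+ 2 * s)) :> R.
    rewrite ler_peMr// -expR0 ler_expR oppr_ge0 mulr_ge0_le0// sqr_ge0.
  rewrite expRN div1r lef_pV2 ?posrE ?expR_gt0//.
  rewrite (le_trans h)// (le_trans _ (expR_ge1Dx _))// lerDr//.
apply: (@cvg_of_le_harmonic _ _ _ s^-1) => n.
set K : R := n.+1%:R; have K0 : 0 < K by rewrite ltr0n.
set y := K * expR _.
have y0 : 0 <= y by rewrite mulr_ge0 ?expR_ge0// ltW.
have yK : y <= s^-1 / K.
  rewrite /y expRN ler_pdivrMr ?expR_gt0//.
  have := expR_ge1Dx (K ^+ 2 * s); set E := expR _ => hE.
  have : K ^+ 2 * s <= E by apply: le_trans hE; rewrite lerDr.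
  have sK : 0 < s^-1 / K by rewrite divr_gt0 ?invr_gt0.
  move=> h; apply: le_trans (ler_wpM2l (ltW sK) h).
  by rewrite expr2 -!mulrA mulKf ?gt_eqF// mulrCA mulVf ?gt_eqF// mulr1.
have e1 := expR_ge1Dx (- y).
have e2 : expR (- y) <= 1 by rewrite expR_le1 oppr_le0.
rewrite mulr1n ler_norml.
move: (s^-1 / K) (expR (- y)) y0 yK e1 e2; clearbody y => q E y0 yK e1 e2.
by apply/andP; split; lra.
Qed.

(** Equality of all characteristic functions is turned into equality of laws
    without Fourier inversion.  Call a function a multiplier if multiplying by it
    preserves the functions whose Fourier integrals agree for [mu] and [nu].
    Sines of linear forms are multipliers by the product formulas, and
    multipliers form an algebra closed under bounded pointwise limits, hence
    under the exponential and under passing to indicators of superlevel sets.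
    The sets whose indicator is a multiplier therefore form a sigma-algebra, and
    [X] and [Y] are measurable for it, being limits of [n sin (X / n)] and
    [n sin (Y / n)]. *)
Section CramerWold.
Context d (T : measurableType d) (R : realType).
Context (mu nu : {finite_measure set T -> \bar R}) (X Y : T -> R).
Hypothesis mX : measurable_fun setT X.
Hypothesis mY : measurable_fun setT Y.
Implicit Types f g : T -> R.

Let agree f := \int[mu]_x f x = \int[nu]_x f x.

Let agreeD f g : bounded_measurable f -> bounded_measurable g ->
  agree f -> agree g -> agree (fun x => f x + g x).
Proof.
move=> bf bg af ag; rewrite /agree !RintegralD//;
  try exact: bounded_measurable_integrable.
by rewrite af ag.
Qed.

Let agreeZ (c : R) f : bounded_measurable f -> agree f -> agree (fun x => c * f x).
Proof.
move=> bf af; rewrite /agree !RintegralZl//;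
  try exact: bounded_measurable_integrable.
by rewrite af.
Qed.

Let agree_cvg (f_ : nat -> T -> R) f (B : R) :
  (forall n, measurable_fun setT (f_ n)) ->
  (forall n x, `|f_ n x| <= B) -> (forall x, f_ ^~ x @ \oo --> f x) ->
  (forall n, agree (f_ n)) -> agree f.
Proof.
move=> mf fB ff af.
have h1 := cvg_Rintegral (m := mu) mf fB ff; have h2 := cvg_Rintegral (m := nu) mf fB ff.
have E : (fun n => \int[mu]_x f_ n x) = (fun n => \int[nu]_x f_ n x).
  by apply/funext => n; exact: af.
by rewrite E in h1; exact: cvg_unique h1 h2.
Qed.

Let L u v x := u * X x + v * Y x.

Let mL u v : measurable_fun setT (L u v).
Proof. by apply: measurable_funD; exact: measurable_funM. Qed.

(** The Fourier integrals of [f], real and imaginary parts, agree for [mu] and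
    [nu]. *)
Let twist f := bounded_measurable f /\ forall u v,
  agree (fun x => f x * cos (L u v x)) /\ agree (fun x => f x * sin (L u v x)).

Let bcos u v := bounded_measurable_cos (mL u v).
Let bsin u v := bounded_measurable_sin (mL u v).

Let twistD f g : twist f -> twist g -> twist (fun x => f x + g x).
Proof.
move=> [bf hf] [bg hg]; split; first exact: bounded_measurableD.
move=> u v; have [f1 f2] := hf u v; have [g1 g2] := hg u v; split.
  rewrite (_ : (fun _ => _) = (fun x => f x * cos (L u v x) + g x * cos (L u v x))).
    by apply: agreeD => //; exact: bounded_measurableM.
  by apply/funext => x; rewrite mulrDl.
rewrite (_ : (fun _ => _) = (fun x => f x * sin (L u v x) + g x * sin (L u v x))).
  by apply: agreeD => //; exact: bounded_measurableM.
by apply/funext => x; rewrite mulrDl.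
Qed.

Let twistZ c f : twist f -> twist (fun x => c * f x).
Proof.
move=> [bf hf]; split.
  by apply: bounded_measurableM => //; exact: bounded_measurable_cst.
move=> u v; have [f1 f2] := hf u v; split.
  under eq_fun do rewrite -mulrA.
  by apply: agreeZ => //; exact: bounded_measurableM.
under eq_fun do rewrite -mulrA.
by apply: agreeZ => //; exact: bounded_measurableM.
Qed.

Let multiplier g := bounded_measurable g /\
  forall f, twist f -> twist (fun x => f x * g x).

Let multiplier_cst c : multiplier (fun=> c).
Proof.
split; first exact: bounded_measurable_cst.
by move=> f /(twistZ c); under eq_fun do rewrite mulrC.
Qed.

Let multiplierD f g : multiplier f -> multiplier g ->
  multiplier (fun x => f x + g x).
Proof.
move=> [bf hf] [bg hg]; split; first exact: bounded_measurableD.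
move=> h th; under eq_fun do rewrite mulrDr.
by apply: twistD; [exact: hf|exact: hg].
Qed.

Let multiplierM f g : multiplier f -> multiplier g ->
  multiplier (fun x => f x * g x).
Proof.
move=> [bf hf] [bg hg]; split; first exact: bounded_measurableM.
by move=> h th; under eq_fun do rewrite mulrA; apply: hg; exact: hf.
Qed.

Let multiplier_cvg (g_ : nat -> T -> R) g (B : R) :
  (forall n, multiplier (g_ n)) -> (forall n x, `|g_ n x| <= B) ->
  (forall x, g_ ^~ x @ \oo --> g x) -> multiplier g.
Proof.
move=> mg gB gg.
have bg : bounded_measurable g.
  split.
    by apply: measurable_fun_cvg (fun x _ => gg x) => n; have [[]] := mg n.
  by exists B => x; apply: le_norm_cvg (gg x) => n.
split => // f tf; have [bf hf] := tf.
have [mf [C fC]] := bf.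
split; first exact: bounded_measurableM.
have key (h : T -> R) : bounded_measurable h ->
    (forall n, agree (fun x => f x * g_ n x * h x)) ->
    agree (fun x => f x * g x * h x).
  move=> [mh [D hD]] ah.
  apply: (@agree_cvg (fun n x => f x * g_ n x * h x) _ (C * B * D)) => //.
  - move=> n; have [[mgn _] _] := mg n.
    by apply: measurable_funM => //; exact: measurable_funM.
  - by move=> n x; rewrite !normrM ler_pM ?mulr_ge0// ler_pM.
  - move=> x; apply: cvgMl; apply: cvgMr; exact: gg.
move=> u v; split; apply: key => // n; have [_ /(_ f tf)[_ /(_ u v)[]]] := mg n.
  by [].
by [].
Qed.

Let multiplier_sin a b : multiplier (fun x => sin (L a b x)).
Proof.
split; first exact: bsin.
move=> f tf; have [bf hf] := tf; split; first exact: bounded_measurableM.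
have Ladd u v x : L (u + a) (v + b) x = L u v x + L a b x by rewrite /L; ring.
have Lsub u v x : L (u - a) (v - b) x = L u v x - L a b x by rewrite /L; ring.
move=> u v; split.
  rewrite (_ : (fun _ => _) = (fun x => 2^-1 * (f x * sin (L (u + a) (v + b) x)
      + -1 * (f x * sin (L (u - a) (v - b) x))))); last first.
    apply/funext => x; rewrite Ladd Lsub; move: (L a b x) (L u v x) => r s.
    by rewrite sinD sinB; field.
  have b1 := bounded_measurableM bf (bsin (u + a) (v + b)).
  have b2 := bounded_measurableM bf (bsin (u - a) (v - b)).
  have b3 := bounded_measurableM (bounded_measurable_cst T (-1 : R)) b2.
  apply: agreeZ; first exact: bounded_measurableD.
  apply: agreeD => //; first by have [] := hf (u + a) (v + b).
  by apply: agreeZ => //; have [] := hf (u - a) (v - b).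
rewrite (_ : (fun _ => _) = (fun x => 2^-1 * (f x * cos (L (u - a) (v - b) x)
    + -1 * (f x * cos (L (u + a) (v + b) x))))); last first.
  apply/funext => x; rewrite Ladd Lsub; move: (L a b x) (L u v x) => r s.
  by rewrite cosB cosD; field.
have b1 := bounded_measurableM bf (bcos (u - a) (v - b)).
have b2 := bounded_measurableM bf (bcos (u + a) (v + b)).
have b3 := bounded_measurableM (bounded_measurable_cst T (-1 : R)) b2.
apply: agreeZ; first exact: bounded_measurableD.
apply: agreeD => //; first by have [] := hf (u - a) (v - b).
by apply: agreeZ => //; have [] := hf (u + a) (v + b).
Qed.

Let multiplier_expR g : multiplier g -> multiplier (fun x => expR (g x)).
Proof.
move=> mg; have [[_ [B gB]] _] := mg.
apply: (@multiplier_cvg (fun n x => series (exp_coeff (g x)) n) _ (expR B)).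
- elim=> [|n ih].
    rewrite (_ : (fun _ => _) = fun=> 0); first exact: multiplier_cst.
    by apply/funext => x; rewrite /series/= big_nil.
  rewrite (_ : (fun _ => _) = fun x => series (exp_coeff (g x)) n +
      g x ^+ n * n`!%:R^-1); last first.
    by apply/funext => x; rewrite /series/= big_nat_recr.
  apply: multiplierD => //; apply: multiplierM => //.
  elim: n {ih} => [|n ih]; first exact: multiplier_cst.
  by under eq_fun do rewrite exprS; exact: multiplierM.
- move=> n x; apply: (@le_trans _ _ (series (exp_coeff B) n)).
    rewrite /series/= (le_trans (ler_norm_sum _ _ _))//; apply: ler_sum => i _.
    rewrite /exp_coeff/= normrM normfV (ger0_norm (ler0n _ _)) normrX.
    by rewrite ler_wpM2r ?invr_ge0// lerXn2r ?nnegrE// (le_trans _ (gB x)).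
  have B0 : 0 <= B by rewrite (le_trans _ (gB x)).
  have := is_cvg_series_exp_coeff B.
  move/(nondecreasing_cvgn_le _) => h; apply: h.
  apply: nondecreasing_series => i _ _; rewrite /exp_coeff/=.
  by rewrite divr_ge0 ?exprn_ge0.
- by move=> x; exact: is_cvg_series_exp_coeff.
Qed.

Let multiplier_gt g t : multiplier g ->
  multiplier (fun x => (t < g x)%R%:R).
Proof.
move=> mg.
apply: (@multiplier_cvg (fun n x =>
   expR (- (n.+1%:R * expR (- (n.+1%:R ^+ 2 * (g x - t)))))) _ 1).
- move=> n; apply: multiplier_expR.
  rewrite (_ : (fun _ => _) = (fun x => - n.+1%:R *
      expR (- n.+1%:R ^+ 2 * (g x + - t)))); last first.
    by apply/funext => x; rewrite !mulNr.
  apply: multiplierM; first exact: multiplier_cst.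
  apply: multiplier_expR; apply: multiplierM; first exact: multiplier_cst.
  by apply: multiplierD => //; exact: multiplier_cst.
- by move=> n x; rewrite ger0_norm ?expR_ge0// expR_le1 oppr_le0.
- by move=> x; rewrite -subr_gt0; exact: cvg_expR_step.
Qed.

Let good := [set A | measurable A /\ multiplier (\1_A : T -> R)].

Let good_sigma_algebra : sigma_algebra setT good.
Proof.
split.
- split => //; rewrite indic0; exact: multiplier_cst.
- move=> A [mA gA]; split; first by rewrite setTD; exact: measurableC.
  rewrite (_ : \1_ _ = (fun x => 1 + -1 * \1_A x)).
    apply: multiplierD; first exact: multiplier_cst.
    by apply: multiplierM => //; exact: multiplier_cst.
  apply/funext => x; rewrite setTD !indicE in_setC.
  by case: (x \in A) => /=; ring.
- move=> F gF; split; first by apply: bigcupT_measurable => i; have [] := gF i.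
  (* the indicator of the complement of the union is the limit of products of
     indicators of complements *)
  have gI (n : nat) : multiplier (fun x => \prod_(0 <= i < n) (1 + -1 * \1_(F i) x)).
    elim: n => [|n ih].
      under eq_fun do rewrite big_nil; exact: multiplier_cst.
    under eq_fun do rewrite big_nat_recr//=.
    apply: multiplierM => //; apply: multiplierD; first exact: multiplier_cst.
    by apply: multiplierM; [exact: multiplier_cst|have [] := gF n].
  have h01 i x : (1 + -1 * \1_(F i) x : R) = (x \notin F i)%:R.
    by rewrite indicE; case: (x \in F i) => /=; ring.
  rewrite (_ : \1_ _ = (fun x => 1 + -1 * \1_(~` (\bigcup_i F i)) x : R)); last first.
    by apply/funext => x; rewrite !indicE in_setC; case: (_ \in _) => /=; ring.
  apply: multiplierD; first exact: multiplier_cst.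
  apply: multiplierM; first exact: multiplier_cst.
  apply: (multiplier_cvg gI (B := 1)).
    move=> n x; rewrite ger0_norm; last by apply: prodr_ge0 => i _; rewrite h01.
    by apply: prodr_ile1 => i _; rewrite h01 ler0n lern1 leq_b1.
  move=> x; rewrite indicE in_setC; have [xF|xF] := boolP (x \in _) => /=.
    have [k _ Fk] := set_mem xF.
    apply: (@cvg_near_cst _ _ _ _ _ _) => //; near=> n.
    have kn : (k < n)%N by near: n; exists k.+1.
    rewrite (bigD1_seq k) ?mem_index_iota ?iota_uniq//= h01 mem_set//= mul0r//.
  apply: (@cvg_near_cst _ _ _ _ _ _) => //; apply: nearW => n.
  rewrite big1// => i _; rewrite h01; case: (boolP (x \in F i)) => // xi.
  by move: xF; rewrite mem_set//; exists i => //; exact: set_mem.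
Unshelve. all: by end_near.
Qed.

Let goodT := g_sigma_algebraType good.

Let good_measurable (A : set T) : measurable (A : set goodT) -> good A.
Proof.
rewrite /measurable/= => h.
by rewrite -(sigma_algebra_id good_sigma_algebra).
Qed.

Let good_measurable_multiplier g : multiplier g ->
  measurable_fun setT (g : goodT -> R).
Proof.
move=> mg; apply: (measurability _ (RGenOInfty.measurableE R)) => _ [_ [t ->] <-].
rewrite setTI; apply: sub_sigma_algebra; split.
  by apply: measurable_preimage => //; case: mg => -[].
have := multiplier_gt t mg; congr multiplier; apply/funext => x.
rewrite indicE; congr ((nat_of_bool _)%:R).
by apply/idP/idP; rewrite inE/= in_itv/= andbT.
Qed.

Let cvg_sin_scale (y : R) :
  (fun n => n.+1%:R * sin (n.+1%:R^-1 * y)) @ \oo --> y.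
Proof.
have [->|y0] := eqVneq y 0.
  under eq_fun do rewrite mulr0 sin0 mulr0; exact: cvg_cst.
have D : is_derive (0 : R) 1 (@sin R) (cos 0) by exact: is_derive_sin.
have hl : h^-1 *: (sin (h *: 1 + 0) - sin 0) @[h --> (0 : R)^'] --> (1 : R).
  rewrite -[X in _ --> X]cos0 -[X in _ --> X](@derive_val _ _ _ _ _ _ _ D).
  exact: (@ex_derive _ _ _ _ _ _ _ D).
have yn : (fun n => n.+1%:R^-1 * y) @ \oo --> (0 : R)^'.
  move=> A; rewrite /dnbhs /within /= => hA.
  have : (fun n => n.+1%:R^-1 * y) @ \oo --> (0 : R).
    by rewrite -(mul0r y); apply: cvgMl; exact: cvg_harmonic.
  move=> /(_ _ hA) hA'.
  have {hA'} : \forall n \near \oo, n.+1%:R^-1 * y != 0 -> A (n.+1%:R^-1 * y) by [].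
  apply: filterS => n; apply.
  by apply: mulf_neq0 => //; rewrite invr_neq0.
have h := cvg_comp _ _ yn hl.
rewrite -[X in _ --> X]mulr1.
rewrite (_ : (fun _ => _) = (fun n => y *
    ((fun h => h^-1 *: (sin (h *: 1 + 0) - sin 0)) \o
     (fun n => n.+1%:R^-1 * y)) n)); first by apply: cvgMr; exact: h.
apply/funext => n /=; rewrite addr0 sin0 subr0 scaler1 invfM invrK.
by rewrite /GRing.scale/= mulrA [y * _]mulrCA mulfV// mulr1.
Qed.

(** The set [H] localizes the comparison: it allows the measures to be compared on
    a part of the space on which [(X, Y)] is a chart. *)
Lemma cramer_wold (H : set T) (A : set (R * R)) : measurable H -> measurable A ->
  (forall u v, \int[mu]_x (\1_H x * cos (u * X x + v * Y x)) =
               \int[nu]_x (\1_H x * cos (u * X x + v * Y x))) ->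
  (forall u v, \int[mu]_x (\1_H x * sin (u * X x + v * Y x)) =
               \int[nu]_x (\1_H x * sin (u * X x + v * Y x))) ->
  mu (H `&` [set x | A (X x, Y x)]) = nu (H `&` [set x | A (X x, Y x)]).
Proof.
move=> mH mA hcos hsin.
have goodXY : measurable_fun setT ((fun x => (X x, Y x)) : goodT -> R * R).
  apply: measurable_fun_pair.
    apply: (@measurable_fun_cvg _ goodT _ _ (fun n x => n.+1%:R * sin (L n.+1%:R^-1 0 x))).
      move=> n; apply: good_measurable_multiplier; apply: multiplierM.
        exact: multiplier_cst.
      exact: multiplier_sin.
    move=> x _; under eq_fun do rewrite /L mul0r addr0; exact: cvg_sin_scale.
  apply: (@measurable_fun_cvg _ goodT _ _ (fun n x => n.+1%:R * sin (L 0 n.+1%:R^-1 x))).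
    move=> n; apply: good_measurable_multiplier; apply: multiplierM.
      exact: multiplier_cst.
    exact: multiplier_sin.
  move=> x _; under eq_fun do rewrite /L mul0r add0r; exact: cvg_sin_scale.
have [mB [_ gB]] : good [set x | A (X x, Y x)].
  apply: good_measurable.
  have h := measurable_preimage goodXY mA.
  exact: h.
have : twist \1_H.
  split; first exact: bounded_measurable_indic.
  by move=> u v; split; [exact: hcos|exact: hsin].
move=> /gB[_ /(_ 0 0)[+ _]]; rewrite /agree.
have E (m : {finite_measure set T -> \bar R}) :
    \int[m]_x (\1_H x * \1_[set x | A (X x, Y x)] x * cos (L 0 0 x)) =
    fine (m (H `&` [set x | A (X x, Y x)])).
  rewrite /Rintegral -[in RHS](setIT (H `&` _)) -integral_indic//; last first.
    exact: measurableI.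
  congr fine; apply: eq_integral => x _.
  by rewrite /L !mul0r addr0 cos0 mulr1 indicI.
rewrite !E => h; rewrite -[LHS]fineK ?fin_num_measure//; last exact: measurableI.
by rewrite h fineK ?fin_num_measure//; exact: measurableI.
Qed.

End CramerWold.

(** * The interval and the circle *)

Lemma measurable_fun_gt d (T : measurableType d) (R : realType) (f : T -> R) :
  (forall t, measurable [set x | t < f x]) -> measurable_fun setT f.
Proof.
move=> mf; apply: (measurability _ (RGenOInfty.measurableE R)) => _ [_ [t ->] <-].
rewrite setTI (_ : _ @^-1` _ = [set x | t < f x])//.
by apply/seteqP; split => x /=; rewrite in_itv/= andbT.
Qed.

(** On [[0, pi]] the cosine is strictly decreasing, so its sublevel sets are the
    superlevel sets of [f]. *)
Lemma measurable_of_cos d (T : measurableType d) (R : realType) (f : T -> R) :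
  (forall x, 0 <= f x <= pi) -> measurable_fun setT (fun x => cos (f x)) ->
  measurable_fun setT f.
Proof.
move=> fpi mcf; apply: measurable_fun_gt => t; have [t0|t0] := ltP t 0.
  rewrite (_ : [set _ | _] = setT)//; apply/seteqP; split => x //= _.
  by rewrite (lt_le_trans t0)//; have /andP[] := fpi x.
have [tpi|pit] := leP t pi.
  rewrite (_ : [set _ | _] = (fun x => cos (f x)) @^-1` `]-oo, cos t[).
    exact: measurable_preimage.
  by apply/seteqP; split => x /=; rewrite !in_itv/= ltr_cos// in_itv/= ?t0.
rewrite (_ : [set _ | _] = set0)//; apply/seteqP; split => x //=.
rewrite ltNge => /negP; apply.
by have /andP[_ /le_trans] := fpi x; apply; exact: ltW.
Qed.

Lemma cosD2piz (R : realType) (t : R) (k : int) : cos (t + 2 * pi * k%:~R) = cos t.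
Proof.
have H n s : cos (s + 2 * pi * n%:R) = cos s :> R.
  elim: n s => [|n ih] s; first by rewrite mulr0 addr0.
  have -> : 2 * pi * n.+1%:R = 2 * pi * n%:R + pi *+ 2 :> R by rewrite -natr1; ring.
  by rewrite addrA cosD2pi.
case: k => n; first exact: H.
rewrite NegzE mulrNz mulrN -[in RHS](subrK (2 * pi * n.+1%:R) t).
by rewrite [in RHS]H.
Qed.

Lemma sinD2piz (R : realType) (t : R) (k : int) : sin (t + 2 * pi * k%:~R) = sin t.
Proof. by rewrite -!cosBpihalf addrAC cosD2piz. Qed.

Lemma cos_lipschitz (R : realType) (s t : R) : `|cos s - cos t| <= `|s - t|.
Proof.
wlog st : s t / t <= s.
  by move=> H; have [/H//|/ltW/H] := leP t s; rewrite distrC (distrC t).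
have d x : x \in `]t, s[ -> is_derive x 1 (@cos R) (- sin x).
  by move=> _; exact: is_derive_cos.
have c : {within `[t, s], continuous (@cos R)}.
  by apply: continuous_subspaceT; exact: continuous_cos.
have [r _ ->] := MVT_segment st d c.
by rewrite normrM normrN ler_piMl// sin_max.
Qed.

Lemma sin_lipschitz (R : realType) (s t : R) : `|sin s - sin t| <= `|s - t|.
Proof.
rewrite -!cosBpihalf (le_trans (cos_lipschitz _ _))//.
by rewrite opprD opprK addrACA addNr addr0.
Qed.

Section IntervalMetric.
Context (R : realType).

Lemma measurable_interval_val : measurable_fun setT (fun x : intervalI R => val x).
Proof.
apply: measurable_fun_gt => t; apply: sub_sigma_algebra.
exists [set x | t < x]; first exact: open_gt.
by [].
Qed.

Lemma measurable_interval_dist :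
  measurable_fun setT (fun z : intervalI R * intervalI R => interval_dist z.1 z.2).
Proof.
have m1 := measurableT_comp measurable_interval_val
  (@measurable_fst _ _ (intervalI R) (intervalI R)).
have m2 := measurableT_comp measurable_interval_val
  (@measurable_snd _ _ (intervalI R) (intervalI R)).
by apply: measurableT_comp => //; exact: measurable_funB.
Qed.

Lemma interval_coord_metric :
  coord_metric (@interval_dist R) (fun x => val x + 1) 2.
Proof.
split.
- by move=> x; rewrite /interval_dist subrr normr0.
- by move=> x y; exact: normr_ge0.
- by move=> x y; exact: distrC.
- by move=> x y z; exact: ler_distD.
- exact: measurable_interval_dist.
- by apply: measurable_funD => //; exact: measurable_interval_val.
- case=> x /= /set_mem; rewrite /= in_itv/= => /andP[x1 x2].
  by apply/andP; split; lra.
- by move=> x y; rewrite /interval_dist opprD addrACA subrr addr0.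
Qed.

End IntervalMetric.

Lemma floor_div_itv (R : realType) (T t : R) : 0 < T ->
  T * (Num.floor (t / T))%:~R <= t < T * (Num.floor (t / T))%:~R + T.
Proof.
move=> T0; have := floor_itv (t / T); rewrite ler_pdivlMr// ltr_pdivrMr//.
by rewrite intrD mulrDl mul1r mulrC.
Qed.

Section CircleMetric.
Context (R : realType).
Implicit Types (s t : R) (x y z : circle R).

Local Notation tp := (2 * pi : R).

Let tp_gt0 : 0 < tp. Proof. by rewrite mulr_gt0// pi_gt0. Qed.

Definition circle_cos x : R := cos (repr x).
Definition circle_sin x : R := sin (repr x).

Lemma to_circle_repr x : to_circle (repr x) = x.
Proof. exact: reprK. Qed.

Lemma to_circleP s t : to_circle s = to_circle t <->
  exists k : int, s - t = tp * k%:~R.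
Proof.
split => [/eqquotP/asboolP//|h]; apply/eqquotP; exact/asboolP.
Qed.

Lemma repr_to_circle t : exists k : int, repr (to_circle t) = t + tp * k%:~R.
Proof.
have /to_circleP[k h] := to_circle_repr (to_circle t).
by exists k; rewrite -h addrC subrK.
Qed.

Lemma circle_cosE t : circle_cos (to_circle t) = cos t.
Proof. by rewrite /circle_cos; have [k ->] := repr_to_circle t; rewrite cosD2piz. Qed.

Lemma circle_sinE t : circle_sin (to_circle t) = sin t.
Proof. by rewrite /circle_sin; have [k ->] := repr_to_circle t; rewrite sinD2piz. Qed.

Lemma measurable_circle_gt (f : circle R -> R) :
  (forall t, open [set s : R | t < f (to_circle s)]) -> measurable_fun setT f.
Proof. by move=> h; apply: measurable_fun_gt => t; apply: sub_sigma_algebra; exact: h. Qed.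

Lemma measurable_circle_continuous (f : circle R -> R) :
  continuous (f \o @to_circle R) -> measurable_fun setT f.
Proof.
move=> /continuousP cf; apply: measurable_circle_gt => t.
by have := cf _ (@open_gt R t).
Qed.

Lemma measurable_circle_cos : measurable_fun setT circle_cos.
Proof.
apply: measurable_circle_continuous.
rewrite (_ : _ \o _ = cos); first exact: continuous_cos.
by apply/funext => t /=; rewrite circle_cosE.
Qed.

Lemma measurable_circle_sin : measurable_fun setT circle_sin.
Proof.
apply: measurable_circle_continuous.
rewrite (_ : _ \o _ = sin); first exact: continuous_sin.
by apply/funext => t /=; rewrite circle_sinE.
Qed.

(** The representative of [t] modulo [2 pi] in [[0, 2 pi[]. *)
Let frac t := t - tp * (Num.floor (t / tp))%:~R.

Let frac_def t (k : int) : tp * k%:~R <= t < tp * (k + 1)%:~R ->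
  frac t = t - tp * k%:~R.
Proof.
move=> h; rewrite /frac (@floor_def _ _ k)// ler_pdivlMr// ltr_pdivrMr//.
by rewrite !(mulrC _ tp).
Qed.

Let frac_itv t : 0 <= frac t < tp.
Proof.
have /andP[a b] := floor_div_itv t tp_gt0.
by rewrite /frac subr_ge0 a ltrBlDl.
Qed.

Let frac_congr t : exists k : int, frac t = t + tp * k%:~R.
Proof. by exists (- Num.floor (t / tp)); rewrite /frac mulrNz mulrN. Qed.

Let fracD t (k : int) : frac (t + tp * k%:~R) = frac t.
Proof.
have /andP[a b] := floor_div_itv t tp_gt0.
rewrite (@frac_def _ (Num.floor (t / tp) + k)); first by rewrite /frac intrD; ring.
rewrite !intrD; apply/andP; split; first by rewrite mulrDr lerD2r.
move: a b; move: (Num.floor _)%:~R => q a b.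
have -> : tp * (q + k%:~R + 1%:~R) = tp * q + tp + tp * k%:~R by ring.
by rewrite ltrD2r.
Qed.

Definition circle_coord x : R := frac (repr x).

Lemma circle_coordE t : circle_coord (to_circle t) = frac t.
Proof. by rewrite /circle_coord; have [k ->] := repr_to_circle t; rewrite fracD. Qed.

Lemma circle_coord_itv x : 0 <= circle_coord x < tp.
Proof. exact: frac_itv. Qed.

Lemma to_circle_coord x : to_circle (circle_coord x) = x.
Proof.
rewrite -[RHS]to_circle_repr; apply/to_circleP; rewrite /circle_coord.
by have [k ->] := frac_congr (repr x); exists k; rewrite addrC addKr.
Qed.

(** [circle_coord] jumps from [2 pi] down to 0, so it is lower semicontinuous:
    its superlevel sets are open. *)
Lemma measurable_circle_coord : measurable_fun setT circle_coord.
Proof.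
apply: measurable_circle_gt => t; under eq_set do rewrite circle_coordE.
have [t0|t0] := ltP t 0.
  rewrite (_ : [set _ | _] = setT); first exact: openT.
  apply/seteqP; split => s //= _; apply: lt_le_trans t0 _.
  by have /andP[] := frac_itv s.
rewrite (_ : [set _ | _] = \bigcup_(k in [set: int])
    `]tp * k%:~R + t, tp * (k + 1)%:~R[%classic).
  by apply: bigcup_open => k _; exact: itv_open.
apply/seteqP; split => s /=.
  move=> ts; exists (Num.floor (s / tp)) => //=; rewrite in_itv/=.
  move: ts; rewrite /frac => ts.
  have /andP[a b] := floor_div_itv s tp_gt0.
  by rewrite addrC -ltrBrDr ts/= intrD mulrDr mulr1.
move=> [k _ /=]; rewrite in_itv/= => /andP[a b].
rewrite (@frac_def _ k); first by rewrite ltrBrDl.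
by rewrite b andbT ltW// (le_lt_trans _ a)// lerDl.
Qed.

Lemma circle_dist_le x y (k : int) :
  circle_dist x y <= `|repr x - repr y + tp * k%:~R|.
Proof.
apply: ge_inf; first by exists 0 => _ [j _ <-]; exact: normr_ge0.
by exists k.
Qed.

(** Shifting [repr x - repr y] into [[- pi, pi[] minimizes its absolute value among
    its translates by multiples of [2 pi]. *)
Lemma circle_dist_attained x y : exists2 k : int,
  circle_dist x y = `|repr x - repr y + tp * k%:~R| & circle_dist x y <= pi.
Proof.
set t := repr x - repr y; pose k := - Num.floor ((t + pi) / tp).
set w := t + tp * k%:~R.
have wpi : `|w| <= pi.
  have := floor_div_itv (t + pi) tp_gt0.
  have -> : w = t - tp * (Num.floor ((t + pi) / tp))%:~R by rewrite /w /k mulrNz mulrN.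
  move: (Num.floor _)%:~R => q /andP[a b].
  by rewrite ler_norml; apply/andP; split; lra.
have kmin (j : int) : `|w| <= `|t + tp * j%:~R|.
  have -> : t + tp * j%:~R = w + tp * (j - k)%:~R by rewrite /w intrB; ring.
  have [->|] := eqVneq (j - k) 0; first by rewrite mulr0 addr0.
  move: (j - k) => i i0.
  have : 1 <= `|i%:~R| :> R.
    by rewrite -intr_norm -[1]/(1%:~R) ler_int -gtz0_ge1 normr_gt0.
  move=> i1; have : tp <= `|tp * i%:~R|.
    by rewrite normrM (gtr0_norm tp_gt0) ler_peMr// ltW.
  move=> h; have := lerB_normD (tp * i%:~R) w; rewrite (addrC w).
  by move=> h'; apply: le_trans h'; lra.
have dw : circle_dist x y = `|w|.
  apply/eqP; rewrite eq_le circle_dist_le/=; apply: lb_le_inf.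
    by exists `|w|; exists k.
  by move=> _ [j _ <-]; exact: kmin.
by exists k; rewrite dw.
Qed.

Lemma circle_dist_ge0 x y : 0 <= circle_dist x y.
Proof. by have [k -> _] := circle_dist_attained x y; exact: normr_ge0. Qed.

Lemma circle_dist_lepi x y : circle_dist x y <= pi.
Proof. by have [] := circle_dist_attained x y. Qed.

Lemma circle_dist_to_circle s t :
  circle_dist (to_circle s) (to_circle t) <= `|s - t|.
Proof.
have [k ek] := repr_to_circle s; have [l el] := repr_to_circle t.
have := circle_dist_le (to_circle s) (to_circle t) (l - k).
rewrite ek el intrB (_ : _ + _ - _ + _ = s - t)//; ring.
Qed.

(** Together with [0 <= circle_dist x y <= pi] this formula determines the distance
    from the cosine and the sine of the two points, which are continuous
    functions on the circle. *)
Lemma cos_circle_dist x y : cos (circle_dist x y) =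
  circle_cos x * circle_cos y + circle_sin x * circle_sin y.
Proof.
have [k -> _] := circle_dist_attained x y.
rewrite (_ : cos `|_| = cos (repr x - repr y + tp * k%:~R)).
  by rewrite cosD2piz cosB.
by case: (ler0P (repr x - repr y + tp * k%:~R)) => // _; rewrite cosN.
Qed.

Lemma measurable_circle_dist :
  measurable_fun setT (fun z : circle R * circle R => circle_dist z.1 z.2).
Proof.
apply: measurable_of_cos => [z|].
  by rewrite circle_dist_ge0 circle_dist_lepi.
under eq_fun do rewrite cos_circle_dist.
have c := measurable_circle_cos; have s := measurable_circle_sin.
have c1 : measurable_fun setT (fun z : circle R * circle R => circle_cos z.1).
  exact: (measurableT_comp c (@measurable_fst _ _ (circle R) (circle R))).
have c2 : measurable_fun setT (fun z : circle R * circle R => circle_cos z.2).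
  exact: (measurableT_comp c (@measurable_snd _ _ (circle R) (circle R))).
have s1 : measurable_fun setT (fun z : circle R * circle R => circle_sin z.1).
  exact: (measurableT_comp s (@measurable_fst _ _ (circle R) (circle R))).
have s2 : measurable_fun setT (fun z : circle R * circle R => circle_sin z.2).
  exact: (measurableT_comp s (@measurable_snd _ _ (circle R) (circle R))).
exact: (measurable_funD (measurable_funM c1 c2) (measurable_funM s1 s2)).
Qed.

Lemma circle_coord_metric :
  coord_metric (@circle_dist R) circle_coord tp.
Proof.
split.
- move=> x; apply/eqP; rewrite eq_le circle_dist_ge0 andbT.
  by have := circle_dist_le x x 0; rewrite subrr mulr0 addr0 normr0.
- exact: circle_dist_ge0.
- have H x y : circle_dist x y <= circle_dist y x.
    have [k -> _] := circle_dist_attained y x.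
    have -> : `|repr y - repr x + tp * k%:~R| =
              `|repr x - repr y + tp * (- k)%:~R|.
      by rewrite -normrN; congr (`|_|); rewrite mulrNz; ring.
    exact: circle_dist_le.
  by move=> x y; apply/eqP; rewrite eq_le !H.
- move=> x y z; have [k -> _] := circle_dist_attained x y.
  have [l -> _] := circle_dist_attained y z.
  rewrite (le_trans (circle_dist_le x z (k + l)))// (le_trans _ (ler_normD _ _))//.
  by rewrite intrD le_eqVlt; apply/orP; left; apply/eqP; congr `|_|; ring.
- exact: measurable_circle_dist.
- exact: measurable_circle_coord.
- by move=> x; have /andP[-> /ltW] := circle_coord_itv x.
- by move=> x y; rewrite -{1}(to_circle_coord x) -{1}(to_circle_coord y)
    circle_dist_to_circle.
Qed.

Lemma circle_cos_lipschitz x y : `|circle_cos x - circle_cos y| <= circle_dist x y.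
Proof.
have [k -> _] := circle_dist_attained x y.
by rewrite /circle_cos -(cosD2piz (repr x) k) addrAC cos_lipschitz.
Qed.

Lemma circle_sin_lipschitz x y : `|circle_sin x - circle_sin y| <= circle_dist x y.
Proof.
have [k -> _] := circle_dist_attained x y.
by rewrite /circle_sin -(sinD2piz (repr x) k) addrAC sin_lipschitz.
Qed.

End CircleMetric.

(** * Coordinates on the sphere *)

Section Laws.
Context d (T : measurableType d) d' (T' : measurableType d') (R : realType).
Context (mu nu : {finite_measure set T -> \bar R}).

Lemma Rintegral_pushforward (phi : T -> T') (m : {measure set T -> \bar R})
    (m' : {measure set T' -> \bar R}) (f : T' -> R) :
  measurable_fun setT phi ->
  (forall A, measurable A -> m' A = m (phi @^-1` A)) -> measurable_fun setT f ->
  m.-integrable setT (EFin \o (f \o phi)) ->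
  \int[m']_y f y = \int[m]_x f (phi x).
Proof.
move=> mphi mm' mf fi; rewrite /Rintegral; congr fine.
rewrite (eq_measure_integral (pushforward m phi)); last by move=> A mA _; rewrite mm'.
rewrite integral_pushforward//; exact/measurable_EFinP.
Qed.

Lemma Rintegral_same_law (phi : T -> T') (f : T' -> R) :
  measurable_fun setT phi ->
  (forall A, measurable A -> mu (phi @^-1` A) = nu (phi @^-1` A)) ->
  bounded_measurable f ->
  \int[mu]_x f (phi x) = \int[nu]_x f (phi x).
Proof.
move=> mphi law bf; have [mf [B fB]] := bf.
have bfphi : bounded_measurable (f \o phi).
  by split; [exact: measurableT_comp|exists B => x; exact: fB].
rewrite -(@Rintegral_pushforward phi mu (pushforward mu phi) f)//; last first.
  exact: bounded_measurable_integrable.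
apply: Rintegral_pushforward => //; exact: bounded_measurable_integrable.
Qed.

End Laws.

Section Perturbation.
Context d (X : measurableType d) dO (O : measurableType dO) (R : realType).
Context (dist : X -> X -> R) (coord : X -> R) (M p : R).
Hypothesis cm : coord_metric dist coord M.
Hypothesis p1 : 1 <= p.
Implicit Types (mu nu : probability O R) (A B : O -> X).

(** Two triangle inequalities; each of the two laws moves by at most the
    [L^p]-distance between the maps. *)
Lemma wasserstein_perturb mu nu A B : measurable_fun setT A -> measurable_fun setT B ->
  (wasserstein dist p (pushforward mu A) (pushforward nu A) <=
   wasserstein dist p (pushforward mu B) (pushforward nu B) +
   (Lp p mu (fun x => dist (A x) (B x)) + Lp p nu (fun x => dist (A x) (B x))))%E.
Proof.
move=> mA mB.
have hmu := wasserstein_maps cm p1 mu mA mB.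
have hnu := wasserstein_maps cm p1 nu mA mB.
have [P PE] := pushforward_probability mu mA.
have [Q QE] := pushforward_probability nu mA.
have [P' PE'] := pushforward_probability mu mB.
have [Q' QE'] := pushforward_probability nu mB.
move: hmu hnu; rewrite -PE -QE -PE' -QE' => hmu hnu.
apply: le_trans (wasserstein_triangle cm p1 P P' Q) _.
rewrite (wasserstein_sym cm p1 Q Q') in hnu.
apply: le_trans (leeD hmu (wasserstein_triangle cm p1 P' Q' Q)) _.
rewrite addeCA; apply: leeD => //.
by apply: leeD.
Qed.

Lemma wasserstein0_same_integral mu nu A (f : X -> R) (L : R) :
  measurable_fun setT A ->
  wasserstein dist p (pushforward mu A) (pushforward nu A) = 0%E ->
  measurable_fun setT f -> (forall x y, `|f x - f y| <= L * dist x y) ->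
  \int[mu]_x f (A x) = \int[nu]_x f (A x).
Proof.
move=> mA W0 mf fL.
have [P PE] := pushforward_probability mu mA.
have [Q QE] := pushforward_probability nu mA.
move: W0; rewrite -PE -QE => W0.
have := wasserstein0_integral_lipschitz cm p1 W0 mf fL.
have bf : bounded_measurable (fun x => f (A x)).
  split; first exact: measurableT_comp.
  exists (`|f point| + `|L| * M) => x.
  rewrite -[f (A x)](subrK (f point)) (le_trans (ler_normD _ _))// addrC lerD2l.
  rewrite (le_trans (fL _ _))//.
  rewrite (@le_trans _ _ (`|L| * dist (A x) point))//.
    by rewrite ler_wpM2r ?ler_norm// (cm_ge0 cm).
  by rewrite ler_wpM2l// (coord_metric_le_bound cm).
rewrite (@Rintegral_pushforward _ _ _ _ _ A mu P)//=; last 2 first.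
- by move=> B mB; rewrite PE.
- exact: bounded_measurable_integrable.
rewrite (@Rintegral_pushforward _ _ _ _ _ A nu Q)//=.
- by move=> B mB; rewrite QE.
- exact: bounded_measurable_integrable.
Qed.

End Perturbation.

Lemma polar_unit (R : realType) (x y : R) : x ^+ 2 + y ^+ 2 = 1 ->
  exists phi, x = cos phi /\ y = sin phi.
Proof.
move=> xy; have x1 : -1 <= x <= 1.
  rewrite -ler_norml -(@expr_le1 _ 2)// real_normK ?num_real//.
  by rewrite -xy lerDl sqr_ge0.
have y2 : 1 - x ^+ 2 = y ^+ 2 by rewrite -xy addrC addKr.
have [y0|y0] := leP 0 y.
  exists (acos x); rewrite acosK ?in_itv//=; split => //.
  by rewrite sin_acos// y2 sqrtr_sqr ger0_norm.
exists (- acos x); rewrite cosN sinN acosK ?in_itv//=; split => //.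
by rewrite sin_acos// y2 sqrtr_sqr ltr0_norm// opprK.
Qed.

Lemma polar_coordinates (R : realType) (u v : R) :
  exists t phi, u = t * cos phi /\ v = t * sin phi.
Proof.
have [uv0|uv0] := eqVneq (u ^+ 2 + v ^+ 2) 0.
  exists 0, 0; rewrite !mul0r; move/eqP : uv0.
  by rewrite paddr_eq0 ?sqr_ge0// !sqrf_eq0 => /andP[/eqP -> /eqP ->].
have t0 : 0 < Num.sqrt (u ^+ 2 + v ^+ 2).
  by rewrite sqrtr_gt0 lt0r uv0 addr_ge0// sqr_ge0.
set t := Num.sqrt _ in t0.
have t2 : t ^+ 2 = u ^+ 2 + v ^+ 2 by rewrite sqr_sqrtr// addr_ge0// sqr_ge0.
have [|phi [c s]] := @polar_unit R (u / t) (v / t).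
  by rewrite !expr_div_n -mulrDl -t2 divff// sqrf_eq0 gt_eqF.
by exists t, phi; rewrite -c -s ![t * _]mulrC !divfK ?gt_eqF.
Qed.

Section SphereCoordinates.
Context (R : realType).
Implicit Types (xi : sphere R).

Lemma continuous_sphere_coord (i : 'I_3) :
  continuous (fun xi : sphere R => val xi i 0).
Proof.
apply/continuousP => A oA.
have /continuousP/(_ _ oA) oV := @coord_continuous R 3 1 i 0.
by exists ((fun M : 'cV[R]_3 => M i 0) @^-1` A).
Qed.

Lemma measurable_sphere_continuous (f : sphere R -> R) :
  continuous f -> measurable_fun setT f.
Proof.
move=> /continuousP cf; apply: measurable_fun_gt => t.
by apply: sub_sigma_algebra; exact: cf _ (@open_gt R t).
Qed.

Lemma measurable_sphere_coord (i : 'I_3) :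
  measurable_fun setT (fun xi : sphere R => val xi i 0).
Proof.
apply: measurable_sphere_continuous; exact: continuous_sphere_coord.
Qed.

Lemma sphere_sqr xi : val xi 0 0 ^+ 2 + val xi 1 0 ^+ 2 + val xi 2 0 ^+ 2 = 1.
Proof. by have /set_mem := valP xi. Qed.

Lemma cV3_eq (v w : 'cV[R]_3) : v 0 0 = w 0 0 -> v 1 0 = w 1 0 -> v 2 0 = w 2 0 ->
  v = w.
Proof.
move=> h0 h1 h2; apply/colP => -[[|[|[|//]]] h].
- by have -> : Ordinal h = 0 by exact: val_inj.
- by have -> : Ordinal h = 1 by exact: val_inj.
- by have -> : Ordinal h = 2 by exact: val_inj.
Qed.

(** If [F] inverts [Y] on [H], then every Borel subset of [H] is cut out by a
    measurable condition on [Y]: such sets form a sigma-algebra, and for the trace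
    of an open set [V] of the ambient space the condition is [F (Y xi) \in V]. *)
Lemma sphere_trace_coordinates dS (S : measurableType dS) (H : set (sphere R))
    (Y : sphere R -> S) (F : S -> 'cV[R]_3) :
  (forall i, measurable_fun setT (fun z => F z i 0)) ->
  (forall xi, H xi -> F (Y xi) = val xi) ->
  forall B : set (sphere R), measurable B ->
  exists2 B' : set S, measurable B' & H `&` B = H `&` Y @^-1` B'.
Proof.
move=> mF FY.
pose G := [set B : set (sphere R) | exists2 B' : set S, measurable B' &
  H `&` B = H `&` Y @^-1` B'].
suff GB : @measurable _ (sphere R) `<=` G by move=> B /GB.
apply: smallest_sub; last first.
  move=> _ [V oV <-]; exists (F @^-1` V); first exact: measurable_preimage_open.
  by apply/seteqP; split => xi [Hxi /= h]; split => //=; move: h; rewrite /= FY.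
split.
- by exists set0 => //; rewrite preimage_set0.
- move=> B [B' mB' BE]; exists (~` B'); first exact: measurableC.
  rewrite setTD; apply/seteqP; split => xi [Hxi h]; split => // h'; apply: h.
    have : (H `&` Y @^-1` B') xi by [].
    by rewrite -BE => -[].
  have : (H `&` B) xi by [].
  by rewrite BE => -[].
- move=> B GB; have /choice[B' hB'] : forall i, exists B', measurable B' /\
      H `&` B i = H `&` Y @^-1` B'.
    by move=> i; have [B' ? ?] := GB i; exists B'.
  exists (\bigcup_i B' i).
    by apply: bigcupT_measurable => i; have [] := hB' i.
  rewrite preimage_bigcup !setI_bigcupr; apply: eq_bigcup => // i _.
  by have [] := hB' i.
Qed.

Definition agree_on (mu nu : probability (sphere R) R) (H : set (sphere R)) :=
  forall B, measurable B -> mu (H `&` B) = nu (H `&` B).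

Lemma agree_onU mu nu H K : measurable H -> measurable K ->
  agree_on mu nu H -> agree_on mu nu K -> agree_on mu nu (H `|` K).
Proof.
move=> mH mK aH aK B mB.
have E : (H `|` K) `&` B = (H `&` B) `|` (K `&` (B `\` H)).
  apply/seteqP; split => [xi [[Hxi|Kxi] Bxi]|xi [[Hxi Bxi]|[Kxi [Bxi _]]]].
  - by left.
  - by have [Hxi|nHxi] := pselect (H xi); [left|right].
  - by split => //; left.
  - by split => //; right.
have mD : measurable (B `\` H) by exact: measurableD.
rewrite E !measureU//; try (by apply: measurableI);
  try (by rewrite -subset0 => xi [[Hxi _] [_ [_]]]).
by rewrite /= aH// aK.
Qed.

Lemma agree_on_cover mu nu H : agree_on mu nu H -> (forall xi, H xi) ->
  measure_eq mu nu.
Proof.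
move=> aH HT B mB; have HE : H = setT by apply/seteqP; split.
by have := aH B mB; rewrite HE !setTI.
Qed.

(** A chart [(X, Y)] with measurable inverse [F] on [H] reduces the comparison of the
    measures on [H] to characteristic functions in the plane. *)
Lemma agree_on_chart (mu nu : probability (sphere R) R) (H : set (sphere R)) (X Y : sphere R -> R)
    (F : R * R -> 'cV[R]_3) :
  measurable H -> measurable_fun setT X -> measurable_fun setT Y ->
  (forall i, measurable_fun setT (fun z => F z i 0)) ->
  (forall xi, H xi -> F (X xi, Y xi) = val xi) ->
  (forall u v, \int[mu]_xi (\1_H xi * cos (u * X xi + v * Y xi)) =
               \int[nu]_xi (\1_H xi * cos (u * X xi + v * Y xi))) ->
  (forall u v, \int[mu]_xi (\1_H xi * sin (u * X xi + v * Y xi)) =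
               \int[nu]_xi (\1_H xi * sin (u * X xi + v * Y xi))) ->
  agree_on mu nu H.
Proof.
move=> mH mX mY mF FY hc hs B mB.
have [B' mB' ->] := @sphere_trace_coordinates _ _ H (fun xi => (X xi, Y xi)) F mF FY B mB.
exact: (cramer_wold mX mY mH mB' hc hs).
Qed.

End SphereCoordinates.

(** * Even measures *)

Section ContinuousAlgebra.
Context (T : topologicalType) (R : realType).
Implicit Types f g : T -> R.

Lemma continuous_cmul (c : R) f : continuous f -> continuous (fun x => c * f x).
Proof. by move=> cf x; apply: cvgMr; exact: cf. Qed.

Lemma continuous_add f g : continuous f -> continuous g ->
  continuous (fun x => f x + g x).
Proof. by move=> cf cg x; apply: cvgD; [exact: cf|exact: cg]. Qed.

Lemma continuous_mul f g : continuous f -> continuous g ->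
  continuous (fun x => f x * g x).
Proof. by move=> cf cg x; apply: cvgM; [exact: cf|exact: cg]. Qed.

Lemma continuous_opp f : continuous f -> continuous (fun x => - f x).
Proof. by move=> cf x; apply: cvgN; exact: cf. Qed.

Lemma continuous_of_comp f (g : R -> R) : continuous f -> continuous g ->
  continuous (fun x => g (f x)).
Proof. by move=> cf cg x; exact: (continuous_comp (cf x) (cg _)). Qed.

End ContinuousAlgebra.

Section Even.
Context (R : realType).
Implicit Types (mu nu : probability (sphere R) R).

Let X (xi : sphere R) := val xi 0 0.
Let Y (xi : sphere R) := val xi 1 0.
Let Z (xi : sphere R) := val xi 2 0.

Let mX : measurable_fun setT X. Proof. exact: measurable_sphere_coord. Qed.
Let mY : measurable_fun setT Y. Proof. exact: measurable_sphere_coord. Qed.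
Let mZ : measurable_fun setT Z. Proof. exact: measurable_sphere_coord. Qed.

Let upper : set (sphere R) := [set xi | 0 < Z xi].
Let lower : set (sphere R) := [set xi | Z xi < 0].
Let equator : set (sphere R) := [set xi | Z xi = 0].

Let mupper : measurable upper.
Proof.
rewrite (_ : upper = Z @^-1` `]0, +oo[); first exact: measurable_preimage.
by apply/seteqP; split => xi /=; rewrite in_itv/= andbT.
Qed.

Let mlower : measurable lower.
Proof.
rewrite (_ : lower = Z @^-1` `]-oo, 0[); first exact: measurable_preimage.
by apply/seteqP; split => xi /=; rewrite in_itv/=.
Qed.

Let mequator : measurable equator.
Proof. exact: (measurable_preimage mZ (measurable_set1 0)). Qed.

(** Evenness is tested on continuous functions only, so the indicator of the upper
    hemisphere is approximated by smooth functions of the third coordinate. *)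
Lemma even_half_integrals mu (g : R -> R) (u v : R) : even_probability mu ->
  continuous g -> (forall t, `|g t| <= 1) ->
  \int[mu]_xi (\1_upper xi * g (u * X xi + v * Y xi)) =
  \int[mu]_xi (\1_lower xi * g (u * X xi + v * Y xi)).
Proof.
move=> ev cg g1.
pose s (n : nat) (z : R) : R := expR (- (n.+1%:R * expR (- (n.+1%:R ^+ 2 * z)))).
have cid : continuous (fun z : R => z) by move=> z; exact: cvg_id.
have cs n : continuous (s n).
  do 2 (apply: continuous_of_comp (@continuous_expR R); apply: continuous_opp;
    apply: continuous_cmul).
  exact: cid.
have s1 n z : `|s n z| <= 1.
  by rewrite ger0_norm ?expR_ge0// expR_le1 oppr_le0.
have slim z : s ^~ z @ \oo --> ((0 < z)%R%:R : R) by exact: cvg_expR_step.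
have cX : continuous X by exact: continuous_sphere_coord.
have cY : continuous Y by exact: continuous_sphere_coord.
have cZ : continuous Z by exact: continuous_sphere_coord.
have cL : continuous (fun xi => g (u * X xi + v * Y xi)).
  by apply: continuous_of_comp cg; apply: continuous_add; exact: continuous_cmul.
pose f n xi := s n (Z xi) * g (u * X xi + v * Y xi).
pose f' n xi := s n (- Z xi) * g (u * X xi + v * Y xi).
have cf n : continuous (f n).
  by apply: continuous_mul cL; apply: continuous_of_comp (cs n).
have cf' n : continuous (f' n).
  by apply: continuous_mul cL; apply: continuous_of_comp (cs n); exact: continuous_opp.
have E n : \int[mu]_xi f n xi = \int[mu]_xi f' n xi.
  rewrite /Rintegral (ev (f n) (cf n)); congr fine; apply: eq_integral => xi _.
  by rewrite /f /f' /X /Y /Z /= !mxE.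
have fB n xi : `|f n xi| <= 1 by rewrite normrM mulr_ile1.
have fB' n xi : `|f' n xi| <= 1 by rewrite normrM mulr_ile1.
have H1 : (fun n => \int[mu]_xi f n xi) @ \oo -->
    \int[mu]_xi (\1_upper xi * g (u * X xi + v * Y xi)).
  apply: (@cvg_Rintegral _ _ _ mu f _ 1) => //.
    by move=> n; exact: measurable_sphere_continuous.
  move=> xi; apply: cvgMl; rewrite indicE.
  have -> : (xi \in upper) = (0 < Z xi) by apply/idP/idP; rewrite inE.
  exact: slim.
have H2 : (fun n => \int[mu]_xi f' n xi) @ \oo -->
    \int[mu]_xi (\1_lower xi * g (u * X xi + v * Y xi)).
  apply: (@cvg_Rintegral _ _ _ mu f' _ 1) => //.
    by move=> n; exact: measurable_sphere_continuous.
  move=> xi; apply: cvgMl; rewrite indicE.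
  have -> : (xi \in lower) = (0 < - Z xi) by rewrite oppr_gt0; apply/idP/idP; rewrite inE.
  exact: slim.
have E' : (fun n => \int[mu]_xi f n xi) = (fun n => \int[mu]_xi f' n xi).
  exact/funext.
by rewrite E' in H1; exact: cvg_unique H1 H2.
Qed.

(** Integrals of functions of the first two coordinates over the upper hemisphere
    are half of those over the complement of the equator, that is, over the
    preimage of the open unit disc; the latter are determined by the law of these
    coordinates.  The third coordinate is recovered as plus or minus a square root
    above or below the equator, and is 0 on it. *)
Lemma even_measure_eq mu nu : even_probability mu -> even_probability nu ->
  (forall u v, \int[mu]_xi cos (u * X xi + v * Y xi) =
               \int[nu]_xi cos (u * X xi + v * Y xi)) ->
  (forall u v, \int[mu]_xi sin (u * X xi + v * Y xi) =
               \int[nu]_xi sin (u * X xi + v * Y xi)) ->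
  measure_eq mu nu.
Proof.
move=> emu enu hc hs.
have mXY : measurable_fun setT (fun xi => (X xi, Y xi)) by exact: measurable_fun_pair.
have law (A : set (R * R)) : measurable A ->
    mu ((fun xi => (X xi, Y xi)) @^-1` A) = nu ((fun xi => (X xi, Y xi)) @^-1` A).
  move=> mA; have := @cramer_wold _ _ R mu nu X Y mX mY setT A measurableT mA.
  rewrite !setTI; apply => u v.
    under eq_Rintegral do rewrite indicT mul1r.
    by rewrite hc; apply: eq_Rintegral => xi _; rewrite indicT mul1r.
  under eq_Rintegral do rewrite indicT mul1r.
  by rewrite hs; apply: eq_Rintegral => xi _; rewrite indicT mul1r.
pose disc : set (R * R) := [set z | z.1 ^+ 2 + z.2 ^+ 2 < 1].
have mdisc : measurable disc.
  rewrite (_ : disc = (fun z : R * R => z.1 ^+ 2 + z.2 ^+ 2) @^-1` `]-oo, 1[).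
    apply: measurable_preimage => //.
    by apply: measurable_funD; apply: measurable_funX.
  by apply/seteqP; split => xi /=; rewrite in_itv/=.
have discE xi : disc (X xi, Y xi) <-> Z xi != 0.
  rewrite /disc/= -(sphere_sqr xi) -/(X xi) -/(Y xi) -/(Z xi) ltrDl.
  by rewrite lt0r sqr_ge0 andbT sqrf_eq0.
have key (g : R -> R) : continuous g -> (forall t, `|g t| <= 1) ->
  (forall u v, \int[mu]_xi (\1_upper xi * g (u * X xi + v * Y xi)) =
               \int[nu]_xi (\1_upper xi * g (u * X xi + v * Y xi))) /\
  (forall u v, \int[mu]_xi (\1_equator xi * g (u * X xi + v * Y xi)) =
               \int[nu]_xi (\1_equator xi * g (u * X xi + v * Y xi))).
  move=> cg g1.
  have bg u v : bounded_measurable (fun z : R * R => g (u * z.1 + v * z.2)).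
    split; last by exists 1.
    apply: measurableT_comp; first exact: continuous_measurable_fun.
    by apply: measurable_funD; exact: measurable_funM.
  have bgX u v : bounded_measurable (fun xi => g (u * X xi + v * Y xi)).
    have [mg _] := bg u v; split; last by exists 1.
    exact: (measurableT_comp mg mXY).
  have bI (H : set (sphere R)) u v : measurable H ->
      bounded_measurable (fun xi => \1_H xi * g (u * X xi + v * Y xi)).
    by move=> mH; apply: bounded_measurableM => //; exact: bounded_measurable_indic.
  have S (C : set (R * R)) u v : measurable C ->
      \int[mu]_xi (\1_C (X xi, Y xi) * g (u * X xi + v * Y xi)) =
      \int[nu]_xi (\1_C (X xi, Y xi) * g (u * X xi + v * Y xi)).
    move=> mC.
    apply: (@Rintegral_same_law _ _ _ _ _ mu nu (fun xi => (X xi, Y xi))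
      (fun z => \1_C z * g (u * z.1 + v * z.2))) => //.
    by apply: bounded_measurableM => //; exact: bounded_measurable_indic.
  split=> u v.
    have D (m : probability (sphere R) R) : even_probability m ->
        \int[m]_xi (\1_disc (X xi, Y xi) * g (u * X xi + v * Y xi)) =
        2 * \int[m]_xi (\1_upper xi * g (u * X xi + v * Y xi)).
      move=> em; rewrite mulr_natl mulr2n {2}(@even_half_integrals m g u v em cg g1).
      rewrite -RintegralD//; try (by apply: bounded_measurable_integrable; exact: bI).
      apply: eq_Rintegral => xi _; rewrite -mulrDl; congr (_ * _).
      rewrite !indicE.
      have -> : ((X xi, Y xi) \in disc) = (Z xi != 0).
        by apply/idP/idP; rewrite inE => /discE.
      have -> : (xi \in upper) = (0 < Z xi) by apply/idP/idP; rewrite inE.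
      have -> : (xi \in lower) = (Z xi < 0) by apply/idP/idP; rewrite inE.
      by case: (ltgtP (Z xi) 0) => /=; rewrite ?addr0 ?add0r.
    have := S disc u v mdisc; rewrite !D// => /mulfI; apply.
    by rewrite pnatr_eq0.
  have E (m : probability (sphere R) R) :
      \int[m]_xi (\1_equator xi * g (u * X xi + v * Y xi)) =
      \int[m]_xi (\1_(~` disc) (X xi, Y xi) * g (u * X xi + v * Y xi)).
    apply: eq_Rintegral => xi _; congr (_ * _); rewrite !indicE in_setC.
    congr ((nat_of_bool _)%:R); apply/idP/idP.
      by rewrite inE /equator/= => z0; apply/negP; rewrite inE => /discE; rewrite z0 eqxx.
    move=> h; rewrite inE /equator/=; apply/eqP; apply: contraNT h => z0.
    by rewrite inE; exact/discE.
  by rewrite !E; apply: S; exact: measurableC.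
have [cu ce] := key cos (@continuous_cos R) (@cos_max R).
have [su se] := key sin (@continuous_sin R) (@sin_max R).
have lowerE (m : probability (sphere R) R) (g : R -> R) u v : even_probability m ->
    continuous g -> (forall t, `|g t| <= 1) ->
    \int[m]_xi (\1_lower xi * g (u * X xi + v * Y xi)) =
    \int[m]_xi (\1_upper xi * g (u * X xi + v * Y xi)).
  by move=> em cg g1; rewrite even_half_integrals.
have Zsqr xi : Z xi ^+ 2 = 1 - X xi ^+ 2 - Y xi ^+ 2.
  by rewrite -(sphere_sqr xi) /X /Y /Z; ring.
pose F (c : R) (z : R * R) : 'cV[R]_3 :=
  vec3 z.1 z.2 (c * Num.sqrt (1 - z.1 ^+ 2 - z.2 ^+ 2)).
have mF c i : measurable_fun setT (fun z => F c z i 0).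
  have ms : measurable_fun setT (fun z : R * R => c * Num.sqrt (1 - z.1 ^+ 2 - z.2 ^+ 2)).
    apply: measurable_funM => //; apply: measurableT_comp.
      by apply: continuous_measurable_fun; exact: sqrt_continuous.
    by apply: measurable_funB; [apply: measurable_funB => //|]; exact: measurable_funX.
  case: i => -[|[|[|//]]] h.
  - by rewrite (_ : (fun _ => _) = fst)//; apply/funext => z; rewrite /F mxE.
  - by rewrite (_ : (fun _ => _) = snd)//; apply/funext => z; rewrite /F mxE.
  - by rewrite (_ : (fun _ => _) = (fun z : R * R => c * Num.sqrt (1 - z.1 ^+ 2 - z.2 ^+ 2)))//;
      apply/funext => z; rewrite /F mxE.
have FE c xi : c * `|Z xi| = Z xi -> F c (X xi, Y xi) = val xi.
  move=> cz; apply: cV3_eq; rewrite /F !mxE//=.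
  by rewrite -Zsqr sqrtr_sqr cz.
have a1 : agree_on mu nu upper.
  apply: (@agree_on_chart R mu nu upper X Y (F 1)) => // xi h.
  by apply: FE; rewrite mul1r gtr0_norm.
have a2 : agree_on mu nu lower.
  apply: (@agree_on_chart R mu nu lower X Y (F (-1))) => // [xi h|u v|u v].
  - by apply: FE; rewrite mulN1r ltr0_norm// opprK.
  - by rewrite !lowerE//; [exact: continuous_cos|exact: cos_max|exact: continuous_cos|exact: cos_max].
  - by rewrite !lowerE//; [exact: continuous_sin|exact: sin_max|exact: continuous_sin|exact: sin_max].
have a3 : agree_on mu nu equator.
  apply: (@agree_on_chart R mu nu equator X Y (F 0)) => // xi h.
  by apply: FE; rewrite mul0r h.
have aU := agree_onU (measurableU _ _ mupper mlower) mequator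
  (agree_onU mupper mlower a1 a2) a3.
apply: (agree_on_cover aU) => xi; rewrite /upper /lower /equator/=.
by case: (ltgtP (Z xi) 0) => ?; [left; right|left; left|right].
Qed.

End Even.

(** * Vertical slices *)

Section VerticalSlices.
Context (R : realType) (p : R).
Hypothesis p1 : 1 <= p.
Implicit Types (mu nu : probability (sphere R) R).

Lemma measurable_to_interval d (T : measurableType d) (f : T -> intervalI R) :
  measurable_fun setT (fun x => val (f x)) -> measurable_fun setT f.
Proof.
move=> mf; apply: (@measurability _ _ T (intervalI R) setT f (@open (intervalI R))) => //.
move=> _ [U [V oV <-] <-]; rewrite setTI.
by have := measurable_preimage mf (open_measurable oV).
Qed.

Lemma measurable_slice (psi : circle R) : measurable_fun setT (slice psi).
Proof.
apply: measurable_to_interval.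
by apply: measurable_funD; apply: measurable_funM => //; exact: measurable_sphere_coord.
Qed.

Let w mu nu (t : R) : R :=
  fine (slice_wasserstein (@interval_dist R) p (@slice R) mu nu (to_circle t)).

Let wE mu nu t : slice_wasserstein (@interval_dist R) p (@slice R) mu nu (to_circle t)
  = (w mu nu t)%:E.
Proof.
rewrite /w fineK//.
exact: (slice_wasserstein_fin_num (interval_coord_metric R) p1 measurable_slice).
Qed.

Let slice_dist s t (xi : sphere R) :
  interval_dist (slice (to_circle s) xi) (slice (to_circle t) xi) <= 2 * `|s - t|.
Proof.
rewrite /interval_dist /slice/=.
rewrite -/(circle_cos (to_circle s)) -/(circle_sin (to_circle s)).
rewrite -/(circle_cos (to_circle t)) -/(circle_sin (to_circle t)).
rewrite !circle_cosE !circle_sinE opprD addrACA -!mulrBr.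
have h := sphere_sqr xi.
have a1 : `|val xi 0 0| <= 1.
  by rewrite -(@expr_le1 _ 2)// real_normK ?num_real// -h -addrA lerDl addr_ge0 ?sqr_ge0.
have b1 : `|val xi 1 0| <= 1.
  by rewrite -(@expr_le1 _ 2)// real_normK ?num_real// -h addrAC lerDr addr_ge0 ?sqr_ge0.
rewrite (le_trans (ler_normD _ _))// mulr_natl mulr2n !normrM.
have c := cos_lipschitz s t; have e := sin_lipschitz s t.
by rewrite lerD// -[leRHS]mul1r ler_pM.
Qed.

(** The slices of each of the two measures move by at most [2 * |s - t|]. *)
Let w_lipschitz mu nu s t : `|w mu nu s - w mu nu t| <= 4 * `|s - t|.
Proof.
have H s' t' : w mu nu s' <= w mu nu t' + 4 * `|s' - t'|.
  have := wasserstein_perturb (interval_coord_metric R) p1 mu nu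
    (measurable_slice (to_circle s')) (measurable_slice (to_circle t')).
  have L (m : probability (sphere R) R) : (Lp p m (fun xi => interval_dist
      (slice (to_circle s') xi) (slice (to_circle t') xi)) <= (2 * `|s' - t'|)%:E)%E.
    apply: (@Lp_le_cst _ _ _ _ p1 _ _ _ set0) => //.
    - have := measurableT_comp (@measurable_interval_dist R)
        (measurable_fun_pair (measurable_slice (to_circle s')) (measurable_slice (to_circle t'))).
      exact.
    - by move=> xi; exact: normr_ge0.
  move=> /le_trans /(_ (leeD (lexx _) (leeD (L mu) (L nu)))).
  rewrite -/(slice_wasserstein (@interval_dist R) p (@slice R) mu nu (to_circle s')).
  rewrite -/(slice_wasserstein (@interval_dist R) p (@slice R) mu nu (to_circle t')).
  rewrite !wE -!EFinD lee_fin => h; apply: le_trans h _.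
  by rewrite lerD2l -mulrDl -natrD.
have h1 := H s t; have := H t s; rewrite (distrC t) => h2.
by rewrite ler_norml; apply/andP; split; lra.
Qed.

Let continuous_w mu nu : continuous (w mu nu).
Proof.
move=> t; apply/cvgrPdist_le => e e0; near=> s.
rewrite (le_trans (w_lipschitz _ _ _ _))// -ler_pdivlMl//.
near: s; apply: cvgr_dist_le; last by rewrite mulr_gt0// invr_gt0.
exact: cvg_id.
Unshelve. all: by end_near.
Qed.

Let circle_measure_fin : (@circle_measure R setT < +oo)%E.
Proof.
rewrite /circle_measure /pushforward preimage_setT /mrestr setTI.
by rewrite lebesgue_measure_itv/= ifT ?lte_fin ?mulr_gt0 ?pi_gt0// -EFinB ltry.
Qed.

(** If the integrand were positive at some angle, it would be positive on an
    interval to the right of the representative [c] of that angle in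
    [[0, 2 pi[], and this interval has positive measure. *)
Let w0_of_ae mu nu (N : set (circle R)) : measurable N -> @circle_measure R N = 0%E ->
  (forall z, ~ N z -> slice_wasserstein (@interval_dist R) p (@slice R) mu nu z = 0%E) ->
  forall t, w mu nu t = 0.
Proof.
move=> mN N0 WN t.
pose c := circle_coord (to_circle t).
have -> : w mu nu t = w mu nu c by rewrite /w /c to_circle_coord.
have /andP[c0 c2] := circle_coord_itv (to_circle t).
apply: contrapT => /eqP wc.
have wc0 : 0 < w mu nu c.
  by rewrite lt0r wc fine_ge0// slice_wasserstein_ge0.
pose e := Num.min (w mu nu c / 4) (2 * pi - c).
have e0 : 0 < e by rewrite lt_min divr_gt0//= subr_gt0.
have ew : e <= w mu nu c / 4 by rewrite ge_min lexx.
have e2 : e <= 2 * pi - c by rewrite ge_min lexx orbT.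
have sub : `]c, (c + e)%R[%classic `<=` @to_circle R @^-1` N `&` `[0, 2 * pi[%classic.
  move=> s /=; rewrite !in_itv/= => /andP[cs se]; split; last first.
    rewrite (le_trans c0 (ltW cs)) (lt_le_trans se)//.
    by rewrite addrC -lerBrDr.
  apply: contrapT => /WN; rewrite wE => -[ws].
  have := w_lipschitz mu nu c s; rewrite ws subr0 gtr0_norm//.
  rewrite distrC gtr0_norm ?subr_gt0// leNgt => /negP; apply.
  rewrite mulrC -ltr_pdivlMr// ltrBlDl (lt_le_trans se)// lerD2l//.
have : (lebesgue_measure `]c, (c + e)%R[%classic <= circle_measure N)%E.
  rewrite /circle_measure /pushforward /mrestr; apply: le_measure => //; rewrite inE.
    exact: measurable_itv.
  apply: measurableI => //; apply: measurable_preimage => //.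
  exact: measurable_to_circle.
rewrite N0 lebesgue_measure_itv/= lte_fin ltrDl e0 -EFinB lee_fin.
by rewrite addrAC subrr add0r leNgt e0.
Qed.

(** A vertical slice at angle [phi] is the linear form with coefficients
    [(cos phi, sin phi)], and every linear form in two variables is a multiple of
    one of these. *)
Theorem VSW_metric : is_metric_on (@even_probability R) (VSW p).
Proof.
apply: (sliced_wasserstein_metric (interval_coord_metric R) p1 circle_measure_fin measurable_slice).
- move=> mu nu _ _; rewrite (_ : slice_wasserstein _ _ _ _ _ =
    EFin \o (fun z => fine (slice_wasserstein (@interval_dist R) p (@slice R) mu nu z))).
    apply/measurable_EFinP; apply: measurable_circle_continuous; exact: continuous_w.
  apply/funext => z /=; rewrite fineK//.
  exact: (slice_wasserstein_fin_num (interval_coord_metric R) p1 measurable_slice).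
- move=> mu nu N emu enu mN N0 WN.
  have w0 := w0_of_ae mN N0 WN.
  have key (f : R -> R) : measurable_fun setT f -> (forall x y, `|f x - f y| <= `|x - y|) ->
    forall u v, \int[mu]_xi f (u * val xi 0 0 + v * val xi 1 0) =
                \int[nu]_xi f (u * val xi 0 0 + v * val xi 1 0).
    move=> mf fL u v; have [t [phi [-> ->]]] := polar_coordinates u v.
    have W0 : wasserstein (@interval_dist R) p (pushforward mu (slice (to_circle phi)))
        (pushforward nu (slice (to_circle phi))) = 0%E.
      by have := wE mu nu phi; rewrite w0.
    have mh : measurable_fun setT (fun x : intervalI R => f (t * val x)).
      apply: measurableT_comp => //; apply: measurable_funM => //.
      exact: measurable_interval_val.
    have hL (x y : intervalI R) : `|f (t * val x) - f (t * val y)| <= `|t| * interval_dist x y.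
      by rewrite (le_trans (fL _ _))// -mulrBr normrM.
    have := wasserstein0_same_integral (interval_coord_metric R) p1
      (measurable_slice (to_circle phi)) W0 mh hL.
    have E xi : t * val (slice (to_circle phi) xi) =
        t * cos phi * val xi 0 0 + t * sin phi * val xi 1 0.
      rewrite /= -/(circle_cos (to_circle phi)) -/(circle_sin (to_circle phi)).
      by rewrite circle_cosE circle_sinE; ring.
    under eq_Rintegral do rewrite E.
    by under [in X in _ = X]eq_Rintegral do rewrite E.
  apply: even_measure_eq => // u v; apply: key.
  - by apply: continuous_measurable_fun; exact: continuous_cos.
  - exact: cos_lipschitz.
  - by apply: continuous_measurable_fun; exact: continuous_sin.
  - exact: sin_lipschitz.
Qed.

End VerticalSlices.

(** * Azimuths *)

Section CirclePoints.
Context (R : realType).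
Implicit Types (x y : circle R).

Lemma circle_cos2Dsin2 x : circle_cos x ^+ 2 + circle_sin x ^+ 2 = 1.
Proof. exact: cos2Dsin2. Qed.

Lemma circle_dist_lt x y (e : R) : 0 <= e <= pi -> cos e < cos (circle_dist x y) ->
  circle_dist x y < e.
Proof.
by move=> epi; rewrite ltr_cos// in_itv/= ?epi// circle_dist_ge0 circle_dist_lepi.
Qed.

Lemma circle_eq_cos_sin x y : circle_cos x = circle_cos y ->
  circle_sin x = circle_sin y -> x = y.
Proof.
move=> hc hs; have d0 : circle_dist x y = 0.
  apply: (@cos_inj R); rewrite ?in_itv/= ?circle_dist_ge0 ?circle_dist_lepi ?lexx ?pi_ge0//.
  by rewrite cos_circle_dist hc hs -!expr2 circle_cos2Dsin2 cos0.
have [k] := circle_dist_attained x y; rewrite d0 => /esym/normr0_eq0 h _.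
rewrite -(to_circle_repr x) -(to_circle_repr y); apply/to_circleP.
exists (- k); rewrite mulrNz mulrN; apply/eqP; rewrite -subr_eq0 opprK; exact/eqP.
Qed.

Lemma measurable_circle_of_cos_sin d (T : measurableType d) (f : T -> circle R) :
  measurable_fun setT (fun t => circle_cos (f t)) ->
  measurable_fun setT (fun t => circle_sin (f t)) -> measurable_fun setT f.
Proof.
move=> mc ms.
have c1 x : -1 <= circle_cos x <= 1 by rewrite -ler_norml cos_max.
have ma : measurable_fun setT (fun t => acos (circle_cos (f t))).
  apply: measurable_of_cos => [t|]; first by rewrite acos_ge0 ?acos_lepi.
  by under eq_fun do rewrite acosK ?in_itv//=.
pose g t := if 0 <= circle_sin (f t) then acos (circle_cos (f t))
            else - acos (circle_cos (f t)).
have mg : measurable_fun setT g.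
  apply: measurable_fun_ifT => //.
    by apply: measurable_fun_ler.
  exact: measurableT_comp.
rewrite (_ : f = @to_circle R \o g).
  exact: (measurableT_comp (@measurable_to_circle R) mg).
apply/funext => t; apply: circle_eq_cos_sin.
  rewrite /= circle_cosE /g; case: ifPn => _; rewrite ?cosN acosK ?in_itv//=.
have s2 : 1 - circle_cos (f t) ^+ 2 = circle_sin (f t) ^+ 2.
  by rewrite -(circle_cos2Dsin2 (f t)) addrC addKr.
rewrite /= circle_sinE /g; case: ifPn => h; rewrite ?sinN sin_acos// s2 sqrtr_sqr.
  by rewrite ger0_norm.
by rewrite ltr0_norm ?opprK// ltNge.
Qed.

End CirclePoints.

Section Azimuth.
Context (R : realType).

Lemma azi_pole (v : 'cV[R]_3) : v 0 0 ^+ 2 + v 1 0 ^+ 2 = 0 -> azi v = to_circle 0.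
Proof.
move=> v0; rewrite /azi; case: xgetP => // x _ [phi [theta [th vE _]]].
move: v0; rewrite vE !mxE/= !exprMn -mulrDl cos2Dsin2 mul1r => /eqP.
by rewrite sqrf_eq0 gt_eqF// sin_gt0_pi.
Qed.

Lemma azi_spec (v : 'cV[R]_3) : unit_sphere v ->
  v 0 0 ^+ 2 + v 1 0 ^+ 2 != 0 ->
  circle_cos (azi v) = v 0 0 / Num.sqrt (v 0 0 ^+ 2 + v 1 0 ^+ 2) /\
  circle_sin (azi v) = v 1 0 / Num.sqrt (v 0 0 ^+ 2 + v 1 0 ^+ 2).
Proof.
move=> vS v0; set r := Num.sqrt _.
have r2 : r ^+ 2 = v 0 0 ^+ 2 + v 1 0 ^+ 2 by rewrite sqr_sqrtr// addr_ge0 ?sqr_ge0.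
have r0 : 0 < r by rewrite sqrtr_gt0 lt0r v0 addr_ge0 ?sqr_ge0.
have z1 : -1 < v 2 0 < 1.
  rewrite -ltr_norml -(@expr_lt1 _ 2)// real_normK ?num_real//.
  by move: vS; rewrite /unit_sphere/= -r2 => <-; rewrite ltrDr exprn_gt0.
have z1' : -1 <= v 2 0 <= 1 by have /andP[/ltW -> /ltW ->] := z1.
have [phi [c s]] : exists phi, v 0 0 / r = cos phi /\ v 1 0 / r = sin phi.
  by apply: polar_unit; rewrite !expr_div_n -mulrDl -r2 divff// sqrf_eq0 gt_eqF.
have thpi : 0 < acos (v 2 0) < pi.
  have /andP[a b] := z1.
  by rewrite acos_gt0 ?acos_ltpi ?(ltW a) ?(ltW b) ?a ?b.
have rE : sin (acos (v 2 0)) = r.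
  rewrite sin_acos// /r; congr Num.sqrt; move: vS; rewrite /unit_sphere/= => <-.
  by rewrite addrK.
have vE : v = Phi phi (acos (v 2 0)).
  apply: cV3_eq; rewrite /Phi !mxE/=.
  - by rewrite rE -c divfK// gt_eqF.
  - by rewrite rE -s divfK// gt_eqF.
  - by rewrite acosK// in_itv.
rewrite /azi; case: xgetP => [x _ [phi' [theta' [th' vE' ->]]]|/(_ (to_circle phi))]; last first.
  by case; exists phi, (acos (v 2 0)).
rewrite circle_cosE circle_sinE.
have s' : 0 < sin theta' by rewrite sin_gt0_pi.
have rE' : r = sin theta'.
  rewrite /r {1 2}vE' /Phi !mxE/= !exprMn -mulrDl cos2Dsin2 mul1r sqrtr_sqr.
  by rewrite gtr0_norm.
by rewrite rE' {1 2}vE' /Phi !mxE/= !mulfK ?gt_eqF.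
Qed.

(** At a pole the quotient has denominator 0, hence value 0, while the azimuth is by
    convention 0 and has cosine 1: the last term makes up for it. *)
Lemma azi_cosE (v : 'cV[R]_3) : unit_sphere v ->
  circle_cos (azi v) = v 0 0 / Num.sqrt (v 0 0 ^+ 2 + v 1 0 ^+ 2) +
    (v 0 0 ^+ 2 + v 1 0 ^+ 2 == 0)%:R.
Proof.
move=> vS; have [v0|v0] := eqVneq (v 0 0 ^+ 2 + v 1 0 ^+ 2) 0.
  by rewrite azi_pole// circle_cosE cos0 v0 sqrtr0 invr0 mulr0 add0r.
by have [-> _] := azi_spec vS v0; rewrite addr0.
Qed.

Lemma azi_sinE (v : 'cV[R]_3) : unit_sphere v ->
  circle_sin (azi v) = v 1 0 / Num.sqrt (v 0 0 ^+ 2 + v 1 0 ^+ 2).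
Proof.
move=> vS; have [v0|v0] := eqVneq (v 0 0 ^+ 2 + v 1 0 ^+ 2) 0.
  by rewrite azi_pole// circle_sinE sin0 v0 sqrtr0 invr0 mulr0.
by have [_ ->] := azi_spec vS v0.
Qed.

Definition dot (u v : 'cV[R]_3) : R :=
  u 0 0 * v 0 0 + u 1 0 * v 1 0 + u 2 0 * v 2 0.

(** The first two columns of [Psi a b 0]; the third one is [Phi a b]. *)
Definition frame0 (a b : R) : 'cV[R]_3 := vec3 (cos a * cos b) (sin a * cos b) (- sin b).
Definition frame1 (a b : R) : 'cV[R]_3 := vec3 (- sin a) (cos a) 0.

Lemma sum3 (F : 'I_3 -> R) : \sum_(i < 3) F i = F 0 + F 1 + F 2.
Proof.
rewrite !big_ord_recl big_ord0 addr0 addrA.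
by congr (F _ + F _ + F _); apply: val_inj.
Qed.

Lemma Psi_mul (a b : R) (v : 'cV[R]_3) : (Psi a b 0)^T *m v =
  vec3 (dot (frame0 a b) v) (dot (frame1 a b) v) (dot (Phi a b) v).
Proof.
have PsiE i j : Psi a b 0 i j = (nth [::] [:: [:: cos a * cos b; - sin a; cos a * sin b];
    [:: sin a * cos b; cos a; sin a * sin b]; [:: - sin b; 0; cos b]] i)`_j.
  rewrite /Psi mxE sum3 !mxE !sum3 !mxE /= cos0 sin0.
  case: i => -[|[|[|//]]] hi; case: j => -[|[|[|//]]] hj; rewrite /=; ring.
apply: cV3_eq; rewrite mxE sum3 ![(Psi a b 0)^T _ _]mxE !PsiE /dot /frame0 /frame1 /Phi
  /vec3 !mxE /=; ring.
Qed.

Lemma semicircleE (a b : R) (xi : sphere R) :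
  semicircle a b xi = azi (vec3 (dot (frame0 a b) (val xi))
    (dot (frame1 a b) (val xi)) (dot (Phi a b) (val xi))).
Proof. by rewrite /semicircle Psi_mul. Qed.

(** [Psi a b 0] is an isometry. *)
Lemma frame_unit (a b : R) (v : 'cV[R]_3) :
  dot (frame0 a b) v ^+ 2 + dot (frame1 a b) v ^+ 2 + dot (Phi a b) v ^+ 2 =
  v 0 0 ^+ 2 + v 1 0 ^+ 2 + v 2 0 ^+ 2.
Proof.
have ha := cos2Dsin2 a; have hb := cos2Dsin2 b.
rewrite /dot /frame0 /frame1 /Phi !mxE /=.
move: (cos a) (sin a) (cos b) (sin b) (v 0 0) (v 1 0) (v 2 0) ha hb => c s C S x y z ha hb.
transitivity ((c ^+ 2 * x ^+ 2 + s ^+ 2 * y ^+ 2 + 2 * c * s * x * y) * (C ^+ 2 + S ^+ 2)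
  + (S ^+ 2 + C ^+ 2) * z ^+ 2 + (s ^+ 2 * x ^+ 2 + c ^+ 2 * y ^+ 2 - 2 * c * s * x * y)).
  by ring.
rewrite [S ^+ 2 + _]addrC hb.
transitivity ((c ^+ 2 + s ^+ 2) * (x ^+ 2 + y ^+ 2) + z ^+ 2); first by ring.
by rewrite ha mul1r.
Qed.

Lemma frame_unit_sphere (a b : R) (xi : sphere R) :
  unit_sphere (vec3 (dot (frame0 a b) (val xi))
    (dot (frame1 a b) (val xi)) (dot (Phi a b) (val xi))).
Proof.
by rewrite /unit_sphere/= !mxE/= frame_unit sphere_sqr.
Qed.

Lemma measurable_dot (u : 'cV[R]_3) :
  measurable_fun setT (fun xi : sphere R => dot u (val xi)).
Proof.
by apply: measurable_funD; [apply: measurable_funD|]; apply: measurable_funM => //;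
  exact: measurable_sphere_coord.
Qed.

Lemma frame_radius (a b : R) (xi : sphere R) :
  dot (frame0 a b) (val xi) ^+ 2 + dot (frame1 a b) (val xi) ^+ 2 =
  1 - dot (Phi a b) (val xi) ^+ 2.
Proof. by rewrite -(sphere_sqr xi) -(frame_unit a b (val xi)) addrK. Qed.

Lemma semicircle_cosE (a b : R) (xi : sphere R) :
  circle_cos (semicircle a b xi) =
  dot (frame0 a b) (val xi) / Num.sqrt (1 - dot (Phi a b) (val xi) ^+ 2) +
  (1 - dot (Phi a b) (val xi) ^+ 2 == 0)%:R.
Proof.
rewrite semicircleE azi_cosE; last exact: frame_unit_sphere.
by rewrite !mxE/= frame_radius.
Qed.

Lemma semicircle_sinE (a b : R) (xi : sphere R) :
  circle_sin (semicircle a b xi) =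
  dot (frame1 a b) (val xi) / Num.sqrt (1 - dot (Phi a b) (val xi) ^+ 2).
Proof.
rewrite semicircleE azi_sinE; last exact: frame_unit_sphere.
by rewrite !mxE/= frame_radius.
Qed.

Lemma measurable_sqrt_inv d (T : measurableType d) (f : T -> R) :
  measurable_fun setT f -> measurable_fun setT (fun t => (Num.sqrt (f t))^-1).
Proof.
move=> mf; rewrite (_ : (fun _ => _) = fun t => Num.sqrt (f t) `^ (-1)).
  apply: (@measurableT_comp _ _ _ _ _ _ (@powR R ^~ (-1))) => //.
  apply: measurableT_comp => //; apply: continuous_measurable_fun.
  exact: sqrt_continuous.
by apply/funext => t; rewrite powR_inv1// sqrtr_ge0.
Qed.

Lemma measurable_semicircle (a b : R) : measurable_fun setT (@semicircle R a b).
Proof.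
have mr : measurable_fun setT (fun xi : sphere R => 1 - dot (Phi a b) (val xi) ^+ 2).
  by apply: measurable_funB => //; apply: measurable_funX; exact: measurable_dot.
apply: measurable_circle_of_cos_sin.
  rewrite (_ : (fun _ => _) = fun xi : sphere R => dot (frame0 a b) (val xi) *
    (Num.sqrt (1 - dot (Phi a b) (val xi) ^+ 2))^-1 +
    (if 1 - dot (Phi a b) (val xi) ^+ 2 == 0 then 1 else 0)).
    apply: measurable_funD.
      by apply: measurable_funM; [exact: measurable_dot|exact: measurable_sqrt_inv].
    apply: measurable_fun_ifT => //.
    by apply: measurable_fun_eqr.
  by apply/funext => xi; rewrite semicircle_cosE; case: (_ == _).
rewrite (_ : (fun _ => _) = fun xi : sphere R => dot (frame1 a b) (val xi) *
    (Num.sqrt (1 - dot (Phi a b) (val xi) ^+ 2))^-1).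
  by apply: measurable_funM; [exact: measurable_dot|exact: measurable_sqrt_inv].
by apply/funext => xi; rewrite semicircle_sinE.
Qed.

End Azimuth.

Lemma fine_dist_le (R : realType) (x y : \bar R) (a b : R) :
  x \is a fin_num -> y \is a fin_num ->
  (x <= y + (a%:E + b%:E))%E -> (y <= x + (a%:E + b%:E))%E ->
  `|fine x - fine y| <= a + b.
Proof.
case: x y => [x| |] [y| |]//= _ _; rewrite -!EFinD !lee_fin => xy yx.
by rewrite ler_norml lerBrDl lerBlDl; apply/andP; split; lra.
Qed.

(** * Dependence of the azimuth on the axis *)

Section SphereAxes.
Context (R : realType).
Implicit Types (xi zeta : sphere R) (mu nu : probability (sphere R) R).

Definition axis_slice (zeta : sphere R) : sphere R -> circle R :=
  semicircle (repr (azi (val zeta))) (polar (val zeta)).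

Definition pole zeta := val zeta 0 0 ^+ 2 + val zeta 1 0 ^+ 2 = 0.

Let rho zeta := Num.sqrt (val zeta 0 0 ^+ 2 + val zeta 1 0 ^+ 2).

Let rho_gt0 zeta : ~ pole zeta -> 0 < rho zeta.
Proof. by move=> /eqP np; rewrite sqrtr_gt0 lt0r np addr_ge0 ?sqr_ge0. Qed.

Let angles_val zeta : ~ pole zeta ->
  [/\ cos (repr (azi (val zeta))) = val zeta 0 0 / rho zeta,
      sin (repr (azi (val zeta))) = val zeta 1 0 / rho zeta,
      cos (polar (val zeta)) = val zeta 2 0 & sin (polar (val zeta)) = rho zeta].
Proof.
move=> np; have vS := set_mem (valP zeta).
have [|c s] := azi_spec vS; first exact/eqP.
have h := sphere_sqr zeta.
have z1 : -1 <= val zeta 2 0 <= 1.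
  rewrite -ler_norml -(@expr_le1 _ 2)// real_normK ?num_real//.
  by rewrite -h lerDr addr_ge0 ?sqr_ge0.
split => //; first by rewrite /polar acosK// in_itv.
by rewrite /polar sin_acos// /rho -h addrK.
Qed.

Lemma Phi_axis zeta : ~ pole zeta ->
  Phi (repr (azi (val zeta))) (polar (val zeta)) = val zeta.
Proof.
move=> np; have [c s C S] := angles_val np; have r0 := rho_gt0 np.
by apply: cV3_eq; rewrite /Phi !mxE/= ?c ?s ?C ?S ?divfK ?gt_eqF.
Qed.

Definition converges_to (z_ : nat -> sphere R) zeta :=
  forall i, (fun n => val (z_ n) i 0) @ \oo --> val zeta i 0.

Section Convergence.
Context (z_ : nat -> sphere R) (zeta : sphere R).
Hypothesis z_np : forall n, ~ pole (z_ n).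
Hypothesis np : ~ pole zeta.
Hypothesis zz : converges_to z_ zeta.

Let cvg_sqr (u : nat -> R) (l : R) : u @ \oo --> l -> (fun n => u n ^+ 2) @ \oo --> l ^+ 2.
Proof. by move=> ul; under eq_fun do rewrite expr2; rewrite expr2; apply: cvgM. Qed.

Let cvg_sqrt (u : nat -> R) (l : R) : u @ \oo --> l ->
  (fun n => Num.sqrt (u n)) @ \oo --> Num.sqrt l.
Proof. by move=> ul; exact: (cvg_comp _ _ ul (@sqrt_continuous R l)). Qed.

Let rho_cvg : (fun n => rho (z_ n)) @ \oo --> rho zeta.
Proof.
by apply: cvg_sqrt; apply: cvgD; apply: cvg_sqr; exact: zz.
Qed.

Let rhoV_cvg : (fun n => (rho (z_ n))^-1) @ \oo --> (rho zeta)^-1.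
Proof. by apply: cvgV => //; rewrite gt_eqF ?rho_gt0. Qed.

Let zi i : (fun n => val (z_ n) i 0) @ \oo --> val zeta i 0.
Proof. exact: zz. Qed.

Let cos_cvg : (fun n => val (z_ n) 0 0 / rho (z_ n)) @ \oo --> val zeta 0 0 / rho zeta.
Proof. by apply: cvgM => //; exact: zi. Qed.

Let sin_cvg : (fun n => val (z_ n) 1 0 / rho (z_ n)) @ \oo --> val zeta 1 0 / rho zeta.
Proof. by apply: cvgM => //; exact: zi. Qed.

Let frame0_cvg xi :
  (fun n => dot (frame0 (repr (azi (val (z_ n)))) (polar (val (z_ n)))) (val xi)) @ \oo -->
  dot (frame0 (repr (azi (val zeta))) (polar (val zeta))) (val xi).
Proof.
rewrite /dot /frame0 !mxE/=; have [-> -> -> ->] := angles_val np.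
under eq_fun => n.
  rewrite !mxE/=; have [-> -> -> ->] := angles_val (@z_np n); over.
apply: cvgD; last by apply: cvgMl; apply: cvgN; exact: rho_cvg.
by apply: cvgD; apply: cvgMl; apply: cvgM; [exact: cos_cvg|exact: zi|exact: sin_cvg|exact: zi].
Qed.

Let frame1_cvg xi :
  (fun n => dot (frame1 (repr (azi (val (z_ n)))) (polar (val (z_ n)))) (val xi)) @ \oo -->
  dot (frame1 (repr (azi (val zeta))) (polar (val zeta))) (val xi).
Proof.
rewrite /dot /frame1 !mxE/=; have [-> -> _ _] := angles_val np.
under eq_fun => n.
  rewrite !mxE/=; have [-> -> _ _] := angles_val (@z_np n); over.
apply: cvgD; last exact: cvg_cst.
by apply: cvgD; apply: cvgMl; [apply: cvgN; exact: sin_cvg|exact: cos_cvg].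
Qed.

Let radius_cvg xi :
  (fun n => 1 - dot (Phi (repr (azi (val (z_ n)))) (polar (val (z_ n)))) (val xi) ^+ 2) @ \oo -->
  1 - dot (Phi (repr (azi (val zeta))) (polar (val zeta))) (val xi) ^+ 2.
Proof.
rewrite Phi_axis//; under eq_fun => n do rewrite (Phi_axis (@z_np n)).
apply: cvgB; first exact: cvg_cst.
by apply: cvg_sqr; rewrite /dot; do ! apply: cvgD; apply: cvgMl; exact: zi.
Qed.

(** Away from [zeta] and [- zeta] the cosine and the sine of the azimuth are
    quotients with a nonzero limit of the denominators. *)
Lemma axis_slice_cvg xi : dot (val zeta) (val xi) ^+ 2 != 1 ->
  (fun n => circle_dist (axis_slice (z_ n) xi) (axis_slice zeta xi)) @ \oo --> (0 : R).
Proof.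
move=> xi1.
have r_gt0 : 0 < 1 - dot (val zeta) (val xi) ^+ 2.
  have := frame_radius (repr (azi (val zeta))) (polar (val zeta)) xi.
  rewrite Phi_axis// => <-; rewrite lt0r addr_ge0 ?sqr_ge0// andbT.
  by rewrite frame_radius Phi_axis// subr_eq0 eq_sym.
have rc := @radius_cvg xi; rewrite Phi_axis// in rc.
have sV : (fun n => (Num.sqrt (1 - dot (Phi (repr (azi (val (z_ n)))) (polar (val (z_ n))))
    (val xi) ^+ 2))^-1) @ \oo --> (Num.sqrt (1 - dot (val zeta) (val xi) ^+ 2))^-1.
  apply: cvgV; first by rewrite gt_eqF// sqrtr_gt0.
  exact: cvg_sqrt.
have cc : (fun n => circle_cos (axis_slice (z_ n) xi)) @ \oo -->
    circle_cos (axis_slice zeta xi).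
  rewrite /axis_slice semicircle_cosE Phi_axis// gt_eqF// addr0.
  apply: cvg_trans (cvgM (@frame0_cvg xi) sV); apply: near_eq_cvg.
  near=> n; rewrite semicircle_cosE gt_eqF ?addr0//.
  by near: n; apply: (cvgr_gt _ rc); exact: r_gt0.
have cs : (fun n => circle_sin (axis_slice (z_ n) xi)) @ \oo -->
    circle_sin (axis_slice zeta xi).
  rewrite /axis_slice semicircle_sinE Phi_axis//.
  under eq_fun do rewrite semicircle_sinE.
  exact: cvgM (@frame1_cvg xi) sV.
have cd : (fun n => cos (circle_dist (axis_slice (z_ n) xi) (axis_slice zeta xi)))
    @ \oo --> (1 : R).
  rewrite -(circle_cos2Dsin2 (axis_slice zeta xi)) !expr2.
  under eq_fun do rewrite cos_circle_dist.
  by apply: cvgD; apply: cvgMl.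
apply/cvgrPdist_lt => e e0; pose e' := Num.min e pi.
have e'0 : 0 < e' by rewrite lt_min e0 pi_gt0.
have e'pi : 0 <= e' <= pi by rewrite ltW//= ge_min lexx orbT.
have ce : cos e' < 1.
  by rewrite -[ltRHS]cos0 ltr_cos// in_itv/= ?lexx ?pi_ge0.
near=> n; rewrite sub0r normrN ger0_norm ?circle_dist_ge0//.
have : circle_dist (axis_slice (z_ n) xi) (axis_slice zeta xi) < e'.
  apply: circle_dist_lt => //; near: n; apply: (cvgr_gt _ cd); exact: ce.
by move/lt_le_trans; apply; rewrite ge_min lexx.
Unshelve. all: by end_near.
Qed.

Context (p : R).
Hypothesis p1 : 1 <= p.

Let p0 : 0 < p. Proof. exact: lt_le_trans p1. Qed.

Let measurable_pole_set : measurable [set xi : sphere R | dot (val zeta) (val xi) ^+ 2 = 1].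
Proof.
have m : measurable_fun setT (fun xi : sphere R => dot (val zeta) (val xi) ^+ 2).
  by apply: measurable_funX; exact: measurable_dot.
exact: (measurable_preimage m (measurable_set1 1)).
Qed.

Let measurable_axis_dist z z' :
  measurable_fun setT (fun xi => circle_dist (axis_slice z xi) (axis_slice z' xi)).
Proof.
have := measurableT_comp (@measurable_circle_dist R) (measurable_fun_pair
  (@measurable_semicircle R (repr (azi (val z))) (polar (val z)))
  (@measurable_semicircle R (repr (azi (val z'))) (polar (val z')))).
exact.
Qed.

(** Dominated convergence: pointwise convergence fails only at [zeta] and [- zeta],
    which form a null set by hypothesis. *)
Lemma Lp_axis_slice_cvg mu (e : R) :
  mu [set xi | dot (val zeta) (val xi) ^+ 2 = 1] = 0%E -> 0 < e ->
  \forall n \near \oo, (Lp p mu (fun xi => circle_dist (axis_slice (z_ n) xi)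
    (axis_slice zeta xi)) <= e%:E)%E.
Proof.
move=> mu0 e0.
pose I n := (\int[mu]_xi (circle_dist (axis_slice (z_ n) xi) (axis_slice zeta xi) `^ p)%:E)%E.
have I0 n : (0 <= I n)%E by apply: integral_ge0 => xi _; rewrite lee_fin powR_ge0.
have dB n xi : `|circle_dist (axis_slice (z_ n) xi) (axis_slice zeta xi) `^ p| <= pi `^ p.
  rewrite ger0_norm ?powR_ge0// ge0_ler_powR ?(ltW p0) ?nnegrE ?circle_dist_ge0 ?pi_ge0//.
  exact: circle_dist_lepi.
have md n := measurable_EFin_powR p (measurable_axis_dist (z_ n) zeta).
have [] := @dominated_convergence _ _ R mu setT measurableT
  (fun n xi => (circle_dist (axis_slice (z_ n) xi) (axis_slice zeta xi) `^ p)%:E)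
  (cst 0%E) (EFin \o cst (pi `^ p)).
- exact: md.
- exact: measurable_cst.
- exists [set xi | dot (val zeta) (val xi) ^+ 2 = 1]; split => // xi /= h.
  apply: contrapT => /eqP xi1; apply: h => _; apply: cvg_EFin; first exact: nearW.
  rewrite /comp/=; apply/cvgrPdist_le => t t0.
  have c := axis_slice_cvg xi1.
  have tp0 : 0 < t `^ p^-1 by rewrite powR_gt0.
  near=> n; rewrite sub0r normrN ger0_norm ?powR_ge0//.
  rewrite -[leRHS](powRr1 (ltW t0)) -(mulVf (lt0r_neq0 p0)) powRrM.
  rewrite ge0_ler_powR ?(ltW p0) ?nnegrE ?circle_dist_ge0 ?powR_ge0//.
  near: n; apply: (cvgr_le _ c); exact: tp0.
- by apply: bounded_measurable_integrable; exact: bounded_measurable_cst.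
- by apply: aeW => xi n _ /=; rewrite lee_fin.
move=> _ _; rewrite integral_cst// mul0e => cI.
have : (fun n => fine (I n)) @ \oo --> (0 : R) by apply: fine_cvg; exact: cI.
move=> /(cvgr_le _) /(_ (e `^ p)) h; near=> n.
have Ifin : I n \is a fin_num.
  rewrite ge0_fin_numE//; apply: (@le_lt_trans _ _ (\int[mu]_xi (pi `^ p)%:E)%E).
    apply: ge0_le_integral => //.
    - by move=> xi _; rewrite lee_fin powR_ge0.
    - by move=> xi _; rewrite lee_fin (le_trans (ler_norm _)).
  by rewrite integral_cst//= probability_setT mule1 ltry.
have -> : (e%:E = (e `^ p)%:E `^ p^-1)%E.
  by rewrite poweR_EFin -powRrM mulfV ?gt_eqF// powRr1// ltW.
rewrite /Lp gt0_ler_poweR ?invr_ge0 ?(ltW p0)//.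
- by rewrite in_itv/= leey andbT I0.
- by rewrite in_itv/= leey andbT lee_fin powR_ge0.
- rewrite -/(I n) -(fineK Ifin) lee_fin; near: n; apply: h; exact: powR_gt0.
Unshelve. all: by end_near.
Qed.

Lemma axis_wasserstein_cvg mu nu :
  mu [set xi | dot (val zeta) (val xi) ^+ 2 = 1] = 0%E ->
  nu [set xi | dot (val zeta) (val xi) ^+ 2 = 1] = 0%E ->
  (fun n => fine (slice_wasserstein (@circle_dist R) p axis_slice mu nu (z_ n))) @ \oo -->
  fine (slice_wasserstein (@circle_dist R) p axis_slice mu nu zeta).
Proof.
move=> mu0 nu0.
have mA z : measurable_fun setT (axis_slice z) by exact: measurable_semicircle.
have cm := circle_coord_metric R.
have Wfin z := slice_wasserstein_fin_num cm p1 mA mu nu z.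
apply/cvgrPdist_le => e e0; have e2 : 0 < e / 2 by rewrite divr_gt0.
near=> n.
have L1 : (Lp p mu (fun xi => circle_dist (axis_slice (z_ n) xi) (axis_slice zeta xi))
    <= (e / 2)%:E)%E by near: n; exact: Lp_axis_slice_cvg.
have L2 : (Lp p nu (fun xi => circle_dist (axis_slice (z_ n) xi) (axis_slice zeta xi))
    <= (e / 2)%:E)%E by near: n; exact: Lp_axis_slice_cvg.
have E (m : probability (sphere R) R) :
    Lp p m (fun xi => circle_dist (axis_slice zeta xi) (axis_slice (z_ n) xi)) =
    Lp p m (fun xi => circle_dist (axis_slice (z_ n) xi) (axis_slice zeta xi)).
  by congr Lp; apply/funext => xi; exact: cm_sym cm _ _.
have h1 := wasserstein_perturb cm p1 mu nu (mA (z_ n)) (mA zeta).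
have h2 := wasserstein_perturb cm p1 mu nu (mA zeta) (mA (z_ n)).
rewrite (E mu) (E nu) in h2.
rewrite (splitr e); apply: (fine_dist_le (Wfin zeta) (Wfin (z_ n))).
- exact: (le_trans h2 (leeD (lexx _) (leeD L1 L2))).
- exact: (le_trans h1 (leeD (lexx _) (leeD L1 L2))).
Unshelve. all: by end_near.
Qed.

End Convergence.

End SphereAxes.

(** * Excluded axes *)

Section CountableAxes.
Context (R : realType).
Implicit Types (xi zeta : sphere R) (mu nu : probability (sphere R) R).

Lemma sphere_eq xi zeta : (forall i, val xi i 0 = val zeta i 0) -> xi = zeta.
Proof. by move=> h; apply: val_inj; apply: cV3_eq. Qed.

Definition at_point (v : 'cV[R]_3) : set (sphere R) :=
  [set xi : sphere R | forall i, val xi i 0 = v i 0].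

Lemma measurable_coord_eq (v : 'cV[R]_3) : measurable (at_point v).
Proof.
rewrite (_ : at_point v = \bigcap_(i in [set: 'I_3])
    ((fun xi : sphere R => val xi i 0) @^-1` [set v i 0])).
  apply: fin_bigcap_measurable => // i _.
  exact: measurable_preimage (measurable_sphere_coord i) (measurable_set1 _).
by apply/seteqP; split => [xi h i _|xi h i] /=; [exact: h|exact: h].
Qed.

Lemma measurable_sphere_set1 zeta : measurable [set zeta].
Proof.
rewrite (_ : [set zeta] = at_point (val zeta)).
  exact: measurable_coord_eq.
by apply/seteqP; split => [_ ->//|xi /= /sphere_eq].
Qed.

Lemma countable_setU (T : Type) (A B : set T) :
  countable A -> countable B -> countable (A `|` B).
Proof.
move=> cA cB; rewrite (_ : A `|` B = \bigcup_(b in [set: bool]) (if b then A else B)).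
  by apply: bigcup_countable => // -[].
apply/seteqP; split => [x [Ax|Bx]|x [[] _]]; [by exists true|by exists false|by left|by right].
Qed.

Lemma countable_inj_preimage (T U : Type) (A : set U) (g : T -> U) :
  injective g -> countable A -> countable (g @^-1` A).
Proof.
move=> gi /countable_injP[f fi]; apply/countable_injP; exists (f \o g) => x y.
by rewrite !inE => Ax Ay /fi h; apply: gi; apply: h; rewrite inE.
Qed.

(** An atom of [mu] gives an atom of the law of each coordinate, and a real random
    variable has countably many atoms. *)
Lemma countable_atoms mu (s : R) : s != 0 ->
  countable [set zeta : sphere R |
    mu (at_point (s *: val zeta)) != 0%E].
Proof.
move=> s0.
pose X i : {mfun sphere R >-> R} := HB.pack (fun xi : sphere R => val xi i 0)
  (isMeasurableFun.Build _ _ _ _ _ (measurable_sphere_coord i)).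
pose K i := [set r | 0 < @pmf _ _ _ mu (X i) r].
have cK i : countable (K i) by exact: pmf_gt0_countable.
apply: (@sub_countable _ _ _ ((fun zeta : sphere R => ((s * val zeta 0 0, s * val zeta 1 0),
   s * val zeta 2 0)) @^-1` ((K 0 `*` K 1) `*` K 2))); last first.
  apply: countable_inj_preimage; last by apply: countableX => //; exact: countableX.
  move=> x y [/(mulfI s0) h0 /(mulfI s0) h1 /(mulfI s0) h2].
  by apply: val_inj; exact: cV3_eq.
apply: subset_card_le => zeta /= h.
have Ki i : K i (s * val zeta i 0).
  rewrite /K/= /pmf fine_gt0//; apply/andP; split; last first.
    apply: (le_lt_trans (@probability_le1 _ _ _ mu _ _)); last exact: ltry.
    exact: measurable_preimage (measurable_sphere_coord i) (measurable_set1 _).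
  apply: (@lt_le_trans _ _ (mu (at_point (s *: val zeta)))).
    by rewrite lt0e h measure_ge0.
  apply: le_measure; rewrite ?inE; first exact: measurable_coord_eq.
    exact: measurable_preimage (measurable_sphere_coord i) (measurable_set1 _).
  by move=> xi /(_ i) /=; rewrite mxE.
by split => //; split.
Qed.

Lemma dot_sqr_eq1 zeta xi : dot (val zeta) (val xi) ^+ 2 = 1 ->
  at_point (1 *: val zeta) xi \/ at_point (-1 *: val zeta) xi.
Proof.
move=> /eqP; rewrite sqrf_eq1 => h.
have a := sphere_sqr zeta; have b := sphere_sqr xi.
have key (s : R) : dot (val zeta) (val xi) = s -> s ^+ 2 = 1 ->
    at_point (s *: val zeta) xi.
  move=> ds s2.
  have : (val xi 0 0 - s * val zeta 0 0) ^+ 2 + (val xi 1 0 - s * val zeta 1 0) ^+ 2 +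
      (val xi 2 0 - s * val zeta 2 0) ^+ 2 = 0.
    transitivity ((val xi 0 0 ^+ 2 + val xi 1 0 ^+ 2 + val xi 2 0 ^+ 2) +
      s ^+ 2 * (val zeta 0 0 ^+ 2 + val zeta 1 0 ^+ 2 + val zeta 2 0 ^+ 2) -
      2 * s * dot (val zeta) (val xi)); first by rewrite /dot; ring.
    have ss : s * s = 1 by rewrite -expr2.
    by rewrite a b ds s2 -(mulrA 2) ss; ring.
  move=> /eqP; rewrite paddr_eq0 ?addr_ge0 ?sqr_ge0// paddr_eq0 ?sqr_ge0//.
  rewrite !sqrf_eq0 !subr_eq0 => /andP[/andP[/eqP h0 /eqP h1] /eqP h2] i.
  by rewrite (@cV3_eq R (val xi) (s *: val zeta))// mxE.
by case/orP: h => /eqP h; [left|right]; apply: key; rewrite ?sqrrN ?expr1n.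
Qed.

(** Axes [zeta] such that [zeta] or [- zeta] is an atom of [mu]; these two points are
    the solutions of [dot zeta xi ^ 2 = 1]. *)
Definition bad_axis mu : set (sphere R) :=
  [set zeta | mu [set xi | dot (val zeta) (val xi) ^+ 2 = 1] != 0%E].

Lemma countable_bad_axis mu : countable (bad_axis mu).
Proof.
apply: (@sub_countable _ _ _
  ([set zeta | mu (at_point (1 *: val zeta)) != 0%E] `|`
   [set zeta | mu (at_point (-1 *: val zeta)) != 0%E])); last first.
  by apply: countable_setU; apply: countable_atoms; rewrite ?oppr_eq0 oner_neq0.
apply: subset_card_le => zeta /= h; apply: contrapT => /not_orP[].
move=> /negP; rewrite negbK => /eqP h1 /negP; rewrite negbK => /eqP h2.
move: h => /eqP; apply.
have mU := measurableU _ _ (measurable_coord_eq (1 *: val zeta)) (measurable_coord_eq (-1 *: val zeta)).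
apply: (subset_measure0 _ mU) => //.
- have m : measurable_fun setT (fun xi : sphere R => dot (val zeta) (val xi) ^+ 2).
    by apply: measurable_funX; exact: measurable_dot.
  exact: (measurable_preimage m (measurable_set1 1)).
- by move=> xi /dot_sqr_eq1.
- apply: null_set_setU => //; exact: measurable_coord_eq.
Qed.

Lemma countable_pole : countable (@pole R).
Proof.
apply/countable_injP; exists (fun zeta : sphere R => nat_of_bool (0 < val zeta 2 0)).
have H zeta : pole zeta -> [/\ val zeta 0 0 = 0, val zeta 1 0 = 0 &
    val zeta 2 0 = if 0 < val zeta 2 0 then 1 else -1].
  move=> h; have := sphere_sqr zeta; rewrite h add0r => /eqP; rewrite sqrf_eq1.
  move: h => /eqP; rewrite paddr_eq0 ?sqr_ge0// !sqrf_eq0 => /andP[/eqP-> /eqP->].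
  by case/orP => /eqP ->; rewrite ?ltr01 // oppr_gt0 ltr10.
move=> x y; rewrite !inE => /H[x0 x1 x2] /H[y0 y1 y2] xy.
apply: val_inj; apply: cV3_eq; rewrite ?x0 ?x1 ?y0 ?y1// x2 y2.
by move: xy; case: (0 < val x 2 0); case: (0 < val y 2 0).
Qed.

Definition excluded mu nu : set (sphere R) := @pole R `|` (bad_axis mu `|` bad_axis nu).

Lemma countable_excluded mu nu : countable (excluded mu nu).
Proof.
apply: countable_setU; first exact: countable_pole.
by apply: countable_setU; exact: countable_bad_axis.
Qed.

Lemma measurable_countable_sphere (C : set (sphere R)) : countable C -> measurable C.
Proof. by apply: countable_measurable => z; exact: measurable_sphere_set1. Qed.

Definition coord_ball (e : R) zeta : set (sphere R) :=
  [set z : sphere R | forall i, `|val z i 0 - val zeta i 0| < e].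

Lemma open_coord_ball (e : R) zeta : open (coord_ball e zeta).
Proof.
have O i : open [set z : sphere R | `|val z i 0 - val zeta i 0| < e].
  have cg : continuous (fun x : R => `|x - val zeta i 0|).
    by move=> x; apply: cvg_norm; apply: cvgB; [exact: cvg_id|exact: cvg_cst].
  have /continuousP c := continuous_of_comp (@continuous_sphere_coord R i) cg.
  by have := c _ (@open_lt R e).
rewrite (_ : coord_ball e zeta =
  [set z : sphere R | `|val z 0 0 - val zeta 0 0| < e] `&`
  ([set z : sphere R | `|val z 1 0 - val zeta 1 0| < e] `&`
   [set z : sphere R | `|val z 2 0 - val zeta 2 0| < e])).
  by apply: openI => //; exact: openI.
apply/seteqP; split => [z h|z [h0 [h1 h2]]]; first by split; [|split]; exact: h.
move=> -[[|[|[|//]]] hi].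
- by have -> : Ordinal hi = 0 by exact: val_inj.
- by have -> : Ordinal hi = 1 by exact: val_inj.
- by have -> : Ordinal hi = 2 by exact: val_inj.
Qed.

(** A function that is sequentially continuous relative to the complement of a
    countable set [C] is Borel: off [C] its superlevel sets are relatively open,
    and every subset of [C] is Borel. *)
Section SequentialContinuity.
Context (C : set (sphere R)) (h : sphere R -> R).
Hypothesis cC : countable C.
Hypothesis hC : forall z_ zeta, (forall n, ~ C (z_ n)) -> ~ C zeta ->
  converges_to z_ zeta -> (fun n => h (z_ n)) @ \oo --> h zeta.

Lemma seq_continuous_ball t zeta : ~ C zeta -> t < h zeta ->
  exists2 e : R, 0 < e & forall z, coord_ball e zeta z -> ~ C z -> t < h z.
Proof.
move=> Cz tz; apply: contrapT => H.
have /choice[z_ hz] : forall n, exists z,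
    [/\ coord_ball n.+1%:R^-1 zeta z, ~ C z & h z <= t].
  move=> n; apply: contrapT => H'; apply: H; exists n.+1%:R^-1 => // z bz nCz.
  by rewrite ltNge; apply/negP => hzt; apply: H'; exists z.
have zz : converges_to z_ zeta.
  move=> i; apply: (@cvg_of_le_harmonic _ _ _ 1) => n.
  by have [/(_ i)/ltW + _ _] := hz n; rewrite div1r.
have nC n : ~ C (z_ n) by have [] := hz n.
have : h zeta <= t.
  by apply: (cvgr_to_le (hC nC Cz zz)); apply: nearW => n; have [] := hz n.
by rewrite leNgt tz.
Qed.

Lemma measurable_seq_continuous : measurable_fun setT h.
Proof.
have mC := measurable_countable_sphere cC.
apply: measurable_fun_gt => t.
pose U := \bigcup_(V in [set V : set (sphere R) | open V /\ V `&` ~` C `<=` [set z | t < h z]]) V.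
have oU : open U by apply: bigcup_open => V [].
rewrite (_ : [set _ | _] = (U `&` ~` C) `|` (C `&` [set z | t < h z])).
  apply: measurableU.
    apply: measurableI; last exact: measurableC.
    exact: sub_sigma_algebra.
  apply: measurable_countable_sphere; apply: sub_countable cC.
  by apply: subset_card_le; exact: subIsetl.
apply/seteqP; split => z /=.
  move=> tz; have [Cz|nCz] := pselect (C z); [by right|left; split => //].
  have [e e0 he] := seq_continuous_ball nCz tz.
  exists (coord_ball e z); last by move=> i; rewrite subrr normr0.
  by split; [exact: open_coord_ball|move=> z' [bz' nCz']; exact: he].
by move=> [[[V [_ sV] Vz] nCz]|[_ //]]; exact: sV.
Qed.

End SequentialContinuity.

End CountableAxes.

(** * The surface measure *)

Section SphereMeasure.
Context (R : realType).
Implicit Types (xi zeta : sphere R).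

Local Notation leb2 := (@lebesgue_measure R \x @lebesgue_measure R)%E.

Let measurable_angles_preimage (A : set (sphere R)) : measurable A ->
  measurable (@angles R `&` @Phi_sphere R @^-1` A).
Proof.
move=> mA; apply: measurableI; first exact: measurable_angles.
exact: measurable_preimage (@measurable_Phi_sphere R) mA.
Qed.

Let measurable_sin2 (D : set (R * R)) : measurable D ->
  measurable_fun D (fun z : R * R => (sin z.2)%:E).
Proof.
move=> mD; apply: measurable_funTS; apply/measurable_EFinP.
apply: measurableT_comp => //.
by apply: continuous_measurable_fun => x; exact: continuous_sin.
Qed.

Let tp_gt0 : 0 < 2 * pi :> R. Proof. by rewrite mulr_gt0// pi_gt0. Qed.

Lemma sphere_measure_fin : (@sphere_measure R setT < +oo)%E.
Proof.
have mD := measurable_angles_preimage (@measurableT _ (sphere R)).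
have h1 : (@sphere_measure R setT <=
    \int[leb2]_(z in @angles R `&` @Phi_sphere R @^-1` setT) (cst 1%E z))%E.
  apply: ge0_le_integral => //.
  - by move=> z [/angles_sin_ge0].
  - exact: measurable_sin2.
  - by move=> z _; rewrite lee_fin sin_le1.
have E : leb2 (@angles R) = (lebesgue_measure (`[0%R, (2 * pi)%R[%classic : set R) *
    lebesgue_measure (`[0%R, pi]%classic : set R))%E.
  exact: product_measure1E.
have h2 : (leb2 (@angles R) < +oo)%E.
  rewrite E !lebesgue_measure_itv/= !lte_fin tp_gt0 pi_gt0.
  by rewrite -!EFinB -EFinM ltry.
apply: (le_lt_trans h1); rewrite integral_cst// mul1e preimage_setT setIT.
exact: h2.
Qed.

(** The spherical coordinates of a countable set lie over countably many
    colatitudes, hence in a null set of the rectangle. *)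
Lemma sphere_measure_countable (C : set (sphere R)) : countable C ->
  @sphere_measure R C = 0%E.
Proof.
move=> cC; have mC := measurable_countable_sphere cC.
pose B := (fun zeta : sphere R => acos (val zeta 2 0)) @` C.
have cB : countable B by apply: sub_countable (card_image_le _ _) cC.
have B0 := countable_lebesgue_measure0 cB.
have mB : measurable B by apply: countable_measurable => // r; exact: measurable_set1.
have mD := measurable_angles_preimage mC.
rewrite /sphere_measure; apply: null_set_integral => //; first exact: measurable_sin2.
apply: (@subset_measure0 _ _ _ leb2 _ (setT `*` B)) => //.
- exact: measurableX.
- move=> [a b] [[/= _]]; rewrite in_itv/= => bpi Cz; split => //=.
  exists (Phi_sphere (a, b)) => //; rewrite /= mxE/= cosK// in_itv.
- transitivity (lebesgue_measure [set: R] * lebesgue_measure B)%E.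
    exact: product_measure1E.
  by rewrite B0 mule0.
Qed.

Lemma Phi_lipschitz (a b a' b' : R) i :
  `|Phi a b i 0 - Phi a' b' i 0| <= `|a - a'| + `|b - b'|.
Proof.
have prod (x y x' y' : R) : `|x| <= 1 -> `|y'| <= 1 ->
    `|x - x'| <= `|a - a'| -> `|y - y'| <= `|b - b'| ->
    `|x * y - x' * y'| <= `|a - a'| + `|b - b'|.
  move=> x1 y1 hx hy; have -> : x * y - x' * y' = (x - x') * y' + x * (y - y') by ring.
  rewrite (le_trans (ler_normD _ _))// !normrM lerD//.
    by rewrite -[leRHS]mulr1 ler_pM.
  by rewrite -[leRHS]mul1r ler_pM.
case: i => -[|[|[|//]]] hi; rewrite /Phi !mxE/=.
- by apply: prod; rewrite ?cos_max ?sin_max ?cos_lipschitz ?sin_lipschitz.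
- by apply: prod; rewrite ?cos_max ?sin_max ?cos_lipschitz ?sin_lipschitz.
- by rewrite (le_trans (cos_lipschitz _ _))// lerDr.
Qed.

(** In spherical coordinates the ball contains a small rectangle on which the sine
    is positive.  The rectangle lies to the upper right of the coordinates of
    [zeta], so as to stay within the range [[0, 2 pi[] of longitudes. *)
Lemma sphere_measure_coord_ball zeta (e : R) : ~ pole zeta -> 0 < e ->
  @sphere_measure R (coord_ball e zeta) != 0%E.
Proof.
move=> np e0; pose a := circle_coord (azi (val zeta)); pose b := polar (val zeta).
have /andP[a0 a2] : 0 <= a < 2 * pi by exact: circle_coord_itv.
have h := sphere_sqr zeta.
have z1 : -1 < val zeta 2 0 < 1.
  rewrite -ltr_norml -(@expr_lt1 _ 2)// real_normK ?num_real//.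
  by rewrite -h ltrDr lt0r addr_ge0 ?sqr_ge0// andbT; exact/eqP.
have /andP[b0 bpi] : 0 < b < pi.
  have /andP[u v] := z1.
  by rewrite /b /polar acos_gt0 ?acos_ltpi ?(ltW u) ?(ltW v) ?u ?v.
have PhiE : Phi a b = val zeta.
  rewrite -(Phi_axis np) /a /Phi.
  have := circle_cosE (circle_coord (azi (val zeta))); rewrite to_circle_coord => <-.
  by have := circle_sinE (circle_coord (azi (val zeta))); rewrite to_circle_coord => <-.
pose d := Num.min (e / 2) (Num.min (2 * pi - a) (pi - b)).
have d0 : 0 < d by rewrite !lt_min divr_gt0// !subr_gt0 a2 bpi.
have de : d <= e / 2 by rewrite ge_min lexx.
have da : d <= 2 * pi - a by rewrite !ge_min lexx !orbT.
have db : d <= pi - b by rewrite !ge_min lexx !orbT.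
pose Q := (`]a, (a + d)%R[%classic `*` `]b, (b + d)%R[%classic : set (R * R)).
have mQ : measurable Q by exact: measurableX.
have Qsub : Q `<=` @angles R `&` @Phi_sphere R @^-1` coord_ball e zeta.
  move=> [s t] [/=]; rewrite !in_itv/= => /andP[as_ sa] /andP[bt tb]; split.
    split; rewrite /= in_itv/=.
      by rewrite (le_trans a0 (ltW as_)) (lt_le_trans sa)// -lerBrDl.
    by rewrite (ltW (lt_trans b0 bt)) (le_trans (ltW tb))// -lerBrDl.
  move=> i; rewrite /= -PhiE (le_lt_trans (Phi_lipschitz _ _ _ _ _))//.
  rewrite !gtr0_norm ?subr_gt0// (splitr e) ltrD// (lt_le_trans _ de)//.
    by rewrite ltrBlDl.
  by rewrite ltrBlDl.
have Qsin z : Q z -> 0 < sin z.2.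
  move=> [_]; rewrite /= in_itv/= => /andP[bt tb].
  by rewrite sin_gt0_pi// (lt_trans b0 bt) (lt_le_trans tb)// -lerBrDl.
apply/eqP => S0.
have mball : measurable (coord_ball e zeta).
  by apply: sub_sigma_algebra; exact: open_coord_ball.
have : (\int[leb2]_(z in Q) (sin z.2)%:E <= 0)%E.
  rewrite -S0 /sphere_measure; apply: ge0_subset_integral => //.
  - exact: measurable_angles_preimage.
  - by apply: measurable_sin2; exact: measurable_angles_preimage.
  - by move=> z [/angles_sin_ge0].
move=> I0.
have Iabs : (\int[leb2]_(z in Q) `|(sin z.2)%:E| = 0)%E.
  transitivity (\int[leb2]_(z in Q) (sin z.2)%:E)%E.
    apply: eq_integral => z /set_mem Qz.
    by rewrite gee0_abs// lee_fin ltW// Qsin.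
  apply/eqP; rewrite eq_le I0 andTb; apply: integral_ge0 => z Qz.
  by rewrite lee_fin ltW// Qsin.
have [N [mN N0 QN]] : ae_eq leb2 Q (fun z => (sin z.2)%:E) (cst 0%E).
  by apply/ae_eq_integral_abs => //; exact: measurable_sin2.
have : (leb2 Q <= 0)%E.
  rewrite -N0; apply: le_measure; rewrite ?inE// => z Qz.
  apply: QN => /= /(_ Qz) [s0]; have := Qsin z Qz; by rewrite s0 ltxx.
have -> : leb2 Q = (lebesgue_measure (`]a, (a + d)%R[%classic : set R) *
    lebesgue_measure (`]b, (b + d)%R[%classic : set R))%E.
  exact: product_measure1E.
rewrite !lebesgue_measure_itv/= !lte_fin !ltrDl d0.
rewrite -!EFinB -EFinM lee_fin !(addrAC _ d) !subrr !add0r leNgt.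
by rewrite mulr_gt0.
Qed.

Context (p : R).
Hypothesis p1 : 1 <= p.

Let w (mu nu : probability (sphere R) R) zeta :=
  fine (slice_wasserstein (@circle_dist R) p (@axis_slice R) mu nu zeta).

Let mA zeta : measurable_fun setT (axis_slice zeta).
Proof. exact: measurable_semicircle. Qed.

Let w_seq_continuous mu nu (z_ : nat -> sphere R) zeta :
  (forall n, ~ excluded mu nu (z_ n)) -> ~ excluded mu nu zeta ->
  converges_to z_ zeta -> (fun n => w mu nu (z_ n)) @ \oo --> w mu nu zeta.
Proof.
move=> zC nC zz; apply: axis_wasserstein_cvg => //.
- by move=> n pn; apply: (zC n); left.
- by move=> pn; apply: nC; left.
- by apply: contrapT => /eqP h; apply: nC; right; left.
- by apply: contrapT => /eqP h; apply: nC; right; right.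
Qed.

Lemma measurable_axis_wasserstein (mu nu : probability (sphere R) R) : measurable_fun setT
  (slice_wasserstein (@circle_dist R) p (@axis_slice R) mu nu).
Proof.
have E : slice_wasserstein (@circle_dist R) p (@axis_slice R) mu nu = EFin \o w mu nu.
  apply/funext => z; rewrite /= /w fineK//.
  exact: (slice_wasserstein_fin_num (circle_coord_metric R) p1 mA).
rewrite E; apply/measurable_EFinP.
exact: (measurable_seq_continuous (countable_excluded mu nu) (@w_seq_continuous mu nu)).
Qed.

(** If the integrand were positive at an axis that is not excluded, it would be so
    in a whole ball up to countably many axes, and balls have positive measure. *)
Lemma axis_wasserstein_eq0 (mu nu : probability (sphere R) R) (N : set (sphere R)) :
  measurable N -> @sphere_measure R N = 0%E ->
  (forall z, ~ N z -> slice_wasserstein (@circle_dist R) p (@axis_slice R) mu nu z = 0%E) ->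
  forall z, ~ excluded mu nu z ->
    slice_wasserstein (@circle_dist R) p (@axis_slice R) mu nu z = 0%E.
Proof.
move=> mN N0 WN z nC.
have Wfin := slice_wasserstein_fin_num (circle_coord_metric R) p1 mA mu nu z.
apply: contrapT => W0.
have wz : 0 < w mu nu z.
  rewrite /w fine_gt0//; apply/andP; split; last by rewrite -ge0_fin_numE// slice_wasserstein_ge0.
  by rewrite lt0e slice_wasserstein_ge0 andbT; exact/eqP.
have [e e0 he] := seq_continuous_ball (@w_seq_continuous mu nu) nC wz.
have np : ~ pole z by move=> pz; apply: nC; left.
have cC := countable_excluded mu nu; have mC := measurable_countable_sphere cC.
have /eqP := sphere_measure_coord_ball np e0; apply.
apply: (@subset_measure0 _ _ _ (@sphere_measure R) _ (N `|` excluded mu nu)).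
- by apply: sub_sigma_algebra; exact: open_coord_ball.
- exact: measurableU.
- move=> z' bz'; have [|nC'] := pselect (excluded mu nu z'); first by right.
  left; apply: contrapT => /WN h; have := he z' bz' nC'.
  by rewrite /w h ltxx.
- by apply: null_set_setU => //; exact: sphere_measure_countable.
Qed.

End SphereMeasure.

(** * Injectivity of the semicircle transform *)

Section DotAlgebra.
Context (R : realType).
Implicit Types u v w : 'cV[R]_3.

Lemma dotC u v : dot u v = dot v u.
Proof. by rewrite /dot; ring. Qed.

Lemma dot_comb u (a b : R) v w :
  dot u (a *: v + b *: w) = a * dot u v + b * dot u w.
Proof. by rewrite /dot !mxE; ring. Qed.

(** Polarization of [frame_unit]. *)
Lemma dot_frame_expand (a b : R) v w : dot v w =
  dot (frame0 a b) v * dot (frame0 a b) w +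
  dot (frame1 a b) v * dot (frame1 a b) w +
  dot (Phi a b) v * dot (Phi a b) w.
Proof.
have hv := frame_unit a b v; have hw := frame_unit a b w.
have hvw := frame_unit a b (1 *: v + 1 *: w).
rewrite !dot_comb !mxE in hvw.
move: (dot (frame0 a b) v) (dot (frame1 a b) v) (dot (Phi a b) v)
  (dot (frame0 a b) w) (dot (frame1 a b) w) (dot (Phi a b) w) hv hw hvw
  => x y z x' y' z' hv hw hvw.
rewrite /dot; apply: (@mulfI R 2); first by rewrite pnatr_eq0.
transitivity ((1 * v 0 0 + 1 * w 0 0) ^+ 2 + (1 * v 1 0 + 1 * w 1 0) ^+ 2 +
  (1 * v 2 0 + 1 * w 2 0) ^+ 2 - (v 0 0 ^+ 2 + v 1 0 ^+ 2 + v 2 0 ^+ 2) -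
  (w 0 0 ^+ 2 + w 1 0 ^+ 2 + w 2 0 ^+ 2)); first by ring.
by rewrite -hvw -hv -hw; ring.
Qed.

(** The direction [e] will be the centre of a hemisphere, [f] and [g] the axes of the
    tangent plane at [e]. *)
Record orthonormal_frame (e f g : 'cV[R]_3) : Prop := OrthonormalFrame {
  of_ff : dot f f = 1; of_gg : dot g g = 1; of_fg : dot f g = 0;
  of_ef : dot e f = 0; of_eg : dot e g = 0;
  of_complete : forall v i,
    v i 0 = dot e v * e i 0 + dot f v * f i 0 + dot g v * g i 0 }.

End DotAlgebra.

Section SemicircleInjectivity.
Context (R : realType) (p : R).
Hypothesis p1 : 1 <= p.
Context (mu nu : probability (sphere R) R).
Hypothesis W0 : forall z, ~ excluded mu nu z ->
  slice_wasserstein (@circle_dist R) p (@axis_slice R) mu nu z = 0%E.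
Implicit Types (z xi : sphere R).

Let cosA z xi := circle_cos (axis_slice z xi).
Let sinA z xi := circle_sin (axis_slice z xi).

Let mA z : measurable_fun setT (axis_slice z).
Proof. exact: measurable_semicircle. Qed.

Let mc z : measurable_fun setT (cosA z).
Proof. exact: (measurableT_comp (@measurable_circle_cos R) (mA z)). Qed.

Let ms z : measurable_fun setT (sinA z).
Proof. exact: (measurableT_comp (@measurable_circle_sin R) (mA z)). Qed.

Lemma same_azimuth_law z (A : set (R * R)) : ~ excluded mu nu z -> measurable A ->
  mu ((fun xi => (cosA z xi, sinA z xi)) @^-1` A) =
  nu ((fun xi => (cosA z xi, sinA z xi)) @^-1` A).
Proof.
move=> nC mAA.
have key (g : R -> R) u v : measurable_fun setT g ->
    (forall x y, `|g x - g y| <= `|x - y|) ->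
    \int[mu]_xi (\1_setT xi * g (u * cosA z xi + v * sinA z xi)) =
    \int[nu]_xi (\1_setT xi * g (u * cosA z xi + v * sinA z xi)).
  move=> mg gL.
  have mf : measurable_fun setT (fun x : circle R => g (u * circle_cos x + v * circle_sin x)).
    apply: measurableT_comp => //; apply: measurable_funD; apply: measurable_funM => //.
      exact: measurable_circle_cos.
    exact: measurable_circle_sin.
  have fL (x y : circle R) : `|g (u * circle_cos x + v * circle_sin x) -
      g (u * circle_cos y + v * circle_sin y)| <= (`|u| + `|v|) * circle_dist x y.
    rewrite (le_trans (gL _ _))// opprD addrACA -!mulrBr (le_trans (ler_normD _ _))//.
    by rewrite !normrM mulrDl lerD// ler_wpM2l// ?circle_cos_lipschitz ?circle_sin_lipschitz.
  have := wasserstein0_same_integral (circle_coord_metric R) p1 (mA z) (W0 nC) mf fL.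
  have E (m : probability (sphere R) R) :
      \int[m]_xi (\1_setT xi * g (u * cosA z xi + v * sinA z xi)) =
      \int[m]_xi g (u * circle_cos (axis_slice z xi) + v * circle_sin (axis_slice z xi)).
    by apply: eq_Rintegral => xi _; rewrite indicT mul1r.
  by rewrite !E.
have := @cramer_wold _ _ R mu nu (cosA z) (sinA z) (mc z) (ms z) setT A measurableT mAA.
rewrite !setTI; apply => u v; apply: key.
- by apply: continuous_measurable_fun; exact: continuous_cos.
- exact: cos_lipschitz.
- by apply: continuous_measurable_fun; exact: continuous_sin.
- exact: sin_lipschitz.
Qed.

(** Coincides with the inverse at positive arguments, the only ones that matter
    below; as a power function it is measurable. *)
Let rinv (x : R) := x `^ (-1).

Let measurable_rinv d (T : measurableType d) (f : T -> R) :
  measurable_fun setT f -> measurable_fun setT (fun t => rinv (f t)).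
Proof. exact: (@measurableT_comp _ _ _ _ _ _ (@powR R ^~ (-1))). Qed.

Let rinvE x : 0 < x -> rinv x = x^-1.
Proof. by move=> x0; rewrite /rinv powR_inv1// ltW. Qed.

Let hemi (e : 'cV[R]_3) : set (sphere R) := [set xi : sphere R | 0 < dot e (val xi)].

Let mhemi e : measurable (hemi e).
Proof.
rewrite (_ : hemi e = (fun xi : sphere R => dot e (val xi)) @^-1` `]0, +oo[).
  by apply: measurable_preimage => //; exact: measurable_dot.
by apply/seteqP; split => xi /=; rewrite in_itv/= andbT.
Qed.

Let hemiE e xi : (\1_(hemi e) xi : R) = (0 < dot e (val xi))%R%:R.
Proof. by rewrite indicE; congr ((nat_of_bool _)%:R); apply/idP/idP; rewrite inE. Qed.

(** On the hemisphere centred at [e] the quotient [dot w xi / dot e xi] is a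
    function of the azimuth of [xi] about any axis orthogonal to [e] and [w]: both
    scalar products are the same multiple of a linear form in the cosine and the
    sine of the azimuth. *)
Lemma lune_integrals (e w : 'cV[R]_3) z (g : R -> R) : ~ excluded mu nu z ->
  dot (val z) e = 0 -> dot (val z) w = 0 ->
  measurable_fun setT g -> (forall t, `|g t| <= 1) ->
  \int[mu]_xi (\1_(hemi e) xi * g (dot w (val xi) * rinv (dot e (val xi)))) =
  \int[nu]_xi (\1_(hemi e) xi * g (dot w (val xi) * rinv (dot e (val xi)))).
Proof.
move=> nC ze zw mg g1.
have np : ~ pole z by move=> h; apply: nC; left.
set a := repr (azi (val z)); set b := polar (val z).
have PhiE : Phi a b = val z by exact: Phi_axis.
pose q0 := dot (frame0 a b) e; pose q1 := dot (frame1 a b) e.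
pose r0 := dot (frame0 a b) w; pose r1 := dot (frame1 a b) w.
pose S : set (R * R) := [set y | 0 < q0 * y.1 + q1 * y.2].
have mlin (c d : R) : measurable_fun setT (fun y : R * R => c * y.1 + d * y.2).
  by apply: measurable_funD; exact: measurable_funM.
have mS : measurable S.
  rewrite (_ : S = (fun y : R * R => q0 * y.1 + q1 * y.2) @^-1` `]0, +oo[).
    exact: measurable_preimage.
  by apply/seteqP; split => y /=; rewrite in_itv/= andbT.
pose F (y : R * R) := \1_S y * g ((r0 * y.1 + r1 * y.2) * rinv (q0 * y.1 + q1 * y.2)).
have bF : bounded_measurable F.
  apply: bounded_measurableM; first exact: bounded_measurable_indic.
  split; last by exists 1.
  by apply: measurableT_comp => //; apply: measurable_funM => //; exact: measurable_rinv.
have bG : bounded_measurable (fun xi : sphere R =>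
    \1_(hemi e) xi * g (dot w (val xi) * rinv (dot e (val xi)))).
  apply: bounded_measurableM; first exact: bounded_measurable_indic.
  split; last by exists 1.
  apply: measurableT_comp => //; apply: measurable_funM; first exact: measurable_dot.
  by apply: measurable_rinv; exact: measurable_dot.
have mcs : measurable_fun setT (fun xi => (cosA z xi, sinA z xi)).
  exact: measurable_fun_pair.
have E (m : probability (sphere R) R) : m [set xi | dot (val z) (val xi) ^+ 2 = 1] = 0%E ->
    \int[m]_xi (\1_(hemi e) xi * g (dot w (val xi) * rinv (dot e (val xi)))) =
    \int[m]_xi F (cosA z xi, sinA z xi).
  move=> m0; rewrite /Rintegral; congr fine; apply: ae_eq_integral => //.
  - by apply/measurable_EFinP; case: bG.
  - apply/measurable_EFinP; case: bF => mF _; exact: (measurableT_comp mF mcs).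
  exists [set xi | dot (val z) (val xi) ^+ 2 = 1]; split => //.
    have m' : measurable_fun setT (fun xi : sphere R => dot (val z) (val xi) ^+ 2).
      by apply: measurable_funX; exact: measurable_dot.
    exact: (measurable_preimage m' (measurable_set1 1)).
  move=> xi /= h; apply: contrapT => /eqP xi1; apply: h => _; congr EFin.
  have D0 : 0 < 1 - dot (val z) (val xi) ^+ 2.
    rewrite -PhiE -frame_radius lt0r addr_ge0 ?sqr_ge0// andbT frame_radius PhiE.
    by rewrite subr_eq0 eq_sym.
  have s0 : 0 < Num.sqrt (1 - dot (val z) (val xi) ^+ 2) by rewrite sqrtr_gt0.
  have cE : cosA z xi = dot (frame0 a b) (val xi) / Num.sqrt (1 - dot (val z) (val xi) ^+ 2).
    by rewrite /cosA /axis_slice semicircle_cosE -/a -/b PhiE gt_eqF// addr0.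
  have sE : sinA z xi = dot (frame1 a b) (val xi) / Num.sqrt (1 - dot (val z) (val xi) ^+ 2).
    by rewrite /sinA /axis_slice semicircle_sinE -/a -/b PhiE.
  move: s0 cE sE; set s := Num.sqrt _ => s0 cE sE.
  have lin (x y u v : R) : x * (u / s) + y * (v / s) = (x * u + y * v) / s by ring.
  have eE : q0 * cosA z xi + q1 * sinA z xi = dot e (val xi) / s.
    by rewrite (dot_frame_expand a b e) PhiE ze mul0r addr0 cE sE lin.
  have wE : r0 * cosA z xi + r1 * sinA z xi = dot w (val xi) / s.
    by rewrite (dot_frame_expand a b w) PhiE zw mul0r addr0 cE sE lin.
  rewrite /F /= eE wE hemiE indicE.
  have -> : ((cosA z xi, sinA z xi) \in S) = (0 < dot e (val xi)).
    apply/idP/idP => [/set_mem|h].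
      by rewrite /S/= eE pmulr_lgt0 ?invr_gt0.
    by apply/mem_set; rewrite /S/= eE pmulr_lgt0 ?invr_gt0.
  have [e0|e0] := ltP 0 (dot e (val xi)); last by rewrite !mul0r.
  rewrite !rinvE ?divr_gt0// invf_div mulrA; congr (_ * g _).
  by rewrite divfK// gt_eqF.
rewrite !E; last 2 first.
- by apply: contrapT => /eqP h; apply: nC; right; right.
- by apply: contrapT => /eqP h; apply: nC; right; left.
apply: Rintegral_same_law => // A mAA; exact: same_azimuth_law.
Qed.

Section Hemisphere.
Context (e f g : 'cV[R]_3).
Hypothesis efg : orthonormal_frame e f g.

Let ff := of_ff efg. Let gg := of_gg efg. Let fg := of_fg efg.
Let ef := of_ef efg. Let eg := of_eg efg.

(** The axis orthogonal to [e] and to [cos s *: f + sin s *: g]. *)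
Let nvec (s : R) : 'cV[R]_3 := (- sin s) *: f + cos s *: g.

Let nvec_unit s : nvec s \in @unit_sphere R.
Proof.
rewrite inE /unit_sphere/=.
transitivity (dot (nvec s) (nvec s)); first by rewrite /dot; ring.
rewrite {2}/nvec dot_comb ![dot (nvec s) _]dotC !dot_comb [dot g f]dotC ff gg fg.
by rewrite -[RHS](cos2Dsin2 s); ring.
Qed.

Let nsph s : sphere R := exist (fun v => v \in @unit_sphere R) _ (nvec_unit s).

Let dot_nsph s v : dot (val (nsph s)) v = - sin s * dot f v + cos s * dot g v.
Proof. by rewrite /= dotC dot_comb ![dot v _]dotC. Qed.

(** On an interval of length at most 1 the axis determines the direction, so that
    only countably many directions there have an excluded axis. *)
Lemma good_direction (o d : R) : 0 < d ->
  exists2 s, o < s < o + d & ~ excluded mu nu (nsph s).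
Proof.
move=> d0; apply: contrapT => H.
pose d' := Num.min d 1.
have d'0 : 0 < d' by rewrite lt_min d0 ltr01.
have sub s : `]o, (o + d')%R[%classic s -> excluded mu nu (nsph s).
  rewrite /= in_itv/= => /andP[os sd]; apply: contrapT => nC; apply: H; exists s => //.
  by rewrite os (lt_le_trans sd)// lerD2l ge_min lexx.
have : countable (`]o, (o + d')%R[%classic : set R).
  have /countable_injP[h hi] := countable_excluded mu nu.
  apply/countable_injP; exists (h \o nsph) => s t; rewrite !inE => hs ht /= hst.
  have nE : nsph s = nsph t by apply: hi => //; rewrite inE; exact: sub.
  have cE : cos s = cos t.
    have : dot (val (nsph s)) g = dot (val (nsph t)) g by rewrite nE.
    by rewrite !dot_nsph gg fg !mulr0 !add0r !mulr1.
  have sE : sin s = sin t.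
    have : dot (val (nsph s)) f = dot (val (nsph t)) f by rewrite nE.
    by rewrite !dot_nsph ff [dot g f]dotC fg !mulr0 !addr0 !mulr1 => /oppr_inj.
  have /to_circleP[k kE] : to_circle s = to_circle t.
    by apply: circle_eq_cos_sin; rewrite ?circle_cosE ?circle_sinE.
  have st1 : `|s - t| < 1.
    move: hs ht; rewrite /= !in_itv/= => /andP[s1 s2] /andP[t1 t2].
    have d1 : d' <= 1 by rewrite ge_min lexx orbT.
    by rewrite ltr_norml; apply/andP; split; lra.
  have [k0|k0] := eqVneq k 0; first by apply/eqP; rewrite -subr_eq0 kE k0 mulr0.
  move: st1; rewrite kE normrM -intr_norm gtr0_norm ?mulr_gt0 ?pi_gt0// ltNge => /negP[].
  have k1 : 1 <= `|k|%:~R :> R by rewrite -[1]/(1%:~R) ler_int -gtz0_ge1 normr_gt0.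
  have pi2 := pi_ge2 R.
  by rewrite -[leLHS]mulr1 ler_pM//; lra.
move=> /countable_lebesgue_measure0; rewrite lebesgue_measure_itv/= lte_fin ltrDl d'0.
move/eqP; rewrite -EFinB eqe addrAC subrr add0r => /eqP d'E.
by move: d'0; rewrite d'E ltxx.
Qed.

(** Gnomonic coordinates on the hemisphere. *)
Let X (xi : sphere R) := dot f (val xi) * rinv (dot e (val xi)).
Let Y (xi : sphere R) := dot g (val xi) * rinv (dot e (val xi)).

Let mX : measurable_fun setT X.
Proof.
apply: measurable_funM; first exact: measurable_dot.
by apply: measurable_rinv; exact: measurable_dot.
Qed.

Let mY : measurable_fun setT Y.
Proof.
apply: measurable_funM; first exact: measurable_dot.
by apply: measurable_rinv; exact: measurable_dot.
Qed.

(** The linear form [u * X + v * Y] is a quotient as in [lune_integrals].  If its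
    axis is excluded, the angle is approximated by angles whose axes are not. *)
Lemma gnomonic_integrals (G : R -> R) (u v : R) : continuous G ->
  (forall t, `|G t| <= 1) ->
  \int[mu]_xi (\1_(hemi e) xi * G (u * X xi + v * Y xi)) =
  \int[nu]_xi (\1_(hemi e) xi * G (u * X xi + v * Y xi)).
Proof.
move=> cG G1; have mG : measurable_fun setT G by exact: continuous_measurable_fun.
have [t [om [-> ->]]] := polar_coordinates u v.
have key s : ~ excluded mu nu (nsph s) ->
    \int[mu]_xi (\1_(hemi e) xi * G (t * cos s * X xi + t * sin s * Y xi)) =
    \int[nu]_xi (\1_(hemi e) xi * G (t * cos s * X xi + t * sin s * Y xi)).
  move=> nC; pose w := (t * cos s) *: f + (t * sin s) *: g.
  have E (m : probability (sphere R) R) :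
      \int[m]_xi (\1_(hemi e) xi * G (t * cos s * X xi + t * sin s * Y xi)) =
      \int[m]_xi (\1_(hemi e) xi * G (dot w (val xi) * rinv (dot e (val xi)))).
    apply: eq_Rintegral => xi _; congr (_ * G _).
    by rewrite [dot w _]dotC dot_comb ![dot (val xi) _]dotC mulrDl /X /Y !mulrA.
  rewrite !E; apply: (@lune_integrals e w (nsph s)) => //.
    by rewrite dot_nsph [dot f e]dotC [dot g e]dotC ef eg !mulr0 addr0.
  by rewrite dot_comb !dot_nsph [dot g f]dotC ff gg fg; ring.
have /choice[s hs] : forall n, exists s, (om < s < om + n.+1%:R^-1) /\ ~ excluded mu nu (nsph s).
  move=> n; have n0 : 0 < n.+1%:R^-1 :> R by rewrite invr_gt0.
  by have [s ? ?] := good_direction om n0; exists s.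
have so : s @ \oo --> om.
  apply: (@cvg_of_le_harmonic _ _ _ 1) => n; have [/andP[a b] _] := hs n.
  by rewrite div1r gtr0_norm ?subr_gt0// ltW// ltrBlDl.
have cs : (fun n => cos (s n)) @ \oo --> cos om by exact: (cvg_comp _ _ so (@continuous_cos R om)).
have ss : (fun n => sin (s n)) @ \oo --> sin om by exact: (cvg_comp _ _ so (@continuous_sin R om)).
have L (m : probability (sphere R) R) :
    (fun n => \int[m]_xi (\1_(hemi e) xi * G (t * cos (s n) * X xi + t * sin (s n) * Y xi)))
    @ \oo --> \int[m]_xi (\1_(hemi e) xi * G (t * cos om * X xi + t * sin om * Y xi)).
  apply: (@cvg_Rintegral _ _ _ m (fun n xi =>
    \1_(hemi e) xi * G (t * cos (s n) * X xi + t * sin (s n) * Y xi)) _ 1).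
  - move=> n; apply: measurable_funM; first exact: measurable_indic.
    by apply: measurableT_comp => //; apply: measurable_funD; exact: measurable_funM.
  - move=> n xi; rewrite normrM mulr_ile1// hemiE.
    by case: (0 < _); rewrite ?normr1 ?normr0.
  - move=> xi; apply: cvgMr.
    have c : (fun n => t * cos (s n) * X xi + t * sin (s n) * Y xi) @ \oo -->
        t * cos om * X xi + t * sin om * Y xi.
      by apply: cvgD; apply: cvgMl; apply: cvgMr.
    exact: (cvg_comp _ _ c (cG _)).
have Eq : (fun n => \int[mu]_xi (\1_(hemi e) xi * G (t * cos (s n) * X xi + t * sin (s n) * Y xi))) =
  (fun n => \int[nu]_xi (\1_(hemi e) xi * G (t * cos (s n) * X xi + t * sin (s n) * Y xi))).
  by apply/funext => n; apply: key; have [] := hs n.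
have Lmu := L mu; rewrite Eq in Lmu; exact: cvg_unique Lmu (L nu).
Qed.

(** The inverse of the gnomonic projection normalizes [e + x *: f + y *: g]. *)
Lemma agree_on_hemisphere : agree_on mu nu (hemi e).
Proof.
pose F (y : R * R) : 'cV[R]_3 := \col_i ((e i 0 + y.1 * f i 0 + y.2 * g i 0) *
  (Num.sqrt (1 + y.1 ^+ 2 + y.2 ^+ 2))^-1).
apply: (@agree_on_chart R mu nu (hemi e) X Y F) => //.
- move=> i; rewrite (_ : (fun y => F y i 0) = fun y =>
    (e i 0 + y.1 * f i 0 + y.2 * g i 0) * (Num.sqrt (1 + y.1 ^+ 2 + y.2 ^+ 2))^-1).
    apply: measurable_funM.
      apply: measurable_funD; last exact: measurable_funM.
      by apply: measurable_funD => //; exact: measurable_funM.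
    apply: measurable_sqrt_inv; apply: measurable_funD; last exact: measurable_funX.
    by apply: measurable_funD => //; exact: measurable_funX.
  by apply/funext => y; rewrite mxE.
- move=> xi /= e0; apply/colP => i; rewrite mxE /X /Y /= rinvE//.
  set E := dot e (val xi) in e0 *; set Fx := dot f (val xi); set Gx := dot g (val xi).
  have En0 : E != 0 by rewrite gt_eqF.
  have n1 : E ^+ 2 + Fx ^+ 2 + Gx ^+ 2 = 1.
    rewrite -(sphere_sqr xi).
    have h i' := of_complete efg (val xi) i'; rewrite -/E -/Fx -/Gx in h.
    transitivity (E * dot e (val xi) + Fx * dot f (val xi) + Gx * dot g (val xi)).
      by rewrite -/E -/Fx -/Gx !expr2.
    transitivity (val xi 0 0 * (E * e 0 0 + Fx * f 0 0 + Gx * g 0 0) +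
      val xi 1 0 * (E * e 1 0 + Fx * f 1 0 + Gx * g 1 0) +
      val xi 2 0 * (E * e 2 0 + Fx * f 2 0 + Gx * g 2 0)); last first.
      by rewrite -!h !expr2.
    by rewrite /dot; move: E Fx Gx {En0 e0 h} => E Fx Gx; ring.
  have -> : 1 + (Fx * E^-1) ^+ 2 + (Gx * E^-1) ^+ 2 = (E^-1) ^+ 2.
    transitivity ((E ^+ 2 + Fx ^+ 2 + Gx ^+ 2) / E ^+ 2); first by field.
    by rewrite n1 exprVn mul1r.
  rewrite sqrtr_sqr gtr0_norm ?invr_gt0// invrK.
  by rewrite [RHS](of_complete efg) -/E -/Fx -/Gx; field.
- by move=> u v; apply: gnomonic_integrals; [exact: continuous_cos|exact: cos_max].
- by move=> u v; apply: gnomonic_integrals; [exact: continuous_sin|exact: sin_max].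
Qed.

End Hemisphere.

Lemma semicircle_measure_eq : measure_eq mu nu.
Proof.
have frame_at0 (s : R) : s ^+ 2 = 1 -> orthonormal_frame (vec3 s 0 0) (vec3 0 1 0) (vec3 0 0 1).
  move=> s2; split; rewrite /dot ?mxE /=; try ring.
  move=> v -[[|[|[|//]]] hi]; rewrite !mxE/=.
  - have -> : Ordinal hi = 0 by exact: val_inj.
    by transitivity (s ^+ 2 * v 0 0); [rewrite s2 mul1r|ring].
  - by have -> : Ordinal hi = 1; [exact: val_inj|ring].
  - by have -> : Ordinal hi = 2; [exact: val_inj|ring].
have frame_at1 (s : R) : s ^+ 2 = 1 -> orthonormal_frame (vec3 0 s 0) (vec3 1 0 0) (vec3 0 0 1).
  move=> s2; split; rewrite /dot ?mxE /=; try ring.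
  move=> v -[[|[|[|//]]] hi]; rewrite !mxE/=.
  - by have -> : Ordinal hi = 0; [exact: val_inj|ring].
  - have -> : Ordinal hi = 1 by exact: val_inj.
    by transitivity (s ^+ 2 * v 1 0); [rewrite s2 mul1r|ring].
  - by have -> : Ordinal hi = 2; [exact: val_inj|ring].
have frame_at2 (s : R) : s ^+ 2 = 1 -> orthonormal_frame (vec3 0 0 s) (vec3 1 0 0) (vec3 0 1 0).
  move=> s2; split; rewrite /dot ?mxE /=; try ring.
  move=> v -[[|[|[|//]]] hi]; rewrite !mxE/=.
  - by have -> : Ordinal hi = 0; [exact: val_inj|ring].
  - by have -> : Ordinal hi = 1; [exact: val_inj|ring].
  - have -> : Ordinal hi = 2 by exact: val_inj.
    by transitivity (s ^+ 2 * v 2 0); [rewrite s2 mul1r|ring].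
have one2 : (1 : R) ^+ 2 = 1 by rewrite expr1n.
have mone2 : (-1 : R) ^+ 2 = 1 by rewrite sqrrN expr1n.
have aU (e e' : 'cV[R]_3) : agree_on mu nu (hemi e) -> agree_on mu nu (hemi e') ->
    agree_on mu nu (hemi e `|` hemi e').
  exact: agree_onU.
have a0 := aU _ _ (agree_on_hemisphere (frame_at0 1 one2)) (agree_on_hemisphere (frame_at0 (-1) mone2)).
have a1 := aU _ _ (agree_on_hemisphere (frame_at1 1 one2)) (agree_on_hemisphere (frame_at1 (-1) mone2)).
have a2 := aU _ _ (agree_on_hemisphere (frame_at2 1 one2)) (agree_on_hemisphere (frame_at2 (-1) mone2)).
have a01 := agree_onU (measurableU _ _ (mhemi _) (mhemi _)) (measurableU _ _ (mhemi _) (mhemi _)) a0 a1.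
have a012 := agree_onU (measurableU _ _ (measurableU _ _ (mhemi _) (mhemi _))
  (measurableU _ _ (mhemi _) (mhemi _))) (measurableU _ _ (mhemi _) (mhemi _)) a01 a2.
apply: (agree_on_cover a012) => xi.
have sgn (x : R) : x != 0 -> 0 < x \/ 0 < - x.
  by move=> x0; rewrite oppr_gt0; case: (ltgtP x 0) x0 => // h; [right|left].
have [x0|/sgn x0] := eqVneq (val xi 0 0) 0; last first.
  left; left; rewrite /hemi/= /dot !mxE/=.
  by case: x0 => h; [left|right]; rewrite !mul0r !addr0 ?mul1r ?mulN1r.
have [y0|/sgn y0] := eqVneq (val xi 1 0) 0; last first.
  left; right; rewrite /hemi/= /dot !mxE/=.
  by case: y0 => h; [left|right]; rewrite !mul0r addr0 add0r ?mul1r ?mulN1r.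
have /sgn z0 : val xi 2 0 != 0.
  apply/eqP => z0; have := sphere_sqr xi; rewrite x0 y0 z0 expr0n/= !addr0 => /eqP.
  by rewrite eq_sym oner_eq0.
right; rewrite /hemi/= /dot !mxE/=.
by case: z0 => h; [left|right]; rewrite !mul0r !add0r ?mul1r ?mulN1r.
Qed.

End SemicircleInjectivity.

Theorem SSW_metric (R : realType) (p : R) : 1 <= p ->
  is_metric_on [set: probability (sphere R) R] (SSW p).
Proof.
move=> p1.
have mA (z : sphere R) : measurable_fun setT (axis_slice z) by exact: measurable_semicircle.
rewrite (_ : SSW p = sliced_wasserstein (@circle_dist R) p (@sphere_measure R) (@axis_slice R)) //.
apply: (sliced_wasserstein_metric (circle_coord_metric R) p1 (@sphere_measure_fin R) mA).
- by move=> mu nu _ _; exact: measurable_axis_wasserstein.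
- move=> mu nu N _ _ mN N0 WN; apply: (semicircle_measure_eq p1).
  by move=> z nC; exact: (axis_wasserstein_eq0 p1 mN N0 WN nC).
Qed.

Theorem theorem5p1 (R : realType) (p : R) (p_ge1 : 1 <= p) :
  is_metric_on (@even_probability R) (VSW p) /\
  is_metric_on [set: probability (sphere R) R] (SSW p).
Proof. by split; [exact: VSW_metric|exact: SSW_metric]. Qed.
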